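(* Let $(V,X,(S_i)_{i=1,\ldots,N})$ be a conformal iterated function system in $\mathbb R^d$ in which all maps $S_1,\ldots,S_N$ are contracting similarities, let $r_i$ be the contraction ratio of $S_i$, and let $K$ be the associated self-similar set. Let $(p_1,\ldots,p_N)$ be a probability vector with all $p_i>0$ and let $\mu$ be the unique probability measure with $\mu=\sum_ip_i\,\mu\circ S_i^{-1}$. For closed $C\subseteq\mathbb R$, $r>0$ and $\alpha\in\mathbb R$ define $$\zeta_C^{\mathrm{sim}}(s)=\sum_{\mathbf i\in\Sigma^*,\ \frac{\log p_{\mathbf i}}{\log\operatorname{diam}K_{\mathbf i}}\in C}r_{\mathbf i}^s,\qquad \zeta_C^{\mathrm{sim}}(s;r)=\sum_{\mathbf i\in\Sigma^*,\ \operatorname{dist}\left(\frac{\log p_{\mathbf i}}{\log\operatorname{diam}K_{\mathbf i}},C\right)\le r}r_{\mathbf i}^s,$$ and $\zeta_\alpha^{\mathrm{sim}}(s;r)=\zeta_{\{\alpha\}}^{\mathrm{sim}}(s;r)$. Define $\beta:\mathbb R\to\mathbb R$ by $\sum_ip_i^qr_i^{\beta(q)}=1$ for $q\in\mathbb R$. Let $C$ be a closed subset of $\mathbb R$. Then: (1.1) $\displaystyle\lim_{r\searrow0}\sigma_{\mathrm{ab}}(\zeta_C^{\mathrm{sim}}(\cdot;r))=\sup_{\alpha\in C}\beta^*(\alpha)$. In particular, if $\alpha\in\mathbb R$, then $\displaystyle\lim_{r\searrow0}\sigma_{\mathrm{ab}}(\zeta_\alpha^{\mathrm{sim}}(\cdot;r))=\beta^*(\alpha)$.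 (1.2) If the OSC is satisfied, then $$\lim_{r\searrow0}\sigma_{\mathrm{ab}}(\zeta_C^{\mathrm{sim}}(\cdot;r))=\sup_{\alpha\in C}\dim_{\mathrm H}\Big\{x\in K:\lim_{r\searrow0}\tfrac{\log\mu(B(x,r))}{\log r}=\alpha\Big\}=\dim_{\mathrm H}\Big\{x\in K:\operatorname*{acc}_{r\searrow0}\tfrac{\log\mu(B(x,r))}{\log r}\subseteq C\Big\}.$$ In particular, if the OSC is satisfied and $\alpha\in\mathbb R$, then $\displaystyle\lim_{r\searrow0}\sigma_{\mathrm{ab}}(\zeta_\alpha^{\mathrm{sim}}(\cdot;r))=\dim_{\mathrm H}\{x\in K:\lim_{r\searrow0}\tfrac{\log\mu(B(x,r))}{\log r}=\alpha\}$. (2.1) If $C$ is an interval and $\overset{\circ}{C}\cap\big(\min_i\frac{\log p_i}{\log r_i},\max_i\frac{\log p_i}{\log r_i}\big)\ne\varnothing$, then $\sigma_{\mathrm{ab}}(\zeta_C^{\mathrm{sim}})=\sup_{\alpha\in C}\beta^*(\alpha)$. (2.2) If $C$ is an interval, $\overset{\circ}{C}\cap\big(\min_i\frac{\log p_i}{\log r_i},\max_i\frac{\log p_i}{\log r_i}\big)\ne\varnothing$ and the OSC is satisfied, then $$\sigma_{\mathrm{ab}}(\zeta_C^{\mathrm{sim}})=\sup_{\alpha\in C}\dim_{\mathrm H}\Big\{x\in K:\lim_{r\searrow0}\tfrac{\log\mu(B(x,r))}{\log r}=\alpha\Big\}=\dim_{\mathrm H}\Big\{x\in K:\operatorname*{acc}_{r\searrow0}\tfrac{\log\mu(B(x,r))}{\log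 r}\subseteq C\Big\}.$$
   Context: $\Sigma^*$ is the set of finite strings $i_1\ldots i_n$ ($n\ge1$) over $\{1,\ldots,N\}$. For $\mathbf i=i_1\ldots i_n$: $p_{\mathbf i}=p_{i_1}\cdots p_{i_n}$, $r_{\mathbf i}=r_{i_1}\cdots r_{i_n}$, $S_{\mathbf i}=S_{i_1}\circ\cdots\circ S_{i_n}$, $K_{\mathbf i}=S_{\mathbf i}K$. Conformal iterated function system (here with similarities): $V\subseteq\mathbb R^d$ is open and connected; $X\subseteq V$ is compact and equals the closure of its interior; $S_i:V\to V$ with $S_iX\subseteq X$ for all $i$. $K$ is the unique non-empty compact $K\subseteq X$ with $K=\bigcup_iS_iK$. Open Set Condition (OSC): there is an open, non-empty, bounded set $O\subseteq X$ with $S_iO\subseteq O$ for all $i$ and $S_iO\cap S_jO=\varnothing$ for $i\ne j$. Legendre transform: $\varphi^*(x)=\inf_y(xy+\varphi(y))$. $\overset{\circ}{C}$ is the interior of $C$; $B(x,r)$ is the ball with center $x$ and radius $r$. $\operatorname{acc}_{r\searrow0}\varphi(r)$ is the set of accumulation points of $\varphi(r)$ as $r\searrow0$. $\dim_{\mathrm H}$ is Hausdorff dimension, with $\dim_{\mathrm H}\varnothing=-\infty$ and $\sup\varnothing=-\infty$. Zeta-functions are defined for those complex $s$ for which the series converges absolutely. For $\zeta(s)=\sum_{\mathbf i}a_{\mathbf i}^s$ with $a_{\mathbf i}>0$, $\sigma_{\mathrm{ab}}(\zeta)=\inf\{t\in\mathbb R:\sum_{\mathbf i}a_{\mathbf i}^t\text{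 converges absolutely}\}$. *)

(* Defs.v *)
From mathcomp Require Import all_boot all_order all_algebra.
From mathcomp Require Import all_classical all_reals all_analysis.

Set Implicit Arguments.
Unset Strict Implicit.
Unset Printing Implicit Defensive.

Import Order.TTheory GRing.Theory Num.Theory.
Import numFieldTopology.Exports numFieldNormedType.Exports.

Local Open Scope classical_set_scope.
Local Open Scope ring_scope.

Section Euclidean.
Context {R : realType} {d : nat}.
Implicit Types (x y : 'rV[R]_d) (A : set 'rV[R]_d).

(* The norm carried by ['rV[R]_d] is the sup norm, which has the right topology
   but not the right similarities; distances below are Euclidean. *)
Definition eucl_dist x y : R := Num.sqrt (\sum_(j < d) (x 0 j - y 0 j) ^+ 2).

Definition eucl_ball x (r : R) : set 'rV[R]_d := [set y | eucl_dist x y <= r].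

(* [diam set0 = -oo]. *)
Definition diam A : \bar R :=
  ereal_sup [set (eucl_dist z.1 z.2)%:E | z in A `*` A].

(* [diam A ^ s] with [diam set0 ^ s = 0], also when [s = 0]; only used for [A]
   of finite diameter. *)
Definition diam_pow (s : R) A : \bar R :=
  if A == set0 then 0%E else ((fine (diam A)) `^ s)%:E.

Definition hausdorff_premeasure (s delta : R) A : \bar R :=
  ereal_inf [set (\sum_(0 <= n <oo) diam_pow s (E n))%E |
    E in [set E : nat -> set 'rV[R]_d |
      A `<=` \bigcup_n E n /\ forall n, (diam (E n) <= delta%:E)%E]].

Definition hausdorff_measure (s : R) A : \bar R :=
  ereal_sup [set hausdorff_premeasure s delta A | delta in [set e | 0 < e]].

Definition dimH A : \bar R :=
  if A == set0 then -oo%E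
  else ereal_inf [set s%:E | s in [set s | 0 <= s /\ hausdorff_measure s A = 0%E]].

End Euclidean.

Notation borel_rV R d := (g_sigma_algebraType (@open 'rV[R]_d)).

Definition legendre {R : realType} (phi : R -> R) (x : R) : \bar R :=
  ereal_inf [set (x * y + phi y)%:E | y in [set: R]].

Definition dist_set {R : realType} (x : R) (C : set R) : \bar R :=
  ereal_inf [set `|x - c|%:E | c in C].

Section IteratedFunctionSystem.
Context {R : realType} {d N : nat}.
Implicit Types (V X K O : set 'rV[R]_d) (S : 'I_N -> 'rV[R]_d -> 'rV[R]_d).
Implicit Types (p r : 'I_N -> R).

(* The maps are total on ['rV[R]_d] for convenience; only their values on [V]
   are meaningful. *)
Record similarity_cifs V X S r : Prop := SimilarityCIFS {
  cifs_open : open V ;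
  cifs_connected : connected V ;
  cifs_subset : X `<=` V ;
  cifs_compact : compact X ;
  cifs_regular : closure (interior X) = X ;
  cifs_stableV : forall i, S i @` V `<=` V ;
  cifs_stableX : forall i, S i @` X `<=` X ;
  cifs_ratio : forall i, 0 < r i < 1 ;
  cifs_similarity : forall i x y, V x -> V y ->
    eucl_dist (S i x) (S i y) = r i * eucl_dist x y }.

Record self_similar_set X S K : Prop := SelfSimilarSet {
  sss_nonempty : K !=set0 ;
  sss_compact : compact K ;
  sss_subset : K `<=` X ;
  sss_fixed : K = \bigcup_i (S i @` K) }.

Definition open_set_condition X S : Prop :=
  exists O, [/\ open O, O !=set0, bounded_set O, O `<=` X &
    (forall i, S i @` O `<=` O) /\
    (forall i j, i != j -> (S i @` O) `&` (S j @` O) = set0)].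

Definition probability_vector p : Prop :=
  (forall i, 0 <= p i) /\ \sum_(i < N) p i = 1.

(* Since [S i] is only meaningful as a map [V -> V], its inverse image is taken
   inside [V]; [A := setT] shows that [mu] is then concentrated on [V]. *)
Definition self_similar_measure V S p (mu : probability (borel_rV R d) R) : Prop :=
  forall A : set (borel_rV R d), measurable A ->
    mu A = (\sum_(i < N) (p i)%:E * mu (V `&` S i @^-1` A))%E.

Definition strings : set (seq 'I_N) := [set w | w != [::]].

Definition weight_string (a : 'I_N -> R) (w : seq 'I_N) : R := \prod_(i <- w) a i.

Definition map_string S (w : seq 'I_N) : 'rV[R]_d -> 'rV[R]_d :=
  foldr (fun i f => S i \o f) id w.

Definition set_string S K (w : seq 'I_N) : set 'rV[R]_d := map_string S w @` K.

(* The denominator can vanish ([diam K_w = 1]) only for finitely many strings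
   [w], which has no influence on an abscissa of convergence. *)
Definition string_exponent S K p (w : seq 'I_N) : R :=
  ln (weight_string p w) / ln (fine (diam (set_string S K w))).

End IteratedFunctionSystem.

(* The series [s |-> \sum_(w in zindex) zbase w ^ s]. Its abscissa of absolute
   convergence only involves real exponents. *)
Record zeta_series (R : realType) (I : choiceType) := ZetaSeries {
  zindex : set I ;
  zbase : I -> R }.

Definition sigma_ab {R : realType} {I : choiceType} (z : zeta_series R I) : \bar R :=
  ereal_inf [set t%:E | t in
    [set t : R | summable (zindex z) (fun w => (zbase z w `^ t)%:E)]].

Section MultifractalZeta.
Context {R : realType} {d N : nat}.
Variables (S : 'I_N -> 'rV[R]_d -> 'rV[R]_d) (r p : 'I_N -> R) (K : set 'rV[R]_d).

Definition zeta_sim (C : set R) : zeta_series R (seq 'I_N) :=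
  ZetaSeries [set w | strings w /\ C (string_exponent S K p w)]
             (weight_string r).

Definition zeta_sim_nbhd (C : set R) (rho : R) : zeta_series R (seq 'I_N) :=
  ZetaSeries
    [set w | strings w /\ (dist_set (string_exponent S K p w) C <= rho%:E)%E]
    (weight_string r).

End MultifractalZeta.

Section LocalDimension.
Context {R : realType} {d : nat}.
Variables (mu : probability (borel_rV R d) R) (K : set 'rV[R]_d).

Definition log_ratio (x : 'rV[R]_d) (rho : R) : R :=
  ln (fine (mu (eucl_ball x rho))) / ln rho.

Definition level_set (alpha : R) : set 'rV[R]_d :=
  [set x | K x /\ log_ratio x rho @[rho --> 0^'+] --> alpha].

Definition acc_set (C : set R) : set 'rV[R]_d :=
  [set x | K x /\ cluster (log_ratio x rho @[rho --> 0^'+]) `<=` C].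

End LocalDimension.

Definition min_exponent {R : realType} {N : nat} (p r : 'I_N -> R) : \bar R :=
  \big[mine/+oo%E]_(i < N) (ln (p i) / ln (r i))%:E.

Definition max_exponent {R : realType} {N : nat} (p r : 'I_N -> R) : \bar R :=
  \big[maxe/-oo%E]_(i < N) (ln (p i) / ln (r i))%:E.

(* Main.v *)
Require Import Defs.
From mathcomp Require Import all_boot all_order all_algebra.
From mathcomp Require Import finmap.
From mathcomp Require Import all_classical all_reals all_analysis.
From mathcomp Require Import ring lra.
Import Order.TTheory GRing.Theory Num.Theory.
Import numFieldTopology.Exports numFieldNormedType.Exports.
Local Open Scope classical_set_scope.
Local Open Scope ring_scope.
Set Implicit Arguments.
Unset Strict Implicit.
Unset Printing Implicit Defensive.

(** Write [r_w] and [p_w] for the products of the ratios and of the weights along a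
    word [w]. The exponent [ln p_w / ln r_w] of a word is, up to a negligible error,
    the exponent that the zeta series compare with [C]; everything rests on counting
    words by exponent, and on the identity [sum_w p_w ^ q * r_w ^ beta q = 1] over
    the words of a given length.

    Abscissas. If [t] exceeds the Legendre transform on [C], then near each point of
    [C] some [q] satisfies [qx + beta q < t]; by compactness finitely many [q]
    suffice, so every relevant [r_w ^ t] is at most a sum of finitely many
    probability weights times a decaying power of [r_w], and the series converges
    ([sigma_ab_le], [finite_certificates]). If [t] is below the Legendre transform at
    [alpha], then [sum_i r_i ^ t * exp (q * f_i) > 1] for all [q], where
    [f_i = ln p_i - alpha ln r_i]. Tilting at a critical [q] makes [f] centred, and by
    Chebyshev's inequality the words with exponent near [alpha] carry an
    exponentially large part of [sum_w r_w ^ t] ([zero_mean_weights],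
    [large_level_sum]). For an interval, concavity moves [alpha] into the interior of
    [C] at small cost ([sigma_zeta_interval]).

    Geometry. The similarities extend to the whole space ([similarity_extension]) and
    the measure is carried by [K] ([mass_compl_K]). The open set condition keeps the
    orbits of one point along incomparable words apart, so boundedly many cylinders
    of size [rho] meet a ball of radius [rho] ([cut_count]). A word [v] with the
    largest possible number of neighbours is isolating: near [K_uv] the set [K] is
    entirely coded through [u], whence [mu B <= p_u] for small balls [B] centred there
    ([isolating_word]).

    Upper bound ([dimH_acc_set_le]). At a scale where the local exponent of a point is
    near [alpha], the cylinder through it (for [q < 0]) or a heavy neighbouring one
    (for [q >= 0]) has a certificate as above. The corresponding balls cover the
    accumulation set and have summable powers of order [t].

    Lower bound ([le_dimH_level_set]). For [t] below the Legendre transform at [alpha],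
    take blocks [w ++ v] with exponents near [alpha] and [sum r_wv ^ t >= 1]. Paths of
    blocks whose exponents tend to [alpha], and whose lengths grow slowly, code points
    of local exponent exactly [alpha], because the suffix [v] isolates each cylinder.
    The weights proportional to [r_wv ^ t] give each cylinder mass at most its ratio
    to the power [t]. If the diameters of a covering had a small sum of powers of some
    order less than [t], the cylinders met by its members would have total mass less
    than [1], and a greedy path would avoid them all ([avoid_cylinders]).

    Hence the Legendre transform at [alpha] bounds the dimension of the level set from
    below, while its supremum over [C] bounds that of the accumulation set, which
    contains the level sets, from above; all quantities agree
    ([multifractal_formalism]). *)

(** * The Euclidean distance on row vectors *)

Section EuclideanDistance.
Context {R : realType} {d : nat}.
Implicit Types x y z : 'rV[R]_d.

Lemma sumr_sqr_ge0 (a : 'I_d -> R) : 0 <= \sum_j a j ^+ 2.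
Proof. by apply: sumr_ge0 => j _; exact: sqr_ge0. Qed.

Lemma sum_cauchy_schwarz (a b : 'I_d -> R) :
  (\sum_j a j * b j) ^+ 2 <= (\sum_j a j ^+ 2) * (\sum_j b j ^+ 2).
Proof.
set A := \sum_j a j ^+ 2; set B := \sum_j b j ^+ 2; set M := \sum_j a j * b j.
have A0 : 0 <= A by exact: sumr_sqr_ge0.
have B0 : 0 <= B by exact: sumr_sqr_ge0.
have H : 0 <= B * (A * B - M ^+ 2).
  have -> : B * (A * B - M ^+ 2) = \sum_j (B * a j - M * b j) ^+ 2.
    transitivity (\sum_j (B ^+ 2 * a j ^+ 2 - B * M *+ 2 * (a j * b j)
                          + M ^+ 2 * b j ^+ 2)); last first.
      by apply: eq_bigr => j _; ring.
    by rewrite !big_split /= sumrN -!mulr_sumr -/A -/B -/M; ring.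
  exact: sumr_sqr_ge0.
have [B1|B1] := ltP 0 B.
  by move: H; rewrite pmulr_rge0// subr_ge0.
have Be : B = 0 by apply/eqP; rewrite eq_le B0 B1.
suff -> : M = 0 by rewrite expr0n /= mulr_ge0.
rewrite /M big1// => j _.
have : b j ^+ 2 <= B by rewrite /B (bigD1 j)//= lerDl sumr_ge0// => k _; exact: sqr_ge0.
rewrite Be => bj.
have -> : b j = 0 by apply/eqP; rewrite -sqrf_eq0 eq_le bj sqr_ge0.
by rewrite mulr0.
Qed.

Lemma eucl_dist_ge0 x y : 0 <= eucl_dist x y.
Proof. exact: sqrtr_ge0. Qed.

Lemma eucl_distC x y : eucl_dist x y = eucl_dist y x.
Proof.
by rewrite /eucl_dist; congr Num.sqrt; apply: eq_bigr => j _; rewrite -sqrrN opprB.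
Qed.

Lemma eucl_distxx x : eucl_dist x x = 0.
Proof. by rewrite /eucl_dist big1 ?sqrtr0// => j _; rewrite subrr expr0n. Qed.

Lemma sqr_eucl_dist x y : eucl_dist x y ^+ 2 = \sum_(j < d) (x 0 j - y 0 j) ^+ 2.
Proof. by rewrite /eucl_dist sqr_sqrtr// sumr_sqr_ge0. Qed.

Lemma eucl_dist_triangle y x z : eucl_dist x z <= eucl_dist x y + eucl_dist y z.
Proof.
rewrite -(@ler_pXn2r _ 2)// ?nnegrE ?addr_ge0 ?eucl_dist_ge0//.
rewrite sqrrD !sqr_eucl_dist.
pose a j := x 0 j - y 0 j; pose b j := y 0 j - z 0 j.
have -> : \sum_(j < d) (x 0 j - z 0 j) ^+ 2 =
    \sum_j a j ^+ 2 + (\sum_j a j * b j) *+ 2 + \sum_j b j ^+ 2.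
  rewrite -sumrMnl -!big_split /=; apply: eq_bigr => j _.
  by rewrite -sqrrD /a /b; congr (_ ^+ 2); ring.
rewrite lerD2r lerD2l lerMn2r /=.
have := sum_cauchy_schwarz a b; rewrite -!sqr_eucl_dist -exprMn => H.
apply: le_trans (ler_norm _) _.
rewrite -(@ler_pXn2r _ 2)// ?nnegrE ?mulr_ge0 ?eucl_dist_ge0//.
by rewrite real_normK ?num_real.
Qed.

Lemma ler_coord_eucl_dist x y j : `|x 0 j - y 0 j| <= eucl_dist x y.
Proof.
rewrite -(@ler_pXn2r _ 2)// ?nnegrE ?eucl_dist_ge0//.
rewrite real_normK ?num_real// sqr_eucl_dist (bigD1 j)//= lerDl.
by apply: sumr_ge0 => k _; exact: sqr_ge0.
Qed.

Lemma eucl_dist_le_sum x y : eucl_dist x y <= \sum_j `|x 0 j - y 0 j|.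
Proof.
rewrite -(@ler_pXn2r _ 2)// ?nnegrE ?eucl_dist_ge0 ?sumr_ge0//.
rewrite sqr_eucl_dist [leRHS]expr2 mulr_suml; apply: ler_sum => j _.
rewrite -(real_normK (num_real _)) expr2 ler_wpM2l//.
by rewrite [leRHS](bigD1 j)//= lerDl sumr_ge0.
Qed.

Lemma eucl_dist_eq0 x y : eucl_dist x y = 0 -> x = y.
Proof.
move=> xy; apply/rowP => j; apply/eqP; rewrite -subr_eq0 -normr_le0.
by rewrite -xy ler_coord_eucl_dist.
Qed.

Lemma norm_le_eucl_dist x y : `|x - y| <= eucl_dist x y.
Proof.
rewrite -[leLHS]/(mx_norm (x - y)) mx_normrE; apply/bigmax_leP; split=> [|[i j] _ /=].
  exact: eucl_dist_ge0.
by rewrite !mxE ord1 ler_coord_eucl_dist.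
Qed.

Lemma eucl_dist_le_norm x y : eucl_dist x y <= d%:R * `|x - y|.
Proof.
apply: le_trans (eucl_dist_le_sum _ _) _.
rewrite (_ : d%:R * _ = \sum_(j < d) `|x - y|); last first.
  by rewrite sumr_const card_ord mulr_natl.
apply: ler_sum => j _.
have := le_bigmax 0 (fun ij => `|(x - y) ij.1 ij.2|) (0, j).
by rewrite -mx_normrE /= !mxE.
Qed.

Lemma continuous_eucl_dist x : continuous (eucl_dist x).
Proof.
move=> y B /nbhs_ballP[e /= e0 He].
have d1 : 0 < d.+1%:R :> R by rewrite ltr0n.
change (nbhs y (eucl_dist x @^-1` B)).
apply/nbhs_ballP; exists (e / d.+1%:R); first by rewrite /= divr_gt0.
move=> z /=; rewrite mx_norm_ball /ball_/= => yz0.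
have yz : eucl_dist y z < e.
  apply: le_lt_trans (eucl_dist_le_norm _ _) _.
  move: yz0; rewrite ltr_pdivlMr// => yz; apply: le_lt_trans yz.
  by rewrite mulrC ler_wpM2l// ler_nat.
have h1 := eucl_dist_triangle y x z; have h2 := eucl_dist_triangle z x y.
rewrite (eucl_distC z y) in h2.
by apply: He; rewrite /= -ball_normE /= ltr_norml; apply/andP; split; lra.
Qed.

Lemma closed_eucl_ball x (rho : R) : closed (eucl_ball x rho).
Proof.
rewrite (_ : eucl_ball x rho = eucl_dist x @^-1` [set t | t <= rho])//.
by apply: preimage_closed => [y _|]; [exact: continuous_eucl_dist|exact: closed_le].
Qed.

Lemma measurable_open (A : set 'rV[R]_d) : open A -> measurable (A : set (borel_rV R d)).
Proof. exact: sub_sigma_algebra. Qed.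

Lemma measurable_closed (A : set 'rV[R]_d) :
  closed A -> measurable (A : set (borel_rV R d)).
Proof.
by move=> cA; rewrite -(setCK A); apply: measurableC; apply: measurable_open; rewrite openC.
Qed.

Lemma measurable_eucl_ball x (rho : R) :
  measurable (eucl_ball x rho : set (borel_rV R d)).
Proof. by apply: measurable_closed; exact: closed_eucl_ball. Qed.

Lemma open_eucl_ball (A : set 'rV[R]_d) x : open A -> A x ->
  exists2 a : R, 0 < a & eucl_ball x a `<=` A.
Proof.
move=> oA Ax; have /nbhs_ballP[e /= e0 He] := open_nbhs_nbhs (conj oA Ax).
exists (e / 2); rewrite ?divr_gt0// => y /= xy; apply: He.
rewrite mx_norm_ball /ball_/=; apply: le_lt_trans (norm_le_eucl_dist _ _) _.
by apply: le_lt_trans xy _; rewrite ltr_pdivrMr// ltr_pMr// ltr1n.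
Qed.

Lemma bounded_eucl_dist (A : set 'rV[R]_d) x : bounded_set A ->
  exists2 b : R, 0 < b & forall y, A y -> eucl_dist x y <= b.
Proof.
move=> [M [_ HM]]; pose M' := Num.max M 0 + 1.
have M'M : M < M' by rewrite /M' ltr_pwDr// le_max lexx.
exists (d%:R * (`|x| + M') + 1).
  rewrite ltr_wpDl// mulr_ge0// addr_ge0// /M' addr_ge0//.
  by rewrite le_max lexx orbT.
move=> y Ay; apply: le_trans (eucl_dist_le_norm _ _) _.
rewrite ler_wpDr// ler_wpM2l//; apply: le_trans (ler_normB _ _) _.
by rewrite lerD2l; exact: HM.
Qed.

End EuclideanDistance.

Section SimilarityExtension.
Context {R : realType} {d : nat}.
Implicit Types x y z : 'rV[R]_d.

Let dot x y : R := (x *m y^T) 0 0.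

Let dotE x y : dot x y = \sum_j x 0 j * y 0 j.
Proof. by rewrite /dot mxE; apply: eq_bigr => j _; rewrite mxE. Qed.

Let dist_dot x y : eucl_dist x y ^+ 2 = dot (x - y) (x - y).
Proof. by rewrite sqr_eucl_dist dotE; apply: eq_bigr => j _; rewrite !mxE expr2. Qed.

Let dotB x y : dot (x - y) (x - y) = dot x x - dot x y *+ 2 + dot y y.
Proof.
rewrite !dotE -sumrMnl -sumrN -!big_split /=; apply: eq_bigr => j _.
by rewrite !mxE; ring.
Qed.

(** Polarisation: a map that scales distances by [rho] around [v0] scales inner
    products by [rho ^ 2], so its values are determined by the images of the
    points [v0 + eps e_j], which form an orthogonal frame; as an affine map it
    then makes sense on the whole space. *)
Lemma similarity_extension (V : set 'rV[R]_d) (f : 'rV[R]_d -> 'rV[R]_d) (rho : R) :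
  open V -> V !=set0 -> 0 < rho ->
  (forall x y, V x -> V y -> eucl_dist (f x) (f y) = rho * eucl_dist x y) ->
  exists T : 'rV[R]_d -> 'rV[R]_d,
    [/\ forall x, V x -> T x = f x,
        forall x y, eucl_dist (T x) (T y) = rho * eucl_dist x y
      & forall y, exists x, T x = y].
Proof.
move=> oV [v0 Vv0] rho0 simf.
have [eps eps0 epsV] := open_eucl_ball oV Vv0.
pose g x := f x - f v0.
have gdot x y : V x -> V y -> dot (g x) (g y) = rho ^+ 2 * dot (x - v0) (y - v0).
  move=> Vx Vy.
  have h a b : V a -> V b -> dot (f a - f b) (f a - f b) = rho ^+ 2 * dot (a - b) (a - b).
    by move=> Va Vb; rewrite -!dist_dot simf// exprMn.
  have h1 := h _ _ Vx Vy; have h2 := h _ _ Vx Vv0; have h3 := h _ _ Vy Vv0.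
  rewrite (_ : f x - f y = g x - g y) in h1; last by rewrite /g opprB addrA subrK.
  rewrite (_ : x - y = (x - v0) - (y - v0)) in h1; last by rewrite opprB addrA subrK.
  rewrite (dotB (g x)) (dotB (x - v0)) in h1; rewrite -/(g x) -/(g y) in h2 h3.
  rewrite h2 h3 in h1; lra.
pose e j : 'rV[R]_d := v0 + eps *: delta_mx 0 j.
have Ve j : V (e j).
  apply: epsV; rewrite /eucl_ball /= -(@ler_pXn2r _ 2)// ?nnegrE ?eucl_dist_ge0 ?(ltW eps0)//.
  rewrite eucl_distC dist_dot dotE /e (addrC v0) addrK (bigD1 j)//= big1.
    by rewrite !mxE !eqxx mulr1 addr0 expr2.
  by move=> k kj; rewrite !mxE (negbTE kj) andbF mulr0 mul0r.
have edot x j : dot x (e j - v0) = eps * x 0 j.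
  rewrite dotE /e (addrC v0) addrK (bigD1 j)//= big1.
    by rewrite !mxE !eqxx mulr1 addr0 mulrC.
  by move=> k kj; rewrite !mxE (negbTE kj) andbF !mulr0.
have re0 : rho * eps != 0 by rewrite mulf_neq0// gt_eqF.
pose F : 'M[R]_d := \matrix_(i, j) ((rho * eps)^-1 * g (e i) 0 j).
have gF x j : (x *m F^T) 0 j = (rho * eps)^-1 * dot x (g (e j)).
  rewrite mxE dotE mulr_sumr; apply: eq_bigr => k _; rewrite !mxE; ring.
have FFT : F *m F^T = 1%:M.
  apply/matrixP => i j; rewrite !mxE.
  transitivity ((rho * eps)^-1 ^+ 2 * dot (g (e i)) (g (e j))).
    by rewrite dotE mulr_sumr; apply: eq_bigr => k _; rewrite !mxE; ring.
  rewrite gdot// edot /e (addrC v0) addrK !mxE eqxx /= (eq_sym j i).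
  case: (i == j) => /=; last by rewrite !mulr0.
  rewrite mulr1 -expr2 -exprMn; apply/eqP; rewrite -exprMn mulVf//.
  by rewrite expr1n.
have FTF : F^T *m F = 1%:M by exact: mulmx1C.
exists (fun x => f v0 + rho *: ((x - v0) *m F)); split.
- move=> x Vx; rewrite (_ : f x = f v0 + g x); last by rewrite /g addrC subrK.
  congr (_ + _).
  rewrite -[RHS]mulmx1 -FTF mulmxA scalemxAl; congr (_ *m _).
  apply/rowP => j; rewrite gF gdot// edot !mxE; field.
  by rewrite !gt_eqF.
- move=> x y; apply/eqP; rewrite -(@eqrXn2 _ 2)// ?mulr_ge0 ?eucl_dist_ge0 ?(ltW rho0)//.
  rewrite exprMn !dist_dot.
  rewrite (_ : _ - _ = rho *: ((x - y) *m F)); last first.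
    rewrite opprD addrACA subrr add0r -scalerBr -mulmxBl; congr (_ *: (_ *m _)).
    by rewrite opprB addrA subrK.
  rewrite /dot linearZ /= trmx_mul -!scalemxAl -!scalemxAr mulmxA -(mulmxA _ F) FFT mulmx1.
  by rewrite !mxE expr2 mulrA.
- move=> y; exists (v0 + rho^-1 *: ((y - f v0) *m F^T)).
  rewrite (addrC v0) addrK -scalemxAl scalerA mulfV ?gt_eqF// scale1r -mulmxA FTF mulmx1.
  by rewrite addrC subrK.
Qed.

End SimilarityExtension.

(** * Finite words and multiplicative weights *)

Section Words.
Context {R : realType} {N : nat}.
Implicit Types (a : 'I_N -> R) (u v w : seq 'I_N).

Fixpoint words n : seq (seq 'I_N) :=
  if n is m.+1 then [seq i :: w | i <- enum 'I_N, w <- words m] else [:: [::]].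

Lemma mem_words n w : (w \in words n) = (size w == n).
Proof.
elim: n w => [|n IH] [|i w] //=.
- by apply/negP => /allpairsP[[j v] /= []].
- rewrite eqSS -IH; apply/allpairsP/idP => [[[j v] /= [_ vn [_ ->]]]//|wn].
  by exists (i, w); rewrite mem_enum.
Qed.

Lemma words_uniq n : uniq (words n).
Proof.
elim: n => [//|n IH] /=; apply: allpairs_uniq => //; first exact: enum_uniq.
by move=> [i v] [j w] _ _ /= [-> ->].
Qed.

Lemma sum_wordsS (P : pred (seq 'I_N)) (F : seq 'I_N -> R) n :
  \sum_(w <- words n.+1 | P w) F w =
  \sum_(i < N) \sum_(w <- words n | P (i :: w)) F (i :: w).
Proof.
rewrite big_mkcond /= big_allpairs_dep /= big_enum /=.
by apply: eq_bigr => i _; rewrite [RHS]big_mkcond.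
Qed.

Lemma weight_nil a : weight_string a [::] = 1.
Proof. by rewrite /weight_string big_nil. Qed.

Lemma weight_cons a i w : weight_string a (i :: w) = a i * weight_string a w.
Proof. by rewrite /weight_string big_cons. Qed.

Lemma weight_cat a u w :
  weight_string a (u ++ w) = weight_string a u * weight_string a w.
Proof. by rewrite /weight_string big_cat. Qed.

Lemma weight_gt0 a w : (forall i, 0 < a i) -> 0 < weight_string a w.
Proof. by move=> a0; rewrite /weight_string prodr_gt0. Qed.

Lemma weight_ge0 a w : (forall i, 0 <= a i) -> 0 <= weight_string a w.
Proof. by move=> a0; rewrite /weight_string prodr_ge0. Qed.

Lemma weight_le1 a w : (forall i, 0 <= a i <= 1) -> weight_string a w <= 1.
Proof.
move=> a01; elim: w => [|i w IH]; first by rewrite weight_nil.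
have /andP[ai0 ai1] := a01 i.
by rewrite weight_cons mulr_ile1// weight_ge0// => j; case/andP: (a01 j).
Qed.

Lemma ln_weight a w : (forall i, 0 < a i) ->
  ln (weight_string a w) = \sum_(i <- w) ln (a i).
Proof.
move=> a0; elim: w => [|i w IH]; first by rewrite weight_nil ln1 big_nil.
by rewrite weight_cons lnM ?posrE ?weight_gt0// IH big_cons.
Qed.

Lemma ln_weight_cat a u w : (forall i, 0 < a i) ->
  ln (weight_string a (u ++ w)) = ln (weight_string a u) + ln (weight_string a w).
Proof. by move=> a0; rewrite weight_cat lnM ?posrE ?weight_gt0. Qed.

(** Every ratio lies in a compact subinterval of [(0, 1)], so the logarithm of a
    contraction ratio is comparable with the length of the word. *)
Lemma ln_weight_bounds a : (forall i, 0 < a i < 1) ->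
  exists lam Lam : R, [/\ 0 < lam, 0 < Lam &
    forall w, (size w)%:R * lam <= - ln (weight_string a w) <= (size w)%:R * Lam].
Proof.
move=> a01.
have a0 i : 0 < a i by case/andP: (a01 i).
have la0 i : 0 < - ln (a i) by rewrite oppr_gt0 ln_lt0.
pose Lam := 1 + \sum_i - ln (a i).
have Lam0 : 0 < Lam by rewrite ltr_pwDl// sumr_ge0// => i _; exact: ltW.
have LamP i : - ln (a i) <= Lam.
  rewrite /Lam (bigD1 i)//= addrCA lerDl addr_ge0// sumr_ge0// => j _; exact: ltW.
pose ilam := 1 + \sum_i (- ln (a i))^-1.
have ilam0 : 0 < ilam by rewrite ltr_pwDl// sumr_ge0// => i _; rewrite invr_ge0 ltW.
have lamP i : ilam^-1 <= - ln (a i).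
  rewrite -[leRHS]invrK lef_pV2 ?posrE// ?invr_gt0//.
  rewrite /ilam (bigD1 i)//= addrCA lerDl addr_ge0// sumr_ge0// => j _.
  by rewrite invr_ge0 ltW.
exists ilam^-1, Lam; split=> //; first by rewrite invr_gt0.
move=> w; rewrite ln_weight// -sumrN.
elim: w => [|i w IH]; first by rewrite !big_nil !mul0r lexx.
rewrite !big_cons /=; have [/andP[h1 h2] h3 h4] := And3 IH (lamP i) (LamP i).
by rewrite -natr1 !mulrDl !mul1r; apply/andP; split; lra.
Qed.

Lemma weight_tail a (eps : R) : (forall i, 0 < a i < 1) -> 0 < eps ->
  exists n, forall w, (n <= size w)%N -> weight_string a w <= eps.
Proof.
move=> a01 eps0; have [lam [Lam [lam0 _ h]]] := ln_weight_bounds a01.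
exists (Num.trunc (`|ln eps| / lam)).+1 => w hw.
have w0 : 0 < weight_string a w by apply: weight_gt0 => i; case/andP: (a01 i).
rewrite -ler_ln ?posrE// -lerN2.
apply: le_trans (ler_norm _) _; rewrite normrN.
have /andP[+ _] := h w; apply: le_trans.
rewrite -ler_pdivrMr//; apply: ltW; apply: lt_le_trans (truncnS_gt _) _.
by rewrite ler_nat.
Qed.

Lemma sum_weight_words a n :
  \sum_(w <- words n) weight_string a w = (\sum_i a i) ^+ n.
Proof.
elim: n => [|n IH]; first by rewrite big_seq1 weight_nil expr0.
rewrite (sum_wordsS xpredT) exprS mulr_suml; apply: eq_bigr => i _.
by rewrite -IH mulr_sumr; apply: eq_bigr => w _; rewrite weight_cons.
Qed.

Lemma sum_weight_prefix a v n : (forall i, 0 <= a i) -> \sum_i a i = 1 ->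
  \sum_(w <- words n | prefix v w) weight_string a w <= weight_string a v.
Proof.
move=> a0 a1; elim: v n => [|j v IH] [|n].
- by rewrite big_mkcond big_seq1 /= weight_nil.
- rewrite (eq_bigl xpredT); last by move=> w; rewrite prefix0s.
  by rewrite sum_weight_words a1 expr1n weight_nil.
- by rewrite big_mkcond big_seq1 /= weight_ge0.
- rewrite sum_wordsS (bigD1 j)//= [X in _ + X]big1 ?addr0; last first.
    by move=> i ij; rewrite big1// => w /=; rewrite eq_sym (negbTE ij).
  rewrite weight_cons (eq_bigl (prefix v)); last by move=> w; rewrite eqxx.
  under eq_bigr do rewrite weight_cons.
  by rewrite -mulr_sumr ler_wpM2l.
Qed.

Lemma ler_sum_subset (I : eqType) (s t : seq I) (g : I -> R) :
  uniq s -> {subset s <= t} -> (forall x, 0 <= g x) ->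
  \sum_(x <- s) g x <= \sum_(x <- t) g x.
Proof.
move=> + + g0; elim: s t => [|x s IH] t /=; first by rewrite big_nil sumr_ge0.
move=> /andP[xs us] st; have xt : x \in t by apply: st; rewrite mem_head.
rewrite big_cons [leRHS](big_rem x xt) /= lerD2l; apply: IH => // y ys.
have yt : y \in t by apply: st; rewrite inE ys orbT.
have := perm_mem (perm_to_rem xt) y; rewrite yt inE => /esym/orP[/eqP yx|//].
by rewrite -yx ys in xs.
Qed.

(** The passage from the finite families over which unordered sums range to sums
    by length. *)
Lemma sum_words_level (s : seq (seq 'I_N)) (g : seq 'I_N -> R) :
  uniq s -> (forall w, 0 <= g w) ->
  exists m, \sum_(w <- s) g w <= \sum_(n < m) \sum_(w <- words n) g w.
Proof.
move=> us g0; have [m sm] : exists m, forall w, w \in s -> (size w < m)%N.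
  by exists (\max_(w <- s) size w).+1 => w ws; rewrite ltnS; exact: leq_bigmax_seq.
exists m.
rewrite -(big_mkord xpredT (fun n => \sum_(w <- words n) g w)).
rewrite -(big_map words xpredT (fun t => \sum_(w <- t) g w)) -big_flatten /=.
apply: ler_sum_subset => // w ws; apply/flatten_mapP; exists (size w).
  by rewrite mem_index_iota /= sm.
by rewrite mem_words.
Qed.

End Words.

(** * Level sums under a Legendre constraint *)

Section ZeroMean.
Context {R : realType} {N : nat}.
Implicit Types (f a P : 'I_N -> R).

(** The sum is the slope at [Q] of the pressure [\sum_j a j * expR (q * f j)], and
    the term of [i] dominates it. *)
Let slope_ge0 f a i : (forall j, 0 < a j) -> 0 < f i ->
  exists2 Q, 0 <= Q & 0 <= \sum_j a j * f j * expR (Q * f j).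
Proof.
move=> a0 fi; pose A := \sum_j a j * `|f j|.
have A0 : 0 <= A by rewrite sumr_ge0// => j _; rewrite mulr_ge0// ltW.
have af0 : 0 < a i * f i ^+ 2 by rewrite mulr_gt0// exprn_gt0.
have Q0 : 0 <= A / (a i * f i ^+ 2) by rewrite divr_ge0// ltW.
exists (A / (a i * f i ^+ 2)) => //; set Q := A / _.
have h j : - (a j * `|f j|) <= a j * f j * expR (Q * f j).
  have [fj|fj] := leP 0 (f j).
    apply: (@le_trans _ _ 0); first by rewrite oppr_le0 mulr_ge0// ltW.
    by rewrite !mulr_ge0 ?expR_ge0// ltW.
  rewrite ltr0_norm// mulrN opprK ler_niMr//.
    by rewrite nmulr_lle0// ltW.
  by rewrite -expR0 ler_expR; rewrite mulr_ge0_le0// ltW.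
rewrite (bigD1 i)//=.
apply: (@le_trans _ _ (A + \sum_(j | j != i) - (a j * `|f j|))).
  rewrite /A sumrN (bigD1 i)//= addrK mulr_ge0// ltW//; exact: a0.
rewrite lerD//; last by apply: ler_sum => j _; exact: h.
have : 1 + Q * f i <= expR (Q * f i) by exact: expR_ge1Dx.
move=> hQ; apply: (@le_trans _ _ (a i * f i * (1 + Q * f i))).
  rewrite mulrDr mulr1 /Q (_ : a i * f i * _ = A); last by field; rewrite !gt_eqF.
  by rewrite lerDr mulr_ge0// ltW.
by rewrite ler_wpM2l// mulr_ge0// ltW.
Qed.

Let one_sided f a eta : (forall j, 0 < a j) -> (forall j, f j <= 0) -> 0 < eta ->
  (forall q, 1 + eta <= \sum_i a i * expR (q * f i)) ->
  1 < \sum_(i | f i == 0) a i.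
Proof.
move=> a0 f0 eta0 /(_ _) H; pose A := \sum_(i | f i != 0) a i / - f i.
have nf i : f i != 0 -> 0 < - f i by move=> fi; rewrite oppr_gt0 lt_neqAle fi f0.
have A0 : 0 <= A by rewrite sumr_ge0// => j /nf fj; rewrite divr_ge0// ltW.
pose q := 2 * A / eta + 1.
have q0 : 0 < q by rewrite ltr_pwDr// divr_ge0 ?mulr_ge0// ltW.
have := H q; rewrite (bigID (fun i => f i == 0))/=.
under eq_bigr => i /eqP -> do rewrite mulr0 expR0 mulr1.
move=> Hq.
suff : \sum_(i | f i != 0) a i * expR (q * f i) <= eta / 2 by lra.
apply: (@le_trans _ _ (A / q)); last first.
  rewrite ler_pdivrMr// /q mulrDr mulr1 (_ : eta / 2 * (2 * A / eta) = A); last by field; rewrite gt_eqF.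
  by rewrite lerDl divr_ge0// ltW.
rewrite /A mulr_suml; apply: ler_sum => j /nf fj.
rewrite -mulrA -invfM ler_wpM2l ?(ltW (a0 _))//.
rewrite -[q * f j]opprK expRN lef_pV2 ?posrE ?expR_gt0 ?mulr_gt0//.
rewrite -mulrN mulrC; apply: le_trans (expR_ge1Dx _).
by rewrite lerDr.
Qed.

(** If [\sum_i a i * exp (q * f i)] stays above [1] for all [q], then tilting [a]
    at a critical point [q] yields a probability vector with respect to which [f]
    has mean zero. When [f] has one sign the infimum over [q] is only approached
    at infinity, where the weights concentrate on the zeros of [f]. *)
Lemma zero_mean_weights f a eta : (forall j, 0 < a j) -> 0 < eta ->
  (forall q, 1 + eta <= \sum_i a i * expR (q * f i)) ->
  exists P Z q, [/\ forall i, 0 <= P i, \sum_i P i = 1, \sum_i P i * f i = 0, 1 < Z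
    & forall i, Z * P i <= a i * expR (q * f i)].
Proof.
move=> a0 eta0 H.
have zeros : 1 < \sum_(i | f i == 0) a i ->
  exists P Z q, [/\ forall i, 0 <= P i, \sum_i P i = 1, \sum_i P i * f i = 0, 1 < Z
    & forall i, Z * P i <= a i * expR (q * f i)].
  set Z := \sum_(i | _) _ => Z1; have Z0 : 0 < Z by exact: lt_trans Z1.
  exists (fun i => if f i == 0 then a i / Z else 0), Z, 0; split=> //.
  - by move=> i; case: ifP => // _; rewrite divr_ge0// ltW.
  - by rewrite -big_mkcond /= -mulr_suml divff// gt_eqF.
  - by rewrite big1// => i _; case: eqP => [->|_]; rewrite ?mulr0 ?mul0r.
  - move=> i; rewrite mul0r expR0 mulr1; case: ifP => _; last by rewrite mulr0 ltW.
    by rewrite mulrC divfK// gt_eqF.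
have [/existsP[i fi]|/existsPn/= fn] := boolP [exists i, 0 < f i]; last first.
  apply: zeros; apply: (@one_sided _ _ eta) => // j.
  by rewrite leNgt.
have [/existsP[i' fi']|/existsPn/= fn] := boolP [exists i, f i < 0]; last first.
  apply: zeros; rewrite (eq_bigl (fun i => - f i == 0)); last by move=> j; rewrite oppr_eq0.
  apply: (@one_sided (fun i => - f i) _ eta) => // [j|q].
    by rewrite oppr_le0 leNgt.
  rewrite (eq_bigr (fun i => a i * expR ((- q) * f i))) ?H// => j _.
  by rewrite mulrN mulNr.
have [Q1 Q10 hQ1] := slope_ge0 a0 fi.
have [|Q2 Q20 hQ2] := @slope_ge0 (fun i => - f i) a i' a0; first by rewrite oppr_gt0.
pose D q := \sum_j a j * f j * expR (q * f j).
have D1 : 0 <= D Q1 by [].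
have D2 : D (- Q2) <= 0.
  rewrite -oppr_ge0 /D -sumrN; apply: le_trans hQ2 _.
  by rewrite le_eqVlt; apply/orP; left; apply/eqP; apply: eq_bigr => j _; rewrite !mulrN !mulNr.
have cD : continuous D.
  rewrite /D => q; apply: cvg_big => [|j _]; first exact: add_continuous.
  apply: cvgM; first exact: cvg_cst.
  apply: (@cvg_comp _ _ _ (fun q => q * f j) expR _ (nbhs (q * f j))); last exact: continuous_expR.
  by apply: cvgM; [exact: cvg_id|exact: cvg_cst].
(* Any zero of the slope will do, since the pressure exceeds [1] everywhere. *)
have [|||q _ Dq] := @IVT _ D (- Q2) Q1 0.
- by rewrite (@le_trans _ _ 0)// oppr_le0.
- by apply: continuous_subspaceT.
- by rewrite ge_min D2 le_max D1 orbT.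
pose Z := \sum_i a i * expR (q * f i).
have Z1 : 1 < Z by apply: lt_le_trans (H q); rewrite ltrDl.
have Z0 : 0 < Z by exact: lt_trans Z1.
exists (fun i => a i * expR (q * f i) / Z), Z, q; split=> //.
- by move=> j; rewrite divr_ge0 ?mulr_ge0 ?expR_ge0// ltW.
- by rewrite -mulr_suml divff// gt_eqF.
- rewrite (eq_bigr (fun i => a i * f i * expR (q * f i) / Z)); last by move=> j _; ring.
  by rewrite -mulr_suml -/(D q) Dq mul0r.
- by move=> j; rewrite mulrC divfK// gt_eqF.
Qed.

Let wsum f (w : seq 'I_N) := \sum_(i <- w) f i.

Lemma sum_weight_square f P n : \sum_i P i = 1 -> \sum_i P i * f i = 0 ->
  \sum_(w <- words n) weight_string P w * wsum f w = 0 /\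
  \sum_(w <- words n) weight_string P w * wsum f w ^+ 2 = n%:R * \sum_i P i * f i ^+ 2.
Proof.
move=> P1 Pf; elim: n => [|n [IH1 IH2]].
  by rewrite !big_seq1 /wsum big_nil expr0n /= !mulr0 mul0r.
rewrite !(sum_wordsS xpredT); split.
  rewrite (eq_bigr (fun i => P i * f i)) // => i _.
  rewrite (eq_bigr (fun w => P i * f i * weight_string P w
    + P i * (weight_string P w * wsum f w))); last first.
    by move=> w _; rewrite weight_cons /wsum big_cons; ring.
  by rewrite big_split /= -!mulr_sumr IH1 sum_weight_words P1 expr1n mulr0 addr0 mulr1.
rewrite (eq_bigr (fun i => P i * f i ^+ 2 + P i * (n%:R * \sum_i P i * f i ^+ 2))); last first.
  move=> i _; rewrite (eq_bigr (fun w => P i * f i ^+ 2 * weight_string P w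
    + P i * f i *+ 2 * (weight_string P w * wsum f w)
    + P i * (weight_string P w * wsum f w ^+ 2))); last first.
    by move=> w _; rewrite weight_cons /wsum big_cons; ring.
  by rewrite !big_split /= -!mulr_sumr IH1 IH2 sum_weight_words P1 expr1n mulr0 addr0 mulr1.
by rewrite big_split /= -mulr_suml P1 mul1r -natr1 mulrDl mul1r addrC.
Qed.

(** Chebyshev's inequality for independent letters. *)
Lemma weight_concentration f P n rho : (0 < n)%N -> 0 < rho ->
  (forall i, 0 <= P i) -> \sum_i P i = 1 -> \sum_i P i * f i = 0 ->
  1 - (\sum_i P i * f i ^+ 2) / (n%:R * rho ^+ 2) <=
  \sum_(w <- words n | `|wsum f w| <= n%:R * rho) weight_string P w.
Proof.
move=> n0 rho0 P0 P1 Pf; have [_ H] := sum_weight_square n P1 Pf.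
have n0' : 0 < n%:R :> R by rewrite ltr0n.
have := sum_weight_words P n; rewrite P1 expr1n.
rewrite (bigID (fun w => `|wsum f w| <= n%:R * rho)) /=.
set B := \sum_(w <- _ | ~~ _) _ => GB1.
rewrite lerBlDr -[leLHS]GB1 lerD2l ler_pdivlMr ?mulr_gt0 ?exprn_gt0//.
rewrite -(@ler_pM2l _ n%:R)// -H (bigID (fun w => `|wsum f w| <= n%:R * rho)) /=.
rewrite -[leLHS]add0r lerD//.
  by apply: sumr_ge0 => w _; rewrite mulr_ge0 ?weight_ge0 ?sqr_ge0.
rewrite (_ : n%:R * _ = B * (n%:R * rho) ^+ 2); last by ring.
rewrite /B mulr_suml; apply: ler_sum => w; rewrite -ltNge => wn.
rewrite ler_wpM2l ?weight_ge0// -[leRHS](real_normK (num_real _)).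
by rewrite ler_pXn2r ?nnegrE ?mulr_ge0 ?normr_ge0 ?ltW.
Qed.

End ZeroMean.

Section Legendre.
Context {R : realType}.
Implicit Types (phi : R -> R) (x t : R).

Lemma legendre_lt_ex phi x t : (legendre phi x < t%:E)%E -> exists q, x * q + phi q < t.
Proof. by move=> /ereal_inf_lt[_ [q _ <-]]; rewrite lte_fin; exists q. Qed.

Lemma legendre_le phi x q : (legendre phi x <= (x * q + phi q)%:E)%E.
Proof. by apply: ereal_inf_lbound; exists q. Qed.

Lemma legendre_ge phi x t : (forall q, t <= x * q + phi q) -> (t%:E <= legendre phi x)%E.
Proof. by move=> h; apply: le_ereal_inf_tmp => _ [q _ <-]; rewrite lee_fin. Qed.

Lemma lt_legendre_ex phi x t : (t%:E < legendre phi x)%E ->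
  exists2 t', t < t' & forall q, t' <= x * q + phi q.
Proof.
case E : (legendre phi x) => [l| |] //.
- rewrite lte_fin => tl; exists l => // q.
  by rewrite -lee_fin -E legendre_le.
- by move=> _; have := legendre_le phi x 0; rewrite E.
Qed.

End Legendre.

Section Pressure.
Context {R : realType} {N : nat}.
Variables (r p : 'I_N -> R) (beta : R -> R).
Hypotheses (r01 : forall i, 0 < r i < 1) (p0 : forall i, 0 < p i).
Hypothesis (hbeta : forall q, \sum_(i < N) p i `^ q * r i `^ beta q = 1).

Let r0 i : 0 < r i. Proof. by case/andP: (r01 i). Qed.

Lemma powR_expR (x t : R) : 0 < x -> x `^ t = expR (t * ln x).
Proof. by move=> x0; rewrite /powR gt_eqF. Qed.

Lemma weight_powR t w :
  weight_string r w `^ t = weight_string (fun i => r i `^ t) w.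
Proof.
elim: w => [|i w IH]; first by rewrite !weight_nil powR1.
by rewrite !weight_cons powRM ?IH ?weight_ge0 ?ltW// => j; exact: ltW.
Qed.

(** The equilibrium distribution at parameter [q]: a probability vector by the
    definition of [beta]. *)
Definition tilt q i := p i `^ q * r i `^ beta q.

Lemma tilt_gt0 q i : 0 < tilt q i.
Proof. by rewrite mulr_gt0// powR_gt0. Qed.

Lemma weight_tilt q w : weight_string (tilt q) w =
  expR (q * ln (weight_string p w) + beta q * ln (weight_string r w)).
Proof.
rewrite expRD -!powR_expR ?weight_gt0//.
elim: w => [|i w IH]; first by rewrite !weight_nil !powR1 mulr1.
by rewrite !weight_cons IH /tilt !powRM ?(ltW (weight_gt0 _ _)) ?ltW// mulrACA.
Qed.

Lemma sum_weight_tilt q n : \sum_(w <- words n) weight_string (tilt q) w = 1.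
Proof. by rewrite sum_weight_words hbeta expr1n. Qed.

Lemma weight_tilt_le1 q w : weight_string (tilt q) w <= 1.
Proof.
apply: weight_le1 => i; rewrite ltW ?tilt_gt0//= -(hbeta q) (bigD1 i)//= lerDl.
by rewrite sumr_ge0// => j _; rewrite ltW// mulr_gt0// powR_gt0.
Qed.

(** Among the words of length [n], those with local exponent close to [alpha] carry
    an exponentially large part of [\sum r_w ^ t] as soon as [t] is below the
    Legendre transform at [alpha]: they are typical for the tilted distribution
    under which [ln p_i - alpha ln r_i] has mean zero. *)
Lemma large_level_sum t alpha rho A n0 :
  (t%:E < legendre beta alpha)%E -> 0 < rho ->
  exists2 n, (n0 <= n)%N &
   A <= \sum_(w <- words n | `|ln (weight_string p w) - alpha * ln (weight_string r w)|
            <= rho * - ln (weight_string r w)) weight_string r w `^ t.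
Proof.
move=> /lt_legendre_ex[t' tt' ht'] rho0.
have [lam [Lam [lam0 _ hlam]]] := ln_weight_bounds r01.
pose f i := ln (p i) - alpha * ln (r i); pose a i := r i `^ t.
have a0 i : 0 < a i by exact: powR_gt0.
pose eta := expR ((t' - t) * lam) - 1.
have eta0 : 0 < eta by rewrite subr_gt0 -expR0 ltr_expR mulr_gt0// subr_gt0.
have H q : 1 + eta <= \sum_i a i * expR (q * f i).
  rewrite /eta addrC subrK -[leLHS]mulr1 -(hbeta q) mulr_sumr; apply: ler_sum => i _.
  rewrite /a !powR_expR// -!expRD ler_expR /f.
  have := hlam [:: i]; rewrite weight_cons weight_nil mulr1 /= mul1r => /andP[hl _].
  have h1 : (t' - t) * lam <= (alpha * q + beta q - t) * - ln (r i).
    by apply: ler_pM => //; rewrite ?subr_ge0 ?(ltW tt') ?(ltW lam0) ?lerB.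
  lra.
have [P [Z [q [P0 P1 Pf Z1 HP]]]] := zero_mean_weights a0 eta0 H.
have Z0 : 0 < Z by exact: lt_trans Z1.
have lZ : 0 < ln Z by rewrite ln_gt0.
(* With this [rho'] the tilting factor [expR (q * f)] costs at most the square
   root of the gain [Z ^+ n]. *)
pose rho' := Num.min (rho * lam) (ln Z / (2 * (`|q| + 1))).
have q1 : 0 < 2 * (`|q| + 1) by rewrite mulr_gt0// ltr_wpDl.
have rho'0 : 0 < rho' by rewrite lt_min mulr_gt0// divr_gt0.
have rho'1 : rho' <= rho * lam by rewrite /rho' ge_min lexx.
have rho'2 : rho' <= ln Z / (2 * (`|q| + 1)) by rewrite /rho' ge_min lexx orbT.
have qrho : `|q| * rho' <= ln Z / 2.
  apply: (@le_trans _ _ ((`|q| + 1) * (ln Z / (2 * (`|q| + 1))))).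
    by rewrite ler_pM ?lerDl// (ltW rho'0).
  by rewrite le_eqVlt; apply/orP; left; apply/eqP; field; rewrite gt_eqF// ltr_wpDl.
pose V := \sum_i P i * f i ^+ 2.
have V0 : 0 <= V by rewrite sumr_ge0// => i _; rewrite mulr_ge0// sqr_ge0.
(* Large enough for Chebyshev to leave half of the mass, and for
   [expR (n * (ln Z / 2)) / 2] to exceed [A]. *)
pose n := (n0 + (Num.trunc (2 * V / rho' ^+ 2)).+1 + (Num.trunc (4 * `|A| / ln Z)).+1)%N.
have n0' : (0 < n)%N by rewrite /n !addnS.
have nr0 : 0 < n%:R :> R by rewrite ltr0n.
have hn1 : 2 * V <= n%:R * rho' ^+ 2.
  rewrite -ler_pdivrMr ?exprn_gt0//; apply: ltW.
  apply: lt_le_trans (truncnS_gt _) _.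
  by rewrite ler_nat /n -addnA addnCA leq_addr.
have hn2 : 4 * `|A| <= n%:R * ln Z.
  rewrite -ler_pdivrMr//; apply: ltW; apply: lt_le_trans (truncnS_gt _) _.
  by rewrite ler_nat /n leq_addl.
exists n; first by rewrite /n -addnA leq_addr.
apply: (@le_trans _ _ (expR (n%:R * (ln Z / 2)) / 2)).
  rewrite ler_pdivlMr//; apply: le_trans (expR_ge1Dx _).
  apply: le_trans (_ : 2 * `|A| <= _); first by rewrite mulrC ler_wpM2l// ler_norm.
  rewrite -[leLHS]add0r lerD//; lra.
have cheb := weight_concentration n0' rho'0 P0 P1 Pf; rewrite -/V in cheb.
have half : 2^-1 <= 1 - V / (n%:R * rho' ^+ 2).
  rewrite lerBrDr -lerBrDl ler_pdivrMr ?mulr_gt0 ?exprn_gt0//; lra.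
have {}cheb := le_trans half cheb.
apply: (@le_trans _ _ (expR (n%:R * (ln Z / 2)) *
  \sum_(w <- words n | `|\sum_(i <- w) f i| <= n%:R * rho') weight_string P w)).
  by rewrite ler_wpM2l// expR_ge0.
rewrite mulr_sumr [leLHS]big_seq_cond [leRHS]big_seq_cond.
rewrite [leLHS]big_mkcond [leRHS]big_mkcond /=.
apply: ler_sum => w _; case: ifP => [/andP[wn hw]|_]; last first.
  by case: ifP => _ //; rewrite powR_ge0.
have {}wn : size w = n by apply/eqP; rewrite -mem_words.
have Fw : ln (weight_string p w) - alpha * ln (weight_string r w) = \sum_(i <- w) f i.
  by rewrite !ln_weight// mulr_sumr -sumrB.
have /andP[hl _] := hlam w; rewrite wn in hl.
rewrite mem_words wn eqxx /= Fw ifT; last first.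
  apply: le_trans hw _; apply: le_trans (_ : n%:R * (rho * lam) <= _).
    by rewrite ler_wpM2l.
  by rewrite mulrCA ler_wpM2l// ltW.
have key : Z ^+ n * weight_string P w <= weight_string a w * expR (q * \sum_(i <- w) f i).
  rewrite -wn; elim: w {wn hw Fw hl} => [|i w IH].
    by rewrite !weight_nil big_nil mulr0 expR0 expr0.
  rewrite !weight_cons big_cons exprS mulrDr expRD mulrACA [leRHS]mulrACA.
  by rewrite ler_pM// ?mulr_ge0 ?exprn_ge0 ?weight_ge0// ltW.
rewrite weight_powR -/a -(@ler_pM2r _ (expR (q * \sum_(i <- w) f i))) ?expR_gt0//.
apply: le_trans key; rewrite mulrAC ler_wpM2r ?weight_ge0// -expRD.
rewrite -[X in _ <= X ^+ _](lnK (x:=Z)) ?posrE// -expRM_natl ler_expR.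
have : q * \sum_(i <- w) f i <= n%:R * (ln Z / 2).
  apply: le_trans (ler_norm _) _; rewrite normrM.
  apply: le_trans (_ : `|q| * (n%:R * rho') <= _); first by rewrite ler_wpM2l.
  by rewrite mulrCA ler_wpM2l.
lra.
Qed.

(** A finite family of exponents [q] certifies [qx + beta q < t] for all [x] near
    [C] at once, by compactness of [C `&` `[0, B]]. *)
Lemma finite_certificates (C : set R) t B : closed C ->
  (forall alpha, C alpha -> (legendre beta alpha < t%:E)%E) ->
  exists (Q : seq R) (eta : R), 0 < eta /\
  forall x c, 0 <= x <= B -> C c -> `|x - c| <= eta ->
    exists2 q, q \in Q & x * q + beta q < t - eta.
Proof.
move=> cC hC.
have /choice[z hz] : forall alpha, exists z : R * R, C alpha ->
    0 < z.2 /\ forall x, `|x - alpha| < 2 * z.2 -> x * z.1 + beta z.1 < t - z.2.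
  move=> alpha; have [Ca|nCa] := pselect (C alpha); last by exists 0.
  have [q hq] := legendre_lt_ex (hC _ Ca).
  have q2 : 0 < 2 * `|q| + 2 by rewrite ltr_wpDl ?mulr_ge0.
  exists (q, (t - (alpha * q + beta q)) / (2 * `|q| + 2)) => _ /=.
  set eta := _ / _; have eta0 : 0 < eta by rewrite divr_gt0// subr_gt0.
  split=> // x hx.
  have e : eta * (2 * `|q| + 2) = t - (alpha * q + beta q) by rewrite /eta divfK// gt_eqF.
  have h : (x - alpha) * q <= 2 * eta * `|q|.
    by apply: le_trans (ler_norm _) _; rewrite normrM ler_wpM2r// ltW.
  lra.
have cK : compact (C `&` `[-1, B + 1]%classic).
  by rewrite setIC; apply: compact_closedI => //; exact: segment_compact.
move: cK; rewrite compact_cover => /(_ R (C `&` `[-1, B + 1]%classic)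
  (fun a => ball a (z a).2)) [].
- by move=> a [Ca _]; exact: ball_open.
- by move=> a [Ca aB]; exists a => //; apply: ballxx; have [] := hz _ Ca.
move=> s sC scov.
have [eta [eta0 eta1 etas]] : exists eta : R, [/\ 0 < eta, eta <= 1 &
    forall a, a \in (s : seq R) -> eta <= (z a).2].
  have : forall a, a \in (s : seq R) -> 0 < (z a).2.
    by move=> a /sC; rewrite inE => -[Ca _]; have [] := hz _ Ca.
  elim: (s : seq R) => [_|a u IH hu]; first by exists 1; split.
  have [|eta [e0 e1 eu]] := IH; first by move=> b bu; apply: hu; rewrite inE bu orbT.
  exists (Num.min eta (z a).2); split.
  - by rewrite lt_min e0 hu ?mem_head.
  - by rewrite ge_min e1.
  - move=> b; rewrite inE => /orP[/eqP ->|bu]; first by rewrite ge_min lexx orbT.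
    by rewrite ge_min eu.
exists [seq (z a).1 | a <- s], eta; split=> // x c /andP[x0 xB] Cc.
rewrite ler_distlC => /andP[xc cx].
have [|a /= sa] := scov c.
  by split => //=; rewrite in_itv /=; apply/andP; split; lra.
rewrite -ball_normE /= ltr_distlC => /andP[ac ca].
have za := etas _ sa; have [Ca _] : (C `&` `[-1, B + 1]%classic) a by apply/set_mem/sC.
exists (z a).1; first exact: map_f.
have [_ /(_ x) h] := hz _ Ca.
apply: lt_le_trans (h _) _; last by rewrite lerB.
by rewrite ltr_distl; apply/andP; split; lra.
Qed.

End Pressure.

(** * Abscissas of convergence of the zeta series *)

Section ZetaAbscissa.
Context {R : realType} {N : nat}.
Variables (r p : 'I_N -> R) (beta : R -> R).
Hypotheses (r01 : forall i, 0 < r i < 1) (p0 : forall i, 0 < p i).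
Hypothesis (p1 : \sum_i p i = 1).
Hypothesis (hbeta : forall q, \sum_(i < N) p i `^ q * r i `^ beta q = 1).
Local Notation rw := (weight_string r).
Local Notation pw := (weight_string p).

Let r0 i : 0 < r i. Proof. by case/andP: (r01 i). Qed.
Let rw0 w : 0 < rw w. Proof. exact: weight_gt0. Qed.
Let pw0 w : 0 < pw w. Proof. exact: weight_gt0. Qed.
Let p_le1 i : p i <= 1.
Proof. by rewrite -p1 (bigD1 i)//= lerDl sumr_ge0// => j _; exact: ltW. Qed.

(** Each [p i] is a power of [r i] with bounded exponent, so the exponents of all
    words stay in a compact interval. *)
Lemma ln_prob_word_bounds : exists2 B, 0 <= B &
  forall w, 0 <= - ln (pw w) <= B * - ln (rw w).
Proof.
have lr0 i : 0 < - ln (r i) by rewrite oppr_gt0 ln_lt0.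
have lp0 i : 0 <= - ln (p i) by rewrite oppr_ge0 ln_le0.
pose B := \sum_i (- ln (p i)) / (- ln (r i)).
have B0 : 0 <= B by rewrite sumr_ge0// => i _; rewrite divr_ge0// ltW.
exists B => // w; rewrite !ln_weight// -!sumrN mulr_sumr sumr_ge0//=.
apply: ler_sum => i _; rewrite -ler_pdivrMr// /B (bigD1 i)//= lerDl sumr_ge0// => j _.
by rewrite divr_ge0// ltW.
Qed.

Lemma ln_word_tail (M : R) : exists n, forall w, (n <= size w)%N -> M <= - ln (rw w).
Proof.
have [n hn] := weight_tail r01 (expR_gt0 (- M)); exists n => w /hn h.
by rewrite lerNr -(expRK (- M)) ler_ln ?posrE ?expR_gt0.
Qed.

(** The diameter [D] of the attractor shifts [ln (rw w)] by a constant, which is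
    negligible for long words. *)
Lemma word_exponent_approx (D eps : R) : 0 < D -> 0 < eps ->
  exists n, forall w, (n <= size w)%N ->
    `|ln (pw w) / ln (rw w * D) - ln (pw w) / ln (rw w)| <= eps.
Proof.
move=> D0 eps0; have [B B0 hB] := ln_prob_word_bounds.
have [n hn] := ln_word_tail (`|ln D| + 1 + B * `|ln D| / eps).
exists n => w /hn {}hn.
have /andP[h1 h2] := hB w.
set l := - ln (rw w) in hn h2; have lE : ln (rw w) = - l by rewrite opprK.
have e0 : 0 <= B * `|ln D| / eps by rewrite divr_ge0 ?mulr_ge0// ltW.
have aD : 0 <= `|ln D| by [].
have l0 : 0 < l by lra.
have lD : `|ln D| + 1 <= l by lra.
have nD := ler_norm (ln D).
have lD0 : 0 < l - ln D by lra.
rewrite lnM ?posrE// lE (_ : - l + ln D = - (l - ln D)); last by ring.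
rewrite (_ : _ - _ = - ln (pw w) / l * (ln D / (l - ln D))); last first.
  by field; rewrite !gt_eqF.
rewrite normrM; apply: (@le_trans _ _ (B * `|ln D / (l - ln D)|)).
  by rewrite ler_wpM2r// ger0_norm ?divr_ge0 ?(ltW l0)// ler_pdivrMr.
rewrite normrM normfV (gtr0_norm lD0) mulrA ler_pdivrMr// [leRHS]mulrC -ler_pdivrMr//.
lra.
Qed.

(** Below the Legendre transform at [alpha] the partial sums over words with
    exponent near [alpha] are unbounded, so the series diverges. *)
Lemma sigma_ab_ge (I : set (seq 'I_N)) alpha rho n0 : 0 < rho ->
  (forall w, (n0 <= size w)%N ->
    `|ln (pw w) - alpha * ln (rw w)| <= rho * - ln (rw w) -> I w) ->
  (legendre beta alpha <= sigma_ab (ZetaSeries I rw))%E.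
Proof.
move=> rho0 hI; apply: le_ereal_inf_tmp => _ [t /= st <-].
rewrite leNgt; apply/negP => tl.
pose g w : \bar R := (rw w `^ t)%:E.
have := st; rewrite /summable ltNge => /negP; apply.
suff h A : (A%:E <= \esum_(x in I) `|g x|)%E.
  have [//|] := leP +oo%E (\esum_(x in I) `|g x|)%E.
  case E : (esum _ _) => [s| |]//; last by have := h 0%R; rewrite E.
  by have := h (s + 1)%R; rewrite E lee_fin gerDl ler10.
have [n n0n] := large_level_sum r01 p0 hbeta A n0 tl rho0.
pose good w := `|ln (pw w) - alpha * ln (rw w)| <= rho * - ln (rw w).
move=> hA; have {}hA : (A <= \sum_(w <- words n | good w) rw w `^ t)%R := hA.
pose ws := [seq w <- words n | good w].
apply: (@le_trans _ _ (\sum_(w <- ws) (rw w `^ t)%:E)%E).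
  by rewrite sumEFin lee_fin big_filter.
apply: esum_ge; exists [set` ws].
  split=> [|w /=]; first exact: finite_seq.
  by rewrite mem_filter mem_words => /andP[h /eqP wn]; apply: hI; rewrite ?wn.
rewrite -fsbig_seq ?filter_uniq ?words_uniq//; apply: lee_sum => w _.
by rewrite gee0_abs// lee_fin powR_ge0.
Qed.

(** The majorant of [rw w ^ t] available for a word whose exponent [x] satisfies
    [qx + beta q < t - eta] for one of the [q] in the list: each summand is a
    probability weight times a power that decays with the length. *)
Definition certificate (Q : seq R) eta w :=
  \sum_(q <- Q) weight_string (tilt r p beta q) w * rw w `^ eta.

Lemma certificate_ge0 Q eta w : 0 <= certificate Q eta w.
Proof.
apply: sumr_ge0 => q _; rewrite mulr_ge0 ?powR_ge0// ltW// weight_gt0// => i.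
exact: tilt_gt0.
Qed.

Lemma certificate_level_sum eta : 0 < eta -> exists2 theta, 0 < theta < 1 &
  forall Q n, \sum_(w <- words n) certificate Q eta w <= (size Q)%:R * theta ^+ n.
Proof.
move=> eta0; have [lam [Lam [lam0 _ h]]] := ln_weight_bounds r01.
exists (expR (- (eta * lam))); first by rewrite expR_gt0 -expR0 ltr_expR oppr_lt0 mulr_gt0.
move=> Q n; rewrite exchange_big /= -sum1_size natr_sum mulr_suml.
apply: ler_sum => q _; rewrite mul1r -expRM_natl.
rewrite -[leRHS]mul1r -[X in X * _](sum_weight_tilt hbeta q n) mulr_suml.
rewrite big_seq [leRHS]big_seq; apply: ler_sum => w; rewrite mem_words => /eqP wn.
rewrite ler_wpM2l//; first by rewrite ltW// weight_gt0// => i; exact: tilt_gt0.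
rewrite powR_expR// ler_expR; have /andP[+ _] := h w; rewrite wn.
by rewrite -(ler_pM2l eta0) => hw; rewrite mulrN mulrCA lerNr -mulrN.
Qed.

Lemma geometric_tail (theta : R) n1 m : 0 < theta < 1 ->
  \sum_(n < m) (if (n1 <= n)%N then theta ^+ n else 0) <= theta ^+ n1 / (1 - theta).
Proof.
move=> /andP[t0 t1]; have t1' : 0 < 1 - theta by rewrite subr_gt0.
suff h : \sum_(n < m) (if (n1 <= n)%N then theta ^+ n else 0) <=
    (theta ^+ n1 - theta ^+ maxn n1 m) / (1 - theta).
  by apply: le_trans h _; rewrite ler_pM2r ?invr_gt0// lerBlDr lerDl exprn_ge0// ltW.
elim: m => [|m IH]; first by rewrite big_ord0 maxn0 subrr mul0r.
rewrite big_ord_recr /=; apply: le_trans (lerD IH (lexx _)) _.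
case: leqP => nm; last by rewrite addr0 (maxn_idPl nm).
rewrite (maxn_idPr (leqW nm)) -[X in _ + X](mulfK (lt0r_neq0 t1')) -mulrDl.
by rewrite ler_pM2r ?invr_gt0// exprS; lra.
Qed.

(** Finitely many words apart, the series is dominated by the certificates, whose
    level sums are geometric. *)
Lemma sigma_ab_le (I : set (seq 'I_N)) t n0 Q eta : 0 < eta ->
  (forall w, I w -> (n0 <= size w)%N -> rw w `^ t <= certificate Q eta w) ->
  (sigma_ab (ZetaSeries I rw) <= t%:E)%E.
Proof.
move=> eta0 hI; apply: ereal_inf_lbound; exists t => //=.
have [theta t01 ht] := certificate_level_sum eta0.
pose g w := (if (size w < n0)%N then rw w `^ t else 0) + certificate Q eta w.
have g0 w : 0 <= g w.
  by rewrite addr_ge0 ?certificate_ge0//; case: ifP => // _; exact: powR_ge0.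
pose M := \sum_(n < n0) \sum_(w <- words n) rw w `^ t + (size Q)%:R * (theta ^+ 0 / (1 - theta)).
rewrite /summable; apply: (@le_lt_trans _ _ M%:E); last exact: ltry.
apply: ge_ereal_sup => _ [X [finX XI] <-].
rewrite fsbig_finite//=; apply: (@le_trans _ _ (\sum_(w <- fset_set X) (g w)%:E)%E).
  rewrite big_seq [leRHS]big_seq; apply: lee_sum => w; rewrite in_fset_set// inE => /XI Iw.
  rewrite lee_fin ger0_norm ?powR_ge0// /g; case: ltnP => wn.
    by rewrite lerDl certificate_ge0.
  by rewrite add0r hI.
rewrite sumEFin lee_fin; have [m hm] := @sum_words_level R N _ g (fset_uniq (fset_set X)) g0.
apply: le_trans hm _; rewrite /g.
under eq_bigr do rewrite big_split /=.
rewrite big_split /= lerD//.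
  rewrite -(big_mkord xpredT (fun n => \sum_(w <- words n) if (size w < n0)%N then rw w `^ t else 0)).
  rewrite -(big_mkord xpredT (fun n => \sum_(w <- words n) rw w `^ t)).
  have c0 n : 0 <= \sum_(w <- words n) rw w `^ t by apply: sumr_ge0 => w _; exact: powR_ge0.
  apply: (@le_trans _ _ (\sum_(0 <= n < m | (n < n0)%N) \sum_(w <- words n) rw w `^ t)).
    rewrite [leRHS]big_mkcond; apply: ler_sum => n _.
    rewrite big_seq; case: ltnP => nn0.
      by rewrite -big_seq; apply: ler_sum => w _; case: ifP => // _; exact: powR_ge0.
    by rewrite big1// => w; rewrite mem_words => /eqP ->; rewrite ltnNge nn0.
  rewrite -[leLHS]big_filter; apply: ler_sum_subset => //.
    by rewrite filter_uniq// iota_uniq.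
  by move=> n; rewrite mem_filter !mem_index_iota /= => /andP[->].
apply: le_trans (_ : \sum_(n < m) (size Q)%:R * theta ^+ n <= _).
  by apply: ler_sum => n _; exact: ht.
rewrite -mulr_sumr ler_wpM2l//; apply: le_trans (geometric_tail 0 m t01).
by apply: ler_sum.
Qed.

End ZetaAbscissa.

Lemma cvg_at_right_ereal {R : realType} (f : R -> \bar R) (L : \bar R) :
  (forall rho, 0 < rho -> (L <= f rho)%E) ->
  (forall t : R, (L < t%:E)%E ->
     exists2 rho0, 0 < rho0 & forall rho, 0 < rho <= rho0 -> (f rho <= t%:E)%E) ->
  f rho @[rho --> 0^'+] --> L.
Proof.
move=> hlow hup A.
have near_le t : (L < t%:E)%E -> \forall rho \near 0^'+, (L <= f rho <= t%:E)%E.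
  move=> /hup[rho0 rho00 h]; near=> rho.
  rewrite hlow/=; last by near: rho; exact: nbhs_right_gt.
  by apply: h; apply/andP; split; near: rho; [exact: nbhs_right_gt|exact: nbhs_right_le].
case: L hlow hup near_le => [l| |] hlow hup near_le /=.
- move=> HA; have /nbhs_ballP[e /= e0 He] : nbhs l (fun x : R => A x%:E) by [].
  have e2 : 0 < e / 2 by rewrite divr_gt0.
  have := near_le (l + e / 2); rewrite lte_fin ltrDl => /(_ e2).
  apply: filterS => rho /andP[]; rewrite /=; case: (f rho) => [y| |]//=.
  rewrite !lee_fin => ly yl; apply: He; rewrite -ball_normE /= ltr_distlC.
  by apply/andP; split; lra.
- move=> HA; rewrite /nbhs /=; near=> rho; rewrite /=.
  have : (+oo <= f rho)%E by apply: hlow; near: rho; exact: nbhs_right_gt.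
  by rewrite leye_eq /= => /eqP ->; exact: nbhs_singleton HA.
- move=> [M [_ HM]]; have := near_le (M - 1); rewrite ltNyr => /(_ erefl).
  apply: filterS => rho /andP[_ h]; apply: HM; apply: le_lt_trans h _.
  by rewrite lte_fin ltrBlDr ltrDl.
Unshelve. all: by end_near. Qed.

Lemma ereal_between {R : realType} (a b : \bar R) : (a < b)%E ->
  exists t : R, (a < t%:E)%E /\ (t%:E < b)%E.
Proof.
case: a b => [a| |] [b| |] //=.
- by rewrite lte_fin => ab; exists ((a + b) / 2); rewrite !lte_fin; split; lra.
- by move=> _; exists (a + 1); rewrite lte_fin ltrDl ltr01 ltry.
- by move=> _; exists (b - 1); rewrite lte_fin ltrBlDr ltrDl ltr01 ltNyr.
- by move=> _; exists 0; rewrite ltry ltNyr.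
Qed.

Section ZetaLimit.
Context {R : realType} {d N : nat}.
Variables (S : 'I_N -> 'rV[R]_d -> 'rV[R]_d) (r p : 'I_N -> R) (K : set 'rV[R]_d).
Variables (beta : R -> R) (D : R).
Hypotheses (r01 : forall i, 0 < r i < 1) (p0 : forall i, 0 < p i).
Hypothesis (p1 : \sum_i p i = 1).
Hypothesis (hbeta : forall q, \sum_(i < N) p i `^ q * r i `^ beta q = 1).
Hypotheses (D0 : 0 < D)
  (diamE : forall w, fine (diam (set_string S K w)) = weight_string r w * D).
Local Notation rw := (weight_string r).
Local Notation pw := (weight_string p).

Let r0 i : 0 < r i. Proof. by case/andP: (r01 i). Qed.
Let rw0 w : 0 < rw w. Proof. exact: weight_gt0. Qed.
Let pw0 w : 0 < pw w. Proof. exact: weight_gt0. Qed.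

Lemma string_exponent_approx eps : 0 < eps ->
  exists n, forall w, (n <= size w)%N ->
    `|string_exponent S K p w - ln (pw w) / ln (rw w)| <= eps.
Proof.
move=> eps0; have [n hn] := word_exponent_approx r01 p0 p1 D0 eps0.
by exists n => w wn; rewrite /string_exponent diamE hn.
Qed.

Lemma ln_ratio_word_lt0 w : (0 < size w)%N -> ln (rw w) < 0.
Proof.
move=> w0; have [lam [Lam [lam0 _ h]]] := ln_weight_bounds r01.
have /andP[+ _] := h w; rewrite -oppr_gt0; apply: lt_le_trans.
by rewrite mulr_gt0// ltr0n.
Qed.

(** Passing from the exponents [ln (pw w) / ln (rw w)] to those of the statement,
    which involve diameters, costs half of the tolerance. *)
Lemma legendre_le_sigma_ab (I : set (seq 'I_N)) alpha rho : 0 < rho ->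
  (forall w, strings w -> `|string_exponent S K p w - alpha| <= rho -> I w) ->
  (legendre beta alpha <= sigma_ab (ZetaSeries I rw))%E.
Proof.
move=> rho0 hI; have rho2 : 0 < rho / 2 by rewrite divr_gt0.
have [n hn] := string_exponent_approx rho2.
apply: (sigma_ab_ge r01 p0 hbeta (n0 := n.+1) rho2) => w wn hw.
have w0 : (0 < size w)%N by exact: leq_trans wn.
have lw0 := ln_ratio_word_lt0 w0.
apply: hI; first by move: w0; rewrite /strings /=; case: (w).
have -> : string_exponent S K p w - alpha =
  (string_exponent S K p w - ln (pw w) / ln (rw w)) + (ln (pw w) / ln (rw w) - alpha) by ring.
apply: le_trans (ler_normD _ _) _; rewrite [leRHS](splitr rho) lerD// ?hn ?(ltnW wn)//.
rewrite -[X in `|_ - X|](mulfK (ltr0_neq0 lw0)) -mulrBl normrM normfV.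
by rewrite (ltr0_norm lw0) ler_pdivrMr ?oppr_gt0.
Qed.

Lemma legendre_le_sigma_nbhd C alpha rho : C alpha -> 0 < rho ->
  (legendre beta alpha <= sigma_ab (zeta_sim_nbhd S r p K C rho))%E.
Proof.
move=> Ca rho0; apply: (legendre_le_sigma_ab rho0) => w sw hw; split=> //.
apply: le_trans (_ : (`|string_exponent S K p w - alpha|%:E <= _)%E); last by rewrite lee_fin.
by apply: ereal_inf_lbound; exists alpha.
Qed.

Lemma sigma_nbhd_le C t : closed C ->
  (forall alpha, C alpha -> (legendre beta alpha < t%:E)%E) ->
  exists2 rho0, 0 < rho0 & forall rho, 0 < rho <= rho0 ->
    (sigma_ab (zeta_sim_nbhd S r p K C rho) <= t%:E)%E.
Proof.
move=> cC hC; have [B B0 hB] := ln_prob_word_bounds r01 p0 p1.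
have [Q [eta [eta0 hQ]]] := finite_certificates B cC hC.
have eta4 : 0 < eta / 4 by rewrite divr_gt0.
have [n hn] := string_exponent_approx eta4.
exists (eta / 4) => // rho /andP[rho0 rhoe].
apply: (sigma_ab_le r01 p0 hbeta (n0 := n.+1) (Q := Q) eta0) => w [sw hw] wn.
have /(hn w) {}hn : (n <= size w)%N by exact: ltnW.
have lw0 : ln (rw w) < 0 by apply: ln_ratio_word_lt0; exact: leq_trans wn.
have /ereal_inf_lt[_ [c Cc <-]] : (dist_set (string_exponent S K p w) C < (eta / 2)%:E)%E.
  apply: le_lt_trans hw _; rewrite lte_fin; lra.
rewrite lte_fin => hc; set x := ln (pw w) / ln (rw w) in hn.
have xlw : ln (pw w) = x * ln (rw w) by rewrite /x divfK// ltr0_neq0.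
have [||q qQ hq] := hQ x c _ Cc.
- have /andP[h1 h2] := hB w; rewrite xlw in h1 h2.
  apply/andP; split.
    by move: h1; rewrite -mulrN pmulr_lge0 ?oppr_gt0.
  by move: h2; rewrite -mulrN ler_pM2r ?oppr_gt0.
- rewrite distrC in hn; have -> : x - c = (x - string_exponent S K p w) + (string_exponent S K p w - c) by ring.
  by apply: le_trans (ler_normD _ _) _; lra.
rewrite /certificate (big_rem q)//= ler_wpDr//.
  by apply: sumr_ge0 => q' _; rewrite mulr_ge0 ?powR_ge0// ltW// weight_gt0// => i; exact: tilt_gt0.
rewrite weight_tilt// !powR_expR// -expRD ler_expR xlw.
have : (t - eta - (x * q + beta q)) * ln (rw w) <= 0.
  by rewrite nmulr_lle0// subr_ge0 ltW.
lra.
Qed.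

Lemma sigma_nbhd_cvg C : closed C ->
  sigma_ab (zeta_sim_nbhd S r p K C rho) @[rho --> 0^'+] -->
  ereal_sup [set legendre beta alpha | alpha in C].
Proof.
move=> cC; apply: cvg_at_right_ereal => [rho rho0|t ht].
  by apply: ge_ereal_sup => _ [alpha Ca <-]; exact: legendre_le_sigma_nbhd.
apply: sigma_nbhd_le => // alpha Ca; apply: le_lt_trans ht.
by apply: ereal_sup_ubound; exists alpha.
Qed.

Lemma sigma_nbhd_cvg1 alpha :
  sigma_ab (zeta_sim_nbhd S r p K [set alpha] rho) @[rho --> 0^'+] --> legendre beta alpha.
Proof.
have := @sigma_nbhd_cvg [set alpha] (@closed_eq _ alpha).
by rewrite image_set1 ereal_sup1.
Qed.

(** If [alpha q + beta q] were negative, then in the identity defining [beta q] the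
    letter on the appropriate side of [alpha] would contribute more than [1]. *)
Lemma legendre_ge0 alpha i j :
  ln (p i) / ln (r i) <= alpha <= ln (p j) / ln (r j) -> (0 <= legendre beta alpha)%E.
Proof.
move=> /andP[hi hj]; apply: legendre_ge => q.
have lr0 k : ln (r k) < 0 by rewrite ln_lt0.
rewrite leNgt; apply/negP => b0.
have hk : exists k, 0 <= q * (ln (p k) - alpha * ln (r k)).
  move: hi hj; rewrite ler_ndivrMr// ler_ndivlMr// => hi hj.
  have [q0|q0] := leP 0 q; [exists i|exists j].
    by rewrite mulr_ge0// subr_ge0.
  by rewrite mulr_le0 ?(ltW q0)// subr_le0.
case: hk => k hk; have : 1 < p k `^ q * r k `^ beta q.
  rewrite !powR_expR// -expRD -expR0 ltr_expR.
  have : 0 < (alpha * q + beta q) * ln (r k) by rewrite nmulr_lgt0// lr0.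
  lra.
rewrite ltNge => /negP; apply; rewrite -(hbeta q) (bigD1 k)//= lerDl.
by apply: sumr_ge0 => l _; rewrite mulr_ge0 ?powR_ge0.
Qed.

Lemma min_exponent_lt_ex t : (min_exponent p r < t%:E)%E ->
  exists i, ln (p i) / ln (r i) < t.
Proof.
rewrite /min_exponent => h; apply: contrapT => /forallNP hn.
move: h; apply/negP; rewrite -leNgt; apply: (big_ind (fun x => (t%:E <= x)%E)) => //=; first exact: leey.
  by move=> x y hx hy; rewrite le_min hx hy.
by move=> i _; rewrite lee_fin leNgt; apply/negP/hn.
Qed.

Lemma max_exponent_gt_ex t : (t%:E < max_exponent p r)%E ->
  exists i, t < ln (p i) / ln (r i).
Proof.
rewrite /max_exponent => h; apply: contrapT => /forallNP hn.
move: h; apply/negP; rewrite -leNgt; apply: (big_ind (fun x => (x <= t%:E)%E)) => //=; first exact: leNye.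
  by move=> x y hx hy; rewrite ge_max hx hy.
by move=> i _; rewrite lee_fin leNgt; apply/negP/hn.
Qed.

(** A boundary point of [C] is approached inside [C] along the segment towards an
    interior point [alpha0]; by concavity the Legendre transform loses little, as
    it is nonnegative at [alpha0]. *)
Lemma sigma_zeta_interval (C : set R) : closed C -> is_interval C ->
  interior C `&` [set t | (min_exponent p r < t%:E)%E /\ (t%:E < max_exponent p r)%E] !=set0 ->
  sigma_ab (zeta_sim S r p K C) = ereal_sup [set legendre beta alpha | alpha in C].
Proof.
move=> cC iC [a0 [Ca0 [/min_exponent_lt_ex[i hi] /max_exponent_gt_ex[j hj]]]].
apply/eqP; rewrite eq_le; apply/andP; split.
  have h rho : 0 < rho -> (sigma_ab (zeta_sim S r p K C) <= sigma_ab (zeta_sim_nbhd S r p K C rho))%E.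
    move=> rho0; apply: ereal_inf_le_tmp => _ [t /= st <-]; exists t => //=.
    apply: le_lt_trans st; apply: ereal_sup_le => _ [X [finX XI] <-]; exists X => //; split=> // w Xw.
    have [sw Cw] := XI w Xw; split=> //.
    apply: le_trans (_ : (`|string_exponent S K p w - string_exponent S K p w|%:E <= _)%E).
      by apply: ereal_inf_lbound; eexists; first exact: Cw.
    by rewrite subrr normr0 lee_fin ltW.
  rewrite leNgt; apply/negP => hlt.
  have [t] := ereal_between hlt.
  move=> [ht1 ht2]; have [|rho0 rho00 /(_ rho0)] := @sigma_nbhd_le C t cC.
    move=> alpha Ca; apply: le_lt_trans ht1.
    by apply: ereal_sup_ubound; exists alpha.
  rewrite rho00 lexx => /(_ erefl) h2.
  by have := le_trans (h _ rho00) h2; rewrite leNgt ht2.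
have [rho rho0 hrho] : exists2 rho, 0 < rho & forall x, `|x - a0| <= rho -> C x.
  move: Ca0; rewrite /interior /= => /nbhs_ballP[e /= e0 He]; exists (e / 2).
    by rewrite divr_gt0.
  move=> x hx; apply: He; rewrite -ball_normE /= distrC; apply: le_lt_trans hx _; lra.
apply: ge_ereal_sup => _ [a Ca <-]; rewrite leNgt; apply/negP => hlt.
have [t [ht1 ht2]] := ereal_between hlt.
have [t' tt' ht'] := lt_legendre_ex ht2.
have B0 q : 0 <= a0 * q + beta q.
  rewrite -lee_fin; apply: le_trans (legendre_le beta a0 q).
  by apply: (@legendre_ge0 a0 i j); rewrite !ltW.
(* The proportion [s] of [alpha0] is small enough for [(1 - s) * t'] to stay above
   [t], whatever the sign of [t']. *)
pose s := (t' - t) / (2 * (`|t'| + (t' - t))).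
have den : 0 < 2 * (`|t'| + (t' - t)) by rewrite mulr_gt0// ltr_wpDl// subr_gt0.
have s0 : 0 < s by rewrite divr_gt0// subr_gt0.
have sE : s * (2 * (`|t'| + (t' - t))) = t' - t by rewrite /s divfK// gt_eqF.
have s1 : s < 1.
  rewrite /s ltr_pdivrMr// mul1r; have := normr_ge0 t'; lra.
pose a' := (1 - s) * a + s * a0.
have tle : t < (1 - s) * t'.
  have : s * t' <= s * `|t'| by rewrite ler_wpM2l ?ler_norm// ltW.
  have : 0 < s * (t' - t) by rewrite mulr_gt0// subr_gt0.
  lra.
have ha' : (t%:E < legendre beta a')%E.
  apply: (@lt_le_trans _ _ ((1 - s) * t')%:E); first by rewrite lte_fin.
  apply: legendre_ge => q; rewrite /a'.
  have h1 : (1 - s) * t' <= (1 - s) * (a * q + beta q) by rewrite ler_wpM2l// subr_ge0 ltW.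
  have h2 : 0 <= s * (a0 * q + beta q) by rewrite mulr_ge0// ltW.
  lra.
have : (legendre beta a' <= sigma_ab (zeta_sim S r p K C))%E; last first.
  by rewrite leNgt (lt_trans ht1 ha').
have srho : 0 < s * rho by rewrite mulr_gt0.
apply: (legendre_le_sigma_ab srho) => w sw hw; split=> //.
set x := string_exponent S K p w in hw *.
(* The exponent [x] near [a'] is again a convex combination of [a] and of a point
   [y] near [a0]. *)
pose y := a0 + (x - a') / s.
have Cy : C y.
  apply: hrho; rewrite /y addrC addKr normrM normfV (gtr0_norm s0) ler_pdivrMr//.
  by rewrite mulrC.
have xE : x = (1 - s) * a + s * y.
  by rewrite /y /a'; field; rewrite gt_eqF.
have [ay|ya] := leP a y.
  apply: (iC a y) => //; rewrite xE; apply/andP; split.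
    have : 0 <= s * (y - a) by rewrite mulr_ge0 ?subr_ge0// ltW.
    lra.
  have : 0 <= (1 - s) * (y - a) by rewrite mulr_ge0 ?subr_ge0// ltW.
  lra.
apply: (iC y a) => //; rewrite xE; apply/andP; split.
  have : 0 <= (1 - s) * (a - y) by rewrite mulr_ge0 ?subr_ge0 ?(ltW ya)// ltW.
  lra.
have : 0 <= s * (a - y) by rewrite mulr_ge0 ?subr_ge0 ?(ltW ya)// ltW.
lra.
Qed.

End ZetaLimit.

(** * Self-similar sets and measures of global similarities *)

(** The data of the theorem once the maps are extended to similarities of the
    whole space, which removes the ambient set from all preimages. *)
Record global_ifs {R : realType} {d N : nat} (T : 'I_N -> 'rV[R]_d -> 'rV[R]_d)
    (r p : 'I_N -> R) (K : set 'rV[R]_d) (mu : probability (borel_rV R d) R) : Prop :=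
  GlobalIFS {
    gi_ratio : forall i, 0 < r i < 1 ;
    gi_sim : forall i x y, eucl_dist (T i x) (T i y) = r i * eucl_dist x y ;
    gi_surj : forall i y, exists x, T i x = y ;
    gi_nonempty : K !=set0 ;
    gi_compact : compact K ;
    gi_fixed : K = \bigcup_i (T i @` K) ;
    gi_p0 : forall i, 0 < p i ;
    gi_p1 : \sum_i p i = 1 ;
    gi_mu : forall A : set (borel_rV R d), measurable A ->
      mu A = (\sum_(i < N) (p i)%:E * mu (T i @^-1` A))%E }.

Section Lipschitz.
Context {R : realType} {d : nat}.
Implicit Types f : 'rV[R]_d -> 'rV[R]_d.

Lemma continuous_similarity f (rho : R) : 0 < rho ->
  (forall x y, eucl_dist (f x) (f y) = rho * eucl_dist x y) -> continuous f.
Proof.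
move=> rho0 simf x B /nbhs_ballP[e /= e0 He]; change (nbhs x (f @^-1` B)).
have d0 : 0 < rho * d.+1%:R :> R by rewrite mulr_gt0// ltr0n.
apply/nbhs_ballP; exists (e / (rho * d.+1%:R)); first by rewrite /= divr_gt0.
move=> y /=; rewrite mx_norm_ball /ball_/= ltr_pdivlMr// => xy; apply: He.
rewrite mx_norm_ball /ball_/=; apply: le_lt_trans (norm_le_eucl_dist _ _) _.
rewrite simf; apply: le_lt_trans xy; rewrite [leRHS]mulrCA ler_wpM2l ?(ltW rho0)//.
apply: le_trans (eucl_dist_le_norm _ _) _.
by rewrite mulrC ler_wpM2l// ler_nat.
Qed.

Lemma measurable_preimage_continuous f (A : set (borel_rV R d)) :
  continuous f -> measurable A -> measurable (f @^-1` A : set (borel_rV R d)).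
Proof.
move=> cf mA; rewrite -[X in measurable X]setTI.
apply: (@measurability _ _ (borel_rV R d) (borel_rV R d) setT f (@open 'rV[R]_d)) => //.
move=> _ [B oB <-]; rewrite setTI; apply: measurable_open.
by move/continuousP : cf; exact.
Qed.

End Lipschitz.

Section GlobalIFS.
Context {R : realType} {d N : nat} {T : 'I_N -> 'rV[R]_d -> 'rV[R]_d}.
Context {r p : 'I_N -> R} {K : set 'rV[R]_d} {mu : probability (borel_rV R d) R}.
Hypothesis H : global_ifs T r p K mu.
Implicit Types (u v w : seq 'I_N) (x y : 'rV[R]_d) (A : set 'rV[R]_d).

Local Notation rw := (weight_string r).
Local Notation pw := (weight_string p).
Local Notation Tw := (map_string T).
Local Notation Kw := (set_string T K).

Lemma ratio_gt0 i : 0 < r i. Proof. by case/andP: (gi_ratio H i). Qed.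

Lemma ratio_word_gt0 w : 0 < rw w. Proof. exact/weight_gt0/ratio_gt0. Qed.

Lemma prob_word_gt0 w : 0 < pw w. Proof. exact/weight_gt0/(gi_p0 H). Qed.

Lemma ratio_word_le1 w : rw w <= 1.
Proof. by apply: weight_le1 => i; have /andP[/ltW -> /ltW ->] := gi_ratio H i. Qed.

Lemma map_string_cat u w x : Tw (u ++ w) x = Tw u (Tw w x).
Proof. by elim: u => //= i u ->. Qed.

Lemma eucl_dist_map_string w x y : eucl_dist (Tw w x) (Tw w y) = rw w * eucl_dist x y.
Proof.
elim: w => [|i w IH] /=; first by rewrite weight_nil mul1r.
by rewrite (gi_sim H) IH weight_cons mulrA.
Qed.

Lemma continuous_gi i : continuous (T i).
Proof. exact: continuous_similarity (ratio_gt0 i) (gi_sim H i). Qed.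

Lemma continuous_map_string w : continuous (Tw w).
Proof. exact: continuous_similarity (ratio_word_gt0 w) (eucl_dist_map_string w). Qed.

Lemma map_string_surj w y : exists x, Tw w x = y.
Proof.
elim: w y => [|i w IH] y /=; first by exists y.
by have [z zy] := gi_surj H i y; have [x xz] := IH z; exists x; rewrite xz.
Qed.

Lemma gi_stable i x : K x -> K (T i x).
Proof. by move=> Kx; rewrite (gi_fixed H); exists i => //; exists x. Qed.

Lemma map_string_stable w x : K x -> K (Tw w x).
Proof. by elim: w x => //= i w IH x Kx; apply: gi_stable; exact: IH. Qed.

Lemma set_string_sub u w : Kw (u ++ w) `<=` Kw u.
Proof.
move=> _ [x Kx <-]; rewrite map_string_cat; exists (Tw w x) => //.
exact: map_string_stable.
Qed.

Lemma closed_set_string w : closed (Kw w).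
Proof.
apply: compact_closed; first exact: norm_hausdorff.
apply: continuous_compact; last exact: (gi_compact H).
by apply: continuous_subspaceT; exact: continuous_map_string.
Qed.

Lemma closed_K : closed K.
Proof. by apply: compact_closed; [exact: norm_hausdorff|exact: (gi_compact H)]. Qed.

Lemma word_of_point x n : K x -> exists2 w, size w = n & Kw w x.
Proof.
elim: n x => [|n IH] x Kx; first by exists [::] => //; exists x.
move: Kx; rewrite {1}(gi_fixed H) => -[i _ [y Ky <-]].
by have [w wn [z Kz <-]] := IH _ Ky; exists (i :: w); [rewrite /= wn|exists z].
Qed.

Lemma bounded_K : exists D : R, forall x y, K x -> K y -> eucl_dist x y <= D.
Proof.
have [x0 Kx0] := gi_nonempty H.
have [b b0 hb] := bounded_eucl_dist x0 (compact_bounded (gi_compact H)).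
exists (b + b) => x y Kx Ky; apply: le_trans (eucl_dist_triangle x0 _ _) _.
by rewrite eucl_distC lerD ?hb.
Qed.

Lemma ratio_word_small (eps : R) : 0 < eps ->
  exists n, forall w, (n <= size w)%N -> rw w <= eps.
Proof. exact: weight_tail (gi_ratio H). Qed.

Lemma measurable_gi i (A : set (borel_rV R d)) : measurable A ->
  measurable (T i @^-1` A : set (borel_rV R d)).
Proof. by apply: measurable_preimage_continuous; exact: continuous_gi. Qed.

Local Notation nu A := (fine (mu (A : set (borel_rV R d)))).

Lemma fine_mu A : measurable (A : set (borel_rV R d)) -> mu A = (nu A)%:E.
Proof. by move=> mA; rewrite fineK// fin_num_measure. Qed.

Lemma mass_eq (A : set (borel_rV R d)) : measurable A ->
  nu A = \sum_i p i * nu (T i @^-1` A).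
Proof.
move=> mA; apply: EFin_inj; rewrite -fine_mu// (gi_mu H)// -sumEFin.
by apply: eq_bigr => i _; rewrite fine_mu//; exact: measurable_gi.
Qed.

Lemma mass_ge0 (A : set (borel_rV R d)) : 0 <= nu A.
Proof. exact/fine_ge0. Qed.

Lemma mass_le1 (A : set (borel_rV R d)) : measurable A -> nu A <= 1.
Proof. by move=> mA; rewrite -lee_fin -fine_mu// probability_le1. Qed.

Lemma mass_le (A B : set (borel_rV R d)) : measurable A -> measurable B ->
  A `<=` B -> nu A <= nu B.
Proof. by move=> mA mB AB; rewrite -lee_fin -!fine_mu// le_measure ?inE. Qed.

Lemma mass_le_bound m n (A : set (borel_rV R d)) : measurable A ->
  (forall w, size w = n -> nu (Tw w @^-1` A) <= m) -> nu A <= m.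
Proof.
elim: n A => [|n IH] A mA h; first exact: (h [::]).
rewrite mass_eq// -[leRHS]mul1r -(gi_p1 H) mulr_suml; apply: ler_sum => i _.
rewrite ler_wpM2l ?(ltW (gi_p0 H i))//; apply: IH; first exact: measurable_gi.
by move=> w wn; have := h (i :: w); rewrite /= wn; exact.
Qed.

Lemma mass_far x : exists2 M : nat -> R, (forall n, 0 < M n) &
  (nu (~` eucl_ball x (M n)) @[n --> \oo] --> (0 : R)).
Proof.
exists (fun n => n.+1%:R) => [n|]; first by rewrite ltr0n.
pose F n : set (borel_rV R d) := ~` eucl_ball x n.+1%:R.
have mF n : measurable (F n) by apply: measurableC; exact: measurable_eucl_ball.
have F0 : \bigcap_n F n = set0.
  rewrite -subset0 => y /(_ (Num.trunc (eucl_dist x y)) I); apply.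
  by rewrite /eucl_ball /= ltW// truncnS_gt.
have := @nonincreasing_cvg_mu _ _ _ mu F _ mF; rewrite F0 measure0 => /(_ _ measurable0).
move=> h; apply: fine_cvg; apply: h.
  by rewrite (le_lt_trans (probability_le1 _ _)) ?ltry//; exact: mF.
move=> m n mn; apply/subsetPset => y /= Fy ym; apply: Fy.
by rewrite /eucl_ball /=; apply: le_trans ym _; rewrite ler_nat.
Qed.

(** Iterating the maps brings every bounded set close to [K], so the measure is
    carried by [K]. *)
Lemma mass_compl_K (A : set (borel_rV R d)) : measurable A -> A `&` K = set0 -> nu A = 0.
Proof.
move=> mA AK.
(* [G eps] is the open [eps]-neighbourhood of [K]. *)
pose G (eps : R) := \bigcup_(k in K) [set y | eucl_dist k y < eps].
have oG eps : open (G eps).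
  apply: bigcup_open => k _; rewrite (_ : [set _ | _] = eucl_dist k @^-1` [set t | t < eps])//.
  apply: open_comp => [y _|]; [exact: continuous_eucl_dist|exact: open_lt].
have mG eps : measurable (~` G eps : set (borel_rV R d)).
  by apply: measurableC; exact: measurable_open.
have G0 eps : 0 < eps -> nu (~` G eps) = 0.
  move=> eps0; apply/eqP; rewrite eq_le mass_ge0 andbT.
  have [x0 Kx0] := gi_nonempty H.
  have [M M0 hM] := mass_far x0.
  rewrite leNgt; apply/negP => pos.
  have /cvgrPdist_lt/(_ _ pos)[n _ /(_ n (leqnn n))] := hM.
  rewrite sub0r normrN ger0_norm ?mass_ge0// => hn.
  have [m hm] := @ratio_word_small (eps / M n / 2) ltac:(by rewrite !divr_gt0).
  suff : nu (~` G eps) <= nu (~` eucl_ball x0 (M n)) by rewrite leNgt hn.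
  apply: (@mass_le_bound _ m) => // w wm; apply: mass_le.
  - apply: measurable_preimage_continuous => //; exact: continuous_map_string.
  - by apply: measurableC; exact: measurable_eucl_ball.
  move=> y /= nG yM; apply: nG; exists (Tw w x0); first exact: map_string_stable.
  rewrite /= eucl_dist_map_string.
  apply: (@le_lt_trans _ _ (eps / M n / 2 * M n)).
    by rewrite ler_pM ?hm ?wm ?(ltW (ratio_word_gt0 _)) ?eucl_dist_ge0.
  rewrite mulrAC divfK ?gt_eqF//; lra.
pose B n : set (borel_rV R d) := ~` G n.+1%:R^-1.
have mB n : measurable (B n) by exact: mG.
have sub : A `<=` \bigcup_n B n.
  move=> y Ay; have nKy : (~` K) y by move=> Ky; have : set0 y by rewrite -AK.
  have oK : open (~` K) by rewrite openC; exact: closed_K.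
  have [a a0 ha] := open_eucl_ball oK nKy.
  exists (Num.trunc a^-1) => // -[k Kk /=]; rewrite eucl_distC => yk.
  have : (~` K) k; last exact.
  apply: ha; rewrite /eucl_ball /=; apply: le_trans (ltW yk) _.
  by rewrite -[leRHS]invrK lef_pV2 ?posrE ?invr_gt0// ltW// truncnS_gt.
suff : mu A = 0%E by move=> ->.
apply: measure_negligible => //; apply: (negligibleS sub).
apply: negligible_bigcup => n; apply/negligibleP; first exact: mB.
by apply: etrans (fine_mu (mB n)) _; rewrite G0// invr_gt0.
Qed.

Lemma mass_ge_word w (A : set (borel_rV R d)) : measurable A -> Kw w `<=` A -> pw w <= nu A.
Proof.
elim: w A => [|i w IH] A mA wA.
  rewrite weight_nil -lee_fin -fine_mu//.
  have mK : measurable (K : set (borel_rV R d)) by apply: measurable_closed; exact: closed_K.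
  have muK : mu K = 1%E.
    rewrite -[K]setCK; rewrite probability_setC; last exact: measurableC.
    rewrite fine_mu; last exact: measurableC.
    by rewrite mass_compl_K ?sube0//; [exact: measurableC|rewrite setICl].
  rewrite -muK le_measure ?inE// => x Kx; apply: wA; by exists x.
rewrite mass_eq// weight_cons (bigD1 i)//= ler_wpDr//.
  by apply: sumr_ge0 => j _; rewrite mulr_ge0 ?mass_ge0// ltW// (gi_p0 H).
rewrite ler_wpM2l ?(ltW (gi_p0 H _))//; apply: IH; first exact: measurable_gi.
by move=> _ [x Kx <-]; apply: wA; exists x.
Qed.

Lemma mass_le_level n (A : set (borel_rV R d)) : measurable A ->
  nu A <= \sum_(w <- words n | `[< Kw w `&` A !=set0 >]) pw w.
Proof.
elim: n A => [|n IH] A mA.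
  rewrite big_mkcond big_seq1 weight_nil; case: asboolP => [_|hA]; first exact: mass_le1.
  rewrite mass_compl_K//; apply/seteqP; split=> // x [Ax Kx].
  by apply: hA; exists x; split=> //; exists x.
rewrite mass_eq// sum_wordsS; apply: ler_sum => i _.
apply: le_trans (ler_wpM2l (ltW (gi_p0 H i)) (IH _ (measurable_gi i mA))) _.
rewrite mulr_sumr [leLHS]big_mkcond [leRHS]big_mkcond /=; apply: ler_sum => w _.
case: asboolP => [[_ [[x Kx <-] Ax]]|_].
  rewrite ifT ?weight_cons//; apply/asboolP; exists (T i (Tw w x)); split=> //.
  by exists x.
by case: ifP => // _; rewrite ltW// prob_word_gt0.
Qed.

(** Since words overlapping a set can be regrouped by their prefixes, any finite
    list of words whose cylinders account for all long words meeting [A]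
    controls the mass of [A]. The pieces may overlap: the weights of the words are
    added, not the masses of their cylinders. *)
Lemma mass_le_cover n (ws : seq (seq 'I_N)) (A : set (borel_rV R d)) : measurable A ->
  (forall w, size w = n -> Kw w `&` A !=set0 -> exists2 v, v \in ws & prefix v w) ->
  nu A <= \sum_(v <- ws) pw v.
Proof.
move=> mA hA; apply: le_trans (mass_le_level n mA) _.
apply: (@le_trans _ _ (\sum_(v <- ws) \sum_(w <- words n | prefix v w) pw w)); last first.
  apply: ler_sum => v _; apply: sum_weight_prefix; last exact: (gi_p1 H).
  by move=> i; rewrite ltW// (gi_p0 H).
under [leRHS]eq_bigr do rewrite big_mkcond.
rewrite exchange_big /= big_mkcond big_seq [leRHS]big_seq; apply: ler_sum => w.
rewrite mem_words => /eqP wn; case: asboolP => [/(hA _ wn)[v vs vw]|_].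
  rewrite (big_rem v)//= vw ler_wpDr// sumr_ge0// => u _.
  by case: ifP => // _; rewrite ltW// prob_word_gt0.
by rewrite sumr_ge0// => u _; case: ifP => // _; rewrite ltW// prob_word_gt0.
Qed.

Lemma mass_ball_gt0 x rho : K x -> 0 < rho -> 0 < nu (eucl_ball x rho).
Proof.
move=> Kx rho0; have [D hD] := bounded_K.
have [n hn] := @ratio_word_small (rho / (`|D| + 1)) ltac:(by rewrite divr_gt0// ltr_wpDl).
have [w wn Kwx] := word_of_point n Kx.
apply: lt_le_trans (prob_word_gt0 w) _; apply: mass_ge_word.
  exact: measurable_eucl_ball.
move=> _ [y Ky <-]; case: Kwx => z Kz <-; rewrite /eucl_ball /= eucl_dist_map_string.
apply: (@le_trans _ _ (rho / (`|D| + 1) * (`|D| + 1))); last first.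
  by rewrite divfK// gt_eqF// ltr_wpDl.
rewrite ler_pM ?hn ?wn ?(ltW (ratio_word_gt0 _)) ?eucl_dist_ge0//.
by apply: le_trans (hD _ _ Kz Ky) _; rewrite ler_wpDr// ler_norm.
Qed.

Hypothesis diam0 : (0 < diam K)%E.

Lemma diam_KE : diam K = (fine (diam K))%:E.
Proof.
rewrite fineK//; have [D hD] := bounded_K; rewrite ge0_fin_numE ?ltW//.
apply: (@le_lt_trans _ _ D%:E); last exact: ltry.
by apply: ge_ereal_sup => _ [[x y] [/= Kx Ky] <-]; rewrite lee_fin; exact: hD.
Qed.

Lemma fine_diam_gt0 : 0 < fine (diam K).
Proof. by rewrite -lte_fin -diam_KE. Qed.

Lemma eucl_dist_le_diam x y : K x -> K y -> eucl_dist x y <= fine (diam K).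
Proof.
move=> Kx Ky; rewrite -lee_fin -diam_KE; apply: ereal_sup_ubound.
by exists (x, y).
Qed.

Lemma diam_set_string w : diam (Kw w) = (rw w * fine (diam K))%:E.
Proof.
rewrite EFinM -diam_KE; apply/eqP; rewrite eq_le; apply/andP; split.
  apply: ge_ereal_sup => _ [[_ _] [/= [x Kx <-] [y Ky <-]] <-].
  rewrite eucl_dist_map_string EFinM lee_wpmul2l ?lee_fin ?(ltW (ratio_word_gt0 _))//.
  by apply: ereal_sup_ubound; exists (x, y).
rewrite -lee_pdivlMl ?ratio_word_gt0//.
apply: ge_ereal_sup => _ [[x y] [/= Kx Ky] <-].
rewrite lee_pdivlMl ?ratio_word_gt0// -EFinM -eucl_dist_map_string.
by apply: ereal_sup_ubound; exists (Tw w x, Tw w y) => //; split; [exists x|exists y].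
Qed.

Lemma set_string_dist w x y : Kw w x -> Kw w y ->
  eucl_dist x y <= rw w * fine (diam K).
Proof.
move=> [x' Kx <-] [y' Ky <-]; rewrite eucl_dist_map_string ler_wpM2l//.
  exact/ltW/ratio_word_gt0.
exact: eucl_dist_le_diam.
Qed.

End GlobalIFS.

(** * Separation of pieces *)

Section FiniteEnumeration.
Variable I : eqType.

Lemma finite_enumeration (P : I -> Prop) M :
  (forall s : seq I, uniq s -> (forall x, x \in s -> P x) -> (size s <= M)%N) ->
  exists s : seq I, uniq s /\ forall x, x \in s <-> P x.
Proof.
move=> hM; pose Q n := `[< exists s : seq I, [/\ uniq s, forall x, x \in s -> P x & size s = n] >].
have Q0 : exists n, Q n by exists 0%N; apply/asboolP; exists [::].
have QM n : Q n -> (n <= M)%N by move=> /asboolP[s [us sP <-]]; exact: hM.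
case: (ex_maxnP Q0 QM) => n /asboolP[s [us sP sn]] maxn.
exists s; split=> // x; split=> [/sP//|Px]; apply: contrapT => /negP xs.
suff /maxn : Q n.+1 by rewrite ltnn.
apply/asboolP; exists (x :: s); split=> /=; [by rewrite xs|move=> y|by rewrite sn].
by rewrite inE => /orP[/eqP ->//|/sP].
Qed.

Lemma incomparable_split (w v : seq I) : ~~ prefix w v -> ~~ prefix v w ->
  exists u i j w' v', [/\ i != j, w = u ++ i :: w' & v = u ++ j :: v'].
Proof.
elim: w v => [|i w IH] [|j v]//=.
have [<-|ij] := eqVneq i j; last by move=> _ _; exists [::], i, j, w, v.
by move=> /IH h /h[u [k [l [w' [v' [kl -> ->]]]]]]; exists (i :: u), k, l, w', v'.
Qed.

End FiniteEnumeration.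

(** What remains of the open set condition in the sequel: the orbits of one point
    along incomparable words stay apart. *)
Definition separated_orbits {R : realType} {d N : nat} (T : 'I_N -> 'rV[R]_d -> 'rV[R]_d)
    (r : 'I_N -> R) : Prop :=
  exists o a, 0 < a /\ forall w v, ~~ prefix w v -> ~~ prefix v w ->
    a * weight_string r w <= eucl_dist (map_string T w o) (map_string T v o).

Section Separation.
Context {R : realType} {d N : nat} {T : 'I_N -> 'rV[R]_d -> 'rV[R]_d}.
Context {r p : 'I_N -> R} {K : set 'rV[R]_d} {mu : probability (borel_rV R d) R}.
Hypothesis H : global_ifs T r p K mu.
Implicit Types (u v w : seq 'I_N) (x y : 'rV[R]_d).

Local Notation rw := (weight_string r).
Local Notation pw := (weight_string p).
Local Notation Tw := (map_string T).
Local Notation Kw := (set_string T K).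
Local Notation mass A := (fine (mu (A : set (borel_rV R d)))).

(** The images of the open set along incomparable words are disjoint, and the image
    along [w] contains a ball of radius [a * rw w] around the image of the point. *)
Lemma open_set_separated (O : set 'rV[R]_d) : open O -> O !=set0 ->
  (forall i, T i @` O `<=` O) ->
  (forall i j, i != j -> (T i @` O) `&` (T j @` O) = set0) -> separated_orbits T r.
Proof.
move=> openO [z Oz] stO disjO; have [a a0 ha] := open_eucl_ball openO Oz.
have stOw w x : O x -> O (Tw w x).
  by elim: w x => //= i w IH x Ox; apply: stO; exists (Tw w x) => //; exact: IH.
exists z, a; split=> // w v wv vw; rewrite leNgt; apply/negP => hlt.
have [y Ty] := map_string_surj H w (Tw v z).
have Oy : O y.
  apply: ha; move: hlt; rewrite -Ty (eucl_dist_map_string H) mulrC.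
  by rewrite ltr_pM2r ?(ratio_word_gt0 H)// => /ltW.
have [u [i [j [w' [v' [ij we ve]]]]]] := incomparable_split wv vw.
have e : T i (Tw w' y) = T j (Tw v' z).
  apply: eucl_dist_eq0; apply/eqP.
  rewrite -(mulrI_eq0 _ (lregP (lt0r_neq0 (ratio_word_gt0 H u)))).
  rewrite -(eucl_dist_map_string H).
  by rewrite -[T i _]/(Tw (i :: w') y) -[T j _]/(Tw (j :: v') z) -!map_string_cat -we -ve Ty eucl_distxx.
have : (T i @` O `&` T j @` O) (T i (Tw w' y)).
  by split; [exists (Tw w' y)|rewrite e; exists (Tw v' z)] => //; exact: stOw.
by rewrite disjO.
Qed.

(** The words along which the contraction ratio first drops to [rho]. *)
Definition is_cut rho w := (rw w <= rho) && (rho < rw (take (size w).-1 w)).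

Lemma cut_nonempty rho w : is_cut rho w -> w != [::].
Proof. by case: w => // /andP[]; rewrite /= weight_nil => h /(le_lt_trans h); rewrite ltxx. Qed.

Lemma cut_prefix rho w : rho < 1 -> rw w <= rho -> exists k, is_cut rho (take k w).
Proof.
move=> rho1 hw; have ex : exists k, rw (take k w) <= rho by exists (size w); rewrite take_size.
case: (ex_minnP ex) => k hk mink; exists k; rewrite /is_cut hk /=.
have kw : (k <= size w)%N by apply: mink; rewrite take_size.
have k0 : (0 < k)%N.
  case: k hk {mink kw} => //; rewrite take0 weight_nil => h.
  by have := le_lt_trans h rho1; rewrite ltxx.
rewrite size_takel// take_takel ?leq_pred// ltNge; apply/negP => /mink.
by rewrite leqNgt prednK// leqnn.
Qed.

Lemma cut_prefix_eq rho w v : is_cut rho w -> is_cut rho v -> prefix w v -> w = v.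
Proof.
move=> /andP[hw _] /andP[_ hv] /prefixP[s vE]; rewrite vE.
case/lastP: s => [|s i] in vE *; first by rewrite cats0.
move: hv; rewrite vE -rcons_cat size_rcons /= -cats1 take_size_cat// => hv.
have h : rw (w ++ s) <= rw w.
  by rewrite weight_cat ler_piMr ?(ratio_word_le1 H)// ltW// (ratio_word_gt0 H).
by have := lt_le_trans hv (le_trans h hw); rewrite ltxx.
Qed.

Lemma cut_cat rho u w : is_cut rho w -> is_cut (rw u * rho) (u ++ w).
Proof.
move=> hw; have w0 := cut_nonempty hw; move: hw => /andP[h1 h2].
rewrite /is_cut weight_cat ler_pM2l ?(ratio_word_gt0 H)// h1 /=.
have -> : take (size (u ++ w)).-1 (u ++ w) = u ++ take (size w).-1 w.
  rewrite size_cat; case: w w0 {h1 h2} => // i w _; rewrite addnS /= take_cat ltnNge leq_addr /=.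
  by rewrite addKn.
by rewrite weight_cat ltr_pM2l ?(ratio_word_gt0 H).
Qed.

Lemma cut_ratio_ge : exists2 m : R, 0 < m <= 1 & forall rho w, is_cut rho w -> m * rho <= rw w.
Proof.
have [lam [Lam [_ Lam0 h]]] := ln_weight_bounds (gi_ratio H).
exists (expR (- Lam)); first by rewrite expR_gt0 -[leRHS]expR0 ler_expR oppr_le0 ltW.
move=> rho w hw; have := cut_nonempty hw; case/lastP: w hw => // w i hw _.
move: hw => /andP[_]; rewrite size_rcons /= -cats1 take_size_cat// => hrho.
rewrite weight_cat mulrC; apply: (@le_trans _ _ (rw w * expR (- Lam))).
  by rewrite ler_wpM2r ?expR_ge0// ltW.
rewrite ler_wpM2l ?(ltW (ratio_word_gt0 H _))//.
have /andP[_] := h [:: i]; rewrite mul1r lerNl -ler_expR lnK// posrE.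
exact: ratio_word_gt0 H _.
Qed.

(** Cylinders of size [rho] near a point are counted by the positions of the
    separated points [Tw w o] on a grid of mesh comparable with [rho]. *)
Lemma cut_count (kappa : R) : separated_orbits T r -> exists M, forall rho x ws, 0 < rho -> uniq ws ->
  (forall w, w \in ws -> is_cut rho w /\ exists2 y, Kw w y & eucl_dist x y <= kappa * rho) ->
  (size ws <= M)%N.
Proof.
move=> [z [a [a0 sep]]]; have [m /andP[m0 m1] hm] := cut_ratio_ge.
have [b b0 hb] := bounded_eucl_dist z (compact_bounded (gi_compact H)).
have am0 : 0 < a * m by rewrite mulr_gt0.
(* The grid has mesh [h], a fraction of the separation [a * m * rho]; the offset
   [L] makes all coordinates nonnegative. *)
pose L := (Num.trunc (`|kappa + b| * d.+1%:R / (a * m))).+1.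
have hL : `|kappa + b| * d.+1%:R / (a * m) < L%:R by exact: truncnS_gt.
exists #|{ffun 'I_d -> 'I_(2 * L).+1}| => rho x ws rho0 uws hws.
pose h := a * m * rho / d.+1%:R.
have d0 : 0 < d.+1%:R :> R by rewrite ltr0n.
have h0 : 0 < h by rewrite divr_gt0// mulr_gt0.
pose co w j : R := (Tw w z 0 j - x 0 j) / h + L%:R.
have coP w j : w \in ws -> 0 <= co w j < (2 * L).+1%:R.
  move=> /hws[/andP[wrho _] [_ [y Ky <-]] xy].
  have wz : eucl_dist x (Tw w z) <= `|kappa + b| * rho.
    apply: le_trans (eucl_dist_triangle (Tw w y) _ _) _.
    apply: (@le_trans _ _ (kappa * rho + rho * b)).
      rewrite lerD// (eucl_dist_map_string H) ler_pM ?(ltW (ratio_word_gt0 H _)) ?eucl_dist_ge0//.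
      by rewrite eucl_distC hb.
    by rewrite [rho * b]mulrC -mulrDl ler_wpM2r ?(ltW rho0)// ler_norm.
  have : `|(Tw w z 0 j - x 0 j) / h| < L%:R.
    rewrite normrM normfV (gtr0_norm h0) distrC.
    apply: le_lt_trans hL; rewrite ler_pdivrMr//.
    apply: le_trans (ler_coord_eucl_dist _ _ j) _; apply: le_trans wz _.
    by rewrite /h le_eqVlt; apply/orP; left; apply/eqP; field; rewrite !gt_eqF.
  rewrite ltr_norml => /andP[h1 h2]; rewrite /co -natr1 natrM; apply/andP; split; lra.
pose f w : {ffun 'I_d -> 'I_(2 * L).+1} := [ffun j => inord (Num.trunc (co w j))].
rewrite -(size_map f); apply: leq_trans (max_card (mem (map f ws))); rewrite cardE.
apply: uniq_leq_size; last by move=> g gs; rewrite mem_enum.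
rewrite map_inj_in_uniq// => w v ws1 vs1 fwv; apply/eqP; apply: contraT => wv.
have [cw _] := hws _ ws1; have [cv _] := hws _ vs1.
have hw1 : ~~ prefix w v by apply/negP => /(cut_prefix_eq cw cv) e; rewrite e eqxx in wv.
have hw2 : ~~ prefix v w by apply/negP => /(cut_prefix_eq cv cw) e; rewrite e eqxx in wv.
have := sep _ _ hw1 hw2; rewrite leNgt => /negP; case.
apply: le_lt_trans (eucl_dist_le_sum _ _) _.
have lt_h j : `|Tw w z 0 j - Tw v z 0 j| <= h.
  have e : Num.trunc (co w j) = Num.trunc (co v j).
    have trunc_lt u : u \in ws -> (Num.trunc (co u j) < (2 * L).+1)%N.
      move=> /(coP _ j) /andP[c0 c1]; rewrite -(ltr_nat R); apply: le_lt_trans c1.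
      by have /andP[] := truncn_itv c0.
    have := congr1 (fun g : {ffun _ -> _} => val (g j)) fwv.
    by rewrite !ffunE /= !inordK ?trunc_lt.
  have /andP[cw0 _] := coP w j ws1; have /andP[cv0 _] := coP v j vs1.
  have /andP[w1 w2] := truncn_itv cw0; have /andP[v1 v2] := truncn_itv cv0.
  rewrite e in w1 w2; rewrite -natr1 in w2 v2.
  have : `|co w j - co v j| <= 1 by rewrite ler_distl; apply/andP; split; lra.
  rewrite /co (_ : _ - _ = (Tw w z 0 j - Tw v z 0 j) / h); last by field; rewrite gt_eqF.
  by rewrite normrM normfV (gtr0_norm h0) ler_pdivrMr// mul1r.
apply: (@le_lt_trans _ _ (\sum_(j < d) h)); first by apply: ler_sum => j _; exact: lt_h.
rewrite sumr_const card_ord -mulr_natl.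
apply: (@lt_le_trans _ _ (a * (m * rho))); last by rewrite ler_pM2l// hm.
rewrite /h [ltRHS]mulrA mulrA ltr_pdivrMr// mulrC.
by rewrite ltr_pM2l ?mulr_gt0// ltr_nat.
Qed.

Hypothesis sepT : separated_orbits T r.
Hypothesis diam0 : (0 < diam K)%E.
Local Notation D := (fine (diam K)).

Let neighbour v w := is_cut (rw v) w /\
  exists x y, [/\ Kw v x, Kw w y & eucl_dist x y <= rw v].

Let letter : exists i : 'I_N, True.
Proof. by have [x] := gi_nonempty H; rewrite (gi_fixed H) => -[i _ _]; exists i. Qed.

(** Some word [v] has the largest possible number of neighbours of its own size.
    After any prefix [u], the shifted neighbours of [v] are as many neighbours of
    [u ++ v], so there are no others: near [Kw (u ++ v)], all of [K] is coded
    through [u]. This plays the part of a strong open set condition. *)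
Lemma isolating_word : exists v c, 0 < c /\ forall u w x y,
  Kw (u ++ v) x -> Kw w y -> rw w <= rw (u ++ v) -> eucl_dist x y <= c * rw u ->
  prefix u w.
Proof.
have [k0 Kk0] := gi_nonempty H.
have [M hM] := cut_count (D + 1) sepT.
have fin v : exists s : seq (seq 'I_N), uniq s /\ forall w, w \in s <-> neighbour v w.
  apply: (@finite_enumeration _ _ M) => s us sP.
  apply: (hM (rw v) (Tw v k0)) => //; first exact: ratio_word_gt0 H _.
  move=> w /sP[cw [x [y [Kx Ky xy]]]]; split=> //; exists y => //.
  apply: le_trans (eucl_dist_triangle x _ _) _.
  rewrite mulrDl mul1r lerD// mulrC; apply: (set_string_dist H) => //.
  by exists k0.
(* [Q n]: some word has exactly [n] neighbours; the bound [M] gives a largest [n]. *)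
pose Q n := `[< exists v s, [/\ v != [::], uniq s, forall w, w \in s <-> neighbour v w & size s = n] >].
have Q0 : exists n, Q n.
  have [i _] := letter; have [s [us sP]] := fin [:: i].
  by exists (size s); apply/asboolP; exists [:: i], s.
have QM n : Q n -> (n <= M)%N.
  move=> /asboolP[v [s [v0 us sP <-]]]; apply: (hM (rw v) (Tw v k0)) => //.
    exact: ratio_word_gt0 H _.
  move=> w /sP[cw [x [y [Kx Ky xy]]]]; split=> //; exists y => //.
  apply: le_trans (eucl_dist_triangle x _ _) _.
  rewrite mulrDl mul1r lerD// mulrC; apply: (set_string_dist H) => //.
  by exists k0.
case: (ex_maxnP Q0 QM) => n /asboolP[v [s [v0 us sP sn]]] maxn.
exists v, (rw v); split; first exact: ratio_word_gt0 H _.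
move=> u w x y Kx Ky hw xy.
have uv0 : u ++ v != [::] by case: (u).
have nbr_cat t : neighbour v t -> neighbour (u ++ v) (u ++ t).
  move=> [ct [x' [y' [[x1 Kx1 <-] [y1 Ky1 <-] xy']]]]; split.
    by rewrite weight_cat; exact: cut_cat.
  exists (Tw (u ++ v) x1), (Tw (u ++ t) y1); split; [by exists x1|by exists y1|].
  rewrite !map_string_cat (eucl_dist_map_string H) weight_cat ler_wpM2l//.
  exact/ltW/(ratio_word_gt0 H).
have [s' [us' s'P]] := fin (u ++ v).
have sub : {subset map (cat u) s <= s'}.
  by move=> _ /mapP[t /sP ts ->]; apply/s'P; exact: nbr_cat.
have umap : uniq (map (cat u) s).
  by rewrite map_inj_uniq// => t1 t2 /eqP; rewrite eqseq_cat// eqxx => /eqP.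
have le_size : (size s' <= size (map (cat u) s))%N.
  by rewrite size_map sn; apply: maxn; apply/asboolP; exists (u ++ v), s'.
have [_ eq_s] := uniq_min_size umap sub le_size.
have uv1 : rw (u ++ v) < 1.
  have := gi_ratio H; case: (u ++ v) uv0 => // i t _ /(_ i) /andP[_ ri1].
  rewrite weight_cons; apply: le_lt_trans ri1.
  by rewrite ler_piMr ?(ratio_word_le1 H)// ltW// (ratio_gt0 H).
have [k ck] := cut_prefix uv1 hw.
have : neighbour (u ++ v) (take k w).
  split=> //; exists x, y; split=> //; last by rewrite weight_cat mulrC.
  by have := @set_string_sub _ _ _ _ _ _ _ _ H (take k w) (drop k w); rewrite cat_take_drop; exact.
move=> /s'P; rewrite -eq_s => /mapP[t _ tE].
by apply: prefix_trans (prefix_take w k); rewrite tE prefix_prefix.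
Qed.

(** All long words whose cylinders meet such a ball start with [u]. *)
Lemma isolating_word_mass v c : 0 < c ->
  (forall u w x y, Kw (u ++ v) x -> Kw w y -> rw w <= rw (u ++ v) ->
     eucl_dist x y <= c * rw u -> prefix u w) ->
  forall u x, Kw (u ++ v) x -> mass (eucl_ball x (c * rw u)) <= pw u.
Proof.
move=> c0 hv u x Kx; have [n hn] := ratio_word_small H (ratio_word_gt0 H (u ++ v)).
have := @mass_le_cover _ _ _ _ _ _ _ _ H n [:: u] _ (measurable_eucl_ball x (c * rw u)).
rewrite big_seq1; apply=> w wn [y [Kwy xy]]; exists u; first by rewrite inE.
by apply: hv Kx Kwy _ xy; apply: hn; rewrite wn.
Qed.

(** Boundedly many cylinders of size [rho] share the mass of a ball of radius [rho]. *)
Lemma heavy_neighbour : exists2 M, 0 < M & forall x rho, K x -> 0 < rho < 1 ->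
  exists w y, [/\ is_cut rho w, Kw w y, eucl_dist x y <= rho &
    mass (eucl_ball x rho) <= M * pw w].
Proof.
have [M hM] := cut_count 1 sepT; exists M.+1%:R => // x rho Kx /andP[rho0 rho1].
pose P w := is_cut rho w /\ exists2 y, Kw w y & eucl_dist x y <= rho.
have [|s [us sP]] := @finite_enumeration _ P M.
  move=> s us sP; apply: (hM rho x) => // w /sP[cw [y Kwy xy]]; split=> //.
  by exists y => //; rewrite mul1r.
have [n hn] := ratio_word_small H rho0.
have hs : mass (eucl_ball x rho) <= \sum_(w <- s) pw w.
  apply: (mass_le_cover H (n := n)); first exact: measurable_eucl_ball.
  move=> w wn [y [Kwy xy]].
  have [k ck] := cut_prefix rho1 (hn w (eq_leq (esym wn))).
  exists (take k w); last exact: prefix_take.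
  apply/sP; split=> //; exists y => //.
  by have := @set_string_sub _ _ _ _ _ _ _ _ H (take k w) (drop k w); rewrite cat_take_drop; exact.
have sM : (size s <= M)%N.
  apply: (hM rho x) => // w /sP[cw [y Kwy xy]]; split=> //.
  by exists y => //; rewrite mul1r.
have [w ws hw] : exists2 w, w \in s & \sum_(v <- s) pw v <= (size s)%:R * pw w.
  have pos := lt_le_trans (mass_ball_gt0 H Kx rho0) hs.
  case: (s) pos => [|w0 t _]; first by rewrite big_nil ltxx.
  have : exists2 w, w \in w0 :: t & forall v, v \in w0 :: t -> pw v <= pw w.
    elim: t w0 => [|w1 t IH] w0.
      by exists w0; rewrite ?mem_head// => v; rewrite inE => /eqP ->.
    have [w wt hw] := IH w1; have [h|h] := leP (pw w0) (pw w).
      exists w; first by rewrite inE wt orbT.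
      by move=> v; rewrite inE => /orP[/eqP ->//|/hw].
    exists w0; first exact: mem_head.
    by move=> v; rewrite inE => /orP[/eqP ->//|/hw/le_trans]; apply; exact: ltW.
  move=> [w wt hw]; exists w => //.
  rewrite -sum1_size natr_sum mulr_suml big_seq [leRHS]big_seq.
  by apply: ler_sum => v /hw; rewrite mul1r.
have [cw [y Kwy xy]] := (sP w).1 ws.
exists w, y; split=> //; apply: le_trans hs _; apply: le_trans hw _.
by rewrite ler_wpM2r ?(ltW (prob_word_gt0 H _))// ler_nat leqW.
Qed.

End Separation.

(** * The upper bound for Hausdorff dimensions *)

Section HausdorffBasics.
Context {R : realType} {d : nat}.
Implicit Types (A B : set 'rV[R]_d) (s delta : R) (x y z : 'rV[R]_d).

Lemma diam_ge0 A : A !=set0 -> (0 <= diam A)%E.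
Proof.
move=> [x Ax]; apply: ereal_sup_ubound; exists (x, x) => //=.
by rewrite eucl_distxx.
Qed.

Lemma diam_set0 : diam (set0 : set 'rV[R]_d) = -oo%E.
Proof. by rewrite /diam setX0 image_set0 ereal_sup0. Qed.

Lemma diam_eucl_ball x (rho : R) : (diam (eucl_ball x rho) <= (2 * rho)%:E)%E.
Proof.
apply: ge_ereal_sup => _ [[y z] [/= xy xz] <-]; rewrite lee_fin.
apply: le_trans (eucl_dist_triangle x _ _) _; rewrite eucl_distC mulr2n mulrDl mul1r.
exact: lerD.
Qed.

Lemma diam_pow_ge0 s A : (0 <= diam_pow s A)%E.
Proof. by rewrite /diam_pow; case: ifP => // _; rewrite lee_fin powR_ge0. Qed.

Lemma diam_pow_eucl_ball s x (rho : R) : 0 <= s -> 0 <= rho ->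
  (diam_pow s (eucl_ball x rho) <= ((2 * rho) `^ s)%:E)%E.
Proof.
move=> s0 rho0; rewrite /diam_pow; case: ifP => _; first by rewrite lee_fin powR_ge0.
have h0 : (0 <= diam (eucl_ball x rho))%E by apply: diam_ge0; exists x; rewrite /eucl_ball /= eucl_distxx.
have h1 := diam_eucl_ball x rho; rewrite lee_fin ge0_ler_powR ?nnegrE ?fine_ge0 ?mulr_ge0//.
rewrite -lee_fin fineK// ge0_fin_numE//; exact: le_lt_trans h1 (ltry _).
Qed.

Lemma hausdorff_premeasure_ge0 s delta A : (0 <= hausdorff_premeasure s delta A)%E.
Proof.
apply: le_ereal_inf_tmp => _ [E _ <-]; apply: nneseries_ge0 => n _ _.
exact: diam_pow_ge0.
Qed.

Lemma hausdorff_measure_ge0 s A : (0 <= hausdorff_measure s A)%E.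
Proof.
apply: le_trans (hausdorff_premeasure_ge0 s 1 A) _.
by apply: ereal_sup_ubound; exists 1 => //=.
Qed.

Lemma hausdorff_premeasure_mono s delta A B : A `<=` B ->
  (hausdorff_premeasure s delta A <= hausdorff_premeasure s delta B)%E.
Proof.
move=> AB; apply: ereal_inf_le_tmp => _ [E [BE hE] <-]; exists E => //; split=> //.
exact: subset_trans BE.
Qed.

Lemma hausdorff_measure_mono s A B : A `<=` B ->
  (hausdorff_measure s A <= hausdorff_measure s B)%E.
Proof.
move=> AB; apply: ge_ereal_sup => _ [delta d0 <-].
apply: le_trans (hausdorff_premeasure_mono s delta AB) _.
by apply: ereal_sup_ubound; exists delta.
Qed.

Lemma dimH_mono A B : A `<=` B -> (dimH A <= dimH B)%E.
Proof.
move=> AB; rewrite /dimH; case: ifPn => [_|A0]; first exact: leNye.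
case: ifPn => [/eqP B0|_].
  by move: AB; rewrite B0 subset0 => A0'; rewrite A0' eqxx in A0.
apply: ereal_inf_le_tmp => _ [s /= [s0 hs] <-]; exists s => //=; split=> //.
by apply/eqP; rewrite eq_le hausdorff_measure_ge0 -hs hausdorff_measure_mono.
Qed.

Lemma dimH_le s A : 0 <= s -> hausdorff_measure s A = 0%E -> (dimH A <= s%:E)%E.
Proof.
move=> s0 hs; rewrite /dimH; case: ifP => _; first exact: leNye.
by apply: ereal_inf_lbound; exists s.
Qed.

End HausdorffBasics.

Section UpperBound.
Context {R : realType} {d N : nat} {T : 'I_N -> 'rV[R]_d -> 'rV[R]_d}.
Context {r p : 'I_N -> R} {K : set 'rV[R]_d} {mu : probability (borel_rV R d) R}.
Hypothesis H : global_ifs T r p K mu.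
Hypothesis diam0 : (0 < diam K)%E.
Implicit Types (u v w : seq 'I_N) (x y : 'rV[R]_d).

Local Notation rw := (weight_string r).
Local Notation pw := (weight_string p).
Local Notation Tw := (map_string T).
Local Notation Kw := (set_string T K).
Local Notation mass A := (fine (mu (A : set (borel_rV R d)))).
Local Notation D := (fine (diam K)).
Local Notation cut := (@is_cut R N r).

Let r0 := gi_ratio H.
Let rw0 := ratio_word_gt0 H.
Let pw0 := prob_word_gt0 H.
Let D0 : 0 < D. Proof. exact: fine_diam_gt0 H diam0. Qed.

Lemma cut_word_of_point x rho : K x -> 0 < rho < 1 -> exists2 w, cut rho w & Kw w x.
Proof.
move=> Kx /andP[rho0 rho1]; have [n hn] := ratio_word_small H rho0.
have [w wn Kwx] := word_of_point H n Kx.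
have [k ck] := cut_prefix rho1 (hn w (eq_leq (esym wn))).
exists (take k w) => //.
by have := @set_string_sub _ _ _ _ _ _ _ _ H (take k w) (drop k w); rewrite cat_take_drop; exact.
Qed.

Lemma light_cylinder x rho : K x -> 0 < rho < D ->
  exists w, [/\ cut (rho / D) w, Kw w x & pw w <= mass (eucl_ball x rho)].
Proof.
move=> Kx /andP[rho0 rhoD]; have [|w cw Kwx] := @cut_word_of_point x (rho / D) Kx.
  by rewrite divr_gt0// ltr_pdivrMr// mul1r.
exists w; split=> //; apply: (mass_ge_word H); first exact: measurable_eucl_ball.
move=> y Kwy; rewrite /eucl_ball /=; apply: le_trans (set_string_dist H diam0 Kwx Kwy) _.
by move: cw => /andP[h _]; rewrite -ler_pdivlMr.
Qed.

(** The bounds make the local exponents accumulate at every point, in a compact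
    interval. *)
Lemma log_ratio_bounds : exists B, 0 <= B /\ forall x, K x ->
  \forall rho \near 0^'+, 0 <= log_ratio mu x rho <= B.
Proof.
have [B B0 hB] := ln_prob_word_bounds (gi_ratio H) (gi_p0 H) (gi_p1 H).
have [m /andP[m0 m1] hm] := cut_ratio_ge H.
exists (2 * B); split; first by rewrite mulr_ge0.
move=> x Kx; near=> rho.
have rho0 : 0 < rho by near: rho; exact: nbhs_right_gt.
have rho1 : rho < 1 by near: rho; exact: nbhs_right_lt.
have rhoD : rho < D by near: rho; exact: nbhs_right_lt.
have rhoe : rho < expR (- `|ln (m / D)|) by near: rho; apply: nbhs_right_lt; exact: expR_gt0.
have lrho : ln rho < 0 by rewrite ln_lt0// rho0.
have mass0 := mass_ball_gt0 H Kx rho0.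
rewrite /log_ratio; apply/andP; split.
  rewrite -mulrNN -invrN divr_ge0// oppr_ge0 ?(ltW lrho)//.
  by rewrite ln_le0// (mass_le1 (measurable_eucl_ball _ _)).
have [|w [cw Kwx hw]] := @light_cylinder x rho Kx; first by rewrite rho0.
rewrite ler_ndivrMr// -lerN2 -mulrN.
have h1 : - ln (mass (eucl_ball x rho)) <= - ln (pw w) by rewrite lerN2 ler_ln ?posrE.
apply: le_trans h1 _; have /andP[_ h2] := hB w; apply: le_trans h2 _.
rewrite (mulrC 2) -mulrA ler_wpM2l//.
have h3 : ln rho + ln (m / D) <= ln (rw w).
  rewrite -lnM ?posrE ?divr_gt0 ?invr_gt0// ler_ln ?posrE ?mulr_gt0 ?invr_gt0//.
  by have := hm _ _ cw; rewrite mulrCA.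
have h4 : ln rho <= - `|ln (m / D)|.
  by rewrite -[leRHS]expRK ler_ln ?posrE ?expR_gt0// ltW.
have := ler_norm (- ln (m / D)); rewrite normrN; lra.
Unshelve. all: by end_near. Qed.

Variable beta : R -> R.
Hypothesis hbeta : forall q, \sum_(i < N) p i `^ q * r i `^ beta q = 1.
Hypothesis sepT : separated_orbits T r.
Variable k0 : 'rV[R]_d.
Hypothesis Kk0 : K k0.

(** At a scale [rho] where the local exponent at [x] is close to [alpha], some
    cylinder of size comparable with [rho] near [x] has a small enough exponent
    when [q >= 0] (a heavy neighbour), or a large enough one when [q < 0] (the
    cylinder through [x], contained in the ball). *)
Lemma good_cylinder B delta : 0 <= B -> 0 < delta -> exists c k, [/\ 0 <= c, 0 < k &
  forall n, exists2 rho0, 0 < rho0 & forall x rho alpha q, K x -> 0 < rho < rho0 ->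
    0 <= alpha <= B -> `|log_ratio mu x rho - alpha| < delta ->
    exists w, [/\ (n <= size w)%N, eucl_dist x (Tw w k0) <= k * rw w &
      q * alpha * ln (rw w) + `|q| * delta * ln (rw w) - `|q| * c <= q * ln (pw w)]].
Proof.
move=> B0 delta0.
have [m /andP[m0 m1] hm] := cut_ratio_ge H.
have [M M0 hM] := heavy_neighbour H sepT.
have [lam [Lam [lam0 Lam0 hlam]]] := ln_weight_bounds r0.
pose c := `|ln M| + B * `|ln (D / m)| + delta * `|ln D|.
have c1 : 0 <= B * `|ln (D / m)| by rewrite mulr_ge0.
have c2 : 0 <= delta * `|ln D| by rewrite mulr_ge0// ltW.
have c3 : 0 <= `|ln M| by [].
exists c, (m^-1 + D); split.
- by rewrite !addr_ge0.
- by rewrite addr_gt0// invr_gt0.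
move=> n; pose e := expR (- (n%:R * Lam)).
have e0 : 0 < e by exact: expR_gt0.
have szw w rho : rw w <= rho -> rho < e -> (n <= size w)%N.
  move=> wrho rhoe; have : rw w < e by exact: le_lt_trans rhoe.
  rewrite /e -ltr_ln ?posrE ?expR_gt0// expRK => h.
  have /andP[_ h2] := hlam w; rewrite -(ler_nat R) -(ler_pM2r Lam0) ltW//; lra.
exists (Num.min (Num.min 1 D) (Num.min e (D * e))).
  by rewrite !lt_min ltr01 D0 e0 mulr_gt0.
move=> x rho alpha q Kx /andP[rho0].
rewrite !lt_min => /andP[/andP[rho1 rhoD] /andP[rhoe rhoDe]] /andP[a0 aB].
have lrho : ln rho < 0 by rewrite ln_lt0// rho0.
have mass0 := mass_ball_gt0 H Kx rho0.
rewrite ltr_distl /log_ratio => /andP[]; rewrite ltr_ndivlMr// ltr_ndivrMr// => hlo hhi.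
have [q0|q0] := leP 0 q.
  have [|w [y [cw Kwy xy hw]]] := hM x rho Kx; first by rewrite rho0.
  have /andP[wrho _] := cw; exists w; split; first exact: szw wrho rhoe.
    apply: le_trans (eucl_dist_triangle y _ _) _; rewrite mulrDl lerD//.
      by apply: le_trans xy _; rewrite mulrC ler_pdivlMr// mulrC; exact: hm.
    by rewrite mulrC; apply: (set_string_dist H) => //; exists k0.
  have h1 : ln (mass (eucl_ball x rho)) <= ln M + ln (pw w).
    by rewrite -lnM ?posrE// ler_ln ?posrE ?mulr_gt0.
  have h2 : (alpha + delta) * ln (rw w) <= (alpha + delta) * ln rho.
    by rewrite ler_wpM2l ?addr_ge0 ?(ltW delta0)// ler_ln ?posrE.
  have h3 := ler_norm (ln M).
  have h4 : (alpha + delta) * ln (rw w) - c <= ln (pw w) by rewrite /c; lra.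
  have := ler_wpM2l q0 h4; rewrite (ger0_norm q0); lra.
have [|w [cw Kwx hw]] := @light_cylinder x rho Kx; first by rewrite rho0.
have /andP[wrho _] := cw; exists w; split.
- by apply: szw wrho _; rewrite ltr_pdivrMr// mulrC.
- apply: le_trans (_ : rw w * D <= _); first by apply: (set_string_dist H) => //; exists k0.
  by rewrite mulrC ler_wpM2r ?(ltW (rw0 _))// lerDr invr_ge0 ltW.
have h1 : ln (pw w) <= ln (mass (eucl_ball x rho)) by rewrite ler_ln ?posrE.
have h2 : ln rho <= ln (rw w) + ln (D / m).
  rewrite -lnM ?posrE ?divr_gt0 ?invr_gt0// ler_ln ?posrE ?mulr_gt0 ?invr_gt0//.
  rewrite mulrA ler_pdivlMr// -ler_pdivrMr// mulrAC mulrC; exact: hm.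
have h3 : ln (rw w) + ln D <= ln rho.
  by rewrite -lnM ?posrE// ler_ln ?posrE ?mulr_gt0// -ler_pdivlMr.
have h4 : alpha * ln rho <= alpha * ln (rw w) + B * `|ln (D / m)|.
  apply: le_trans (ler_wpM2l a0 h2) _; rewrite mulrDr lerD2l.
  apply: le_trans (ler_wpM2l a0 (ler_norm _)) _; exact: ler_wpM2r.
have h5 : - (delta * ln rho) <= - (delta * ln (rw w)) + delta * `|ln D|.
  have : delta * (ln (rw w) - `|ln D|) <= delta * ln rho.
    rewrite ler_pM2l//; have := ler_norm (- ln D); rewrite normrN; lra.
  lra.
have h6 : ln (pw w) <= (alpha - delta) * ln (rw w) + c by rewrite /c; lra.
have := ler_wnM2l (ltW q0) h6; rewrite (ltr0_norm q0); lra.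
Qed.

(** An accumulation value [alpha] in [C] of the local exponents at [x] has a
    certificate [q] in the finite list; [good_cylinder], applied at a scale where the
    exponent is near [alpha], turns it into a certified word. The factor [c] absorbs
    the constants. *)
Lemma acc_set_certified (C : set R) t : closed C ->
  (forall alpha, C alpha -> (legendre beta alpha < t%:E)%E) ->
  exists Q eta c k, [/\ 0 < eta, 0 < c, 0 < k & forall x n, acc_set mu K C x ->
    exists w, [/\ (n <= size w)%N, eucl_dist x (Tw w k0) <= k * rw w &
      rw w `^ t <= c * certificate r p beta Q eta w]].
Proof.
move=> cC hC; have [B [B0 hB]] := log_ratio_bounds.
have [Q [eta [eta0 hQ]]] := finite_certificates B cC hC.
have [Qm Qm0 hQm] : exists2 Qm, 0 <= Qm & forall q, q \in Q -> `|q| <= Qm.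
  exists (\sum_(q <- Q) `|q|); first by rewrite sumr_ge0.
  by move=> q qQ; rewrite (big_rem q)//= lerDl sumr_ge0.
pose delta := eta / (4 * (Qm + 1)).
have Qm1 : 0 < 4 * (Qm + 1) by rewrite mulr_gt0// ltr_wpDl.
have delta0 : 0 < delta by rewrite divr_gt0.
have Qmd : Qm * delta <= eta / 4.
  rewrite /delta mulrA ler_pdivrMr// (_ : eta / 4 * (4 * (Qm + 1)) = eta * Qm + eta); last by field.
  by rewrite mulrC lerDl ltW.
have [c [k [c0 kpos hck]]] := good_cylinder B0 delta0.
exists Q, (eta / 2), (expR (Qm * c)), k; split=> //; [by rewrite divr_gt0|exact: expR_gt0|].
move=> x n [Kx accx].
have [alpha [aB acl]] : `[0, B] `&` cluster (log_ratio mu x rho @[rho --> 0^'+]) !=set0.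
  apply: (@segment_compact R 0 B) => //.
  by have := hB x Kx; apply: filterS => rho h; rewrite /= in_itv.
have Ca := accx _ acl; rewrite /= in_itv /= in aB.
have [q qQ hq] := hQ alpha alpha aB Ca ltac:(by rewrite subrr normr0 ltW).
have [rho0 rho00 hrho] := hck n.
have [y [[rho [rhoI <-]]]] : ([set log_ratio mu x rho | rho in [set rho | 0 < rho < rho0]] `&`
    ball alpha delta) !=set0.
  apply: acl; last exact: nbhsx_ballx.
  rewrite /nbhs /=; near=> rho; exists rho => //=; apply/andP; split; near: rho.
    exact: nbhs_right_gt.
  exact: nbhs_right_lt.
rewrite -ball_normE /= distrC => hd.
have [w [nw xw hw]] := hrho x rho alpha q Kx rhoI aB hd.
exists w; split=> //; rewrite /certificate (big_rem q)//= mulrDr ler_wpDr//.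
  apply: mulr_ge0; first exact: expR_ge0.
  by apply: sumr_ge0 => q' _; rewrite mulr_ge0 ?powR_ge0// ltW// weight_gt0// => i; exact: tilt_gt0 r0 (gi_p0 H) _ _.
rewrite (weight_tilt beta r0 (gi_p0 H)) !powR_expR// -!expRD ler_expR.
have lw : ln (rw w) <= 0 by rewrite ln_le0// (ratio_word_le1 H).
have h1 : (t - eta - (alpha * q + beta q)) * ln (rw w) <= 0.
  by rewrite mulr_ge0_le0// subr_ge0 ltW.
have h2 : (eta / 4 - `|q| * delta) * ln (rw w) <= 0.
  rewrite mulr_ge0_le0// subr_ge0; apply: le_trans Qmd.
  by rewrite ler_wpM2r ?hQm// ltW.
have h3 : `|q| * c <= Qm * c by rewrite ler_wpM2r ?hQm.
have h4 : eta * ln (rw w) <= 0 by rewrite mulr_ge0_le0// ltW.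
lra.
Unshelve. all: by end_near. Qed.

Lemma exprn_small (theta M eps : R) : 0 < theta < 1 -> 0 < eps ->
  exists n0, forall n, (n0 <= n)%N -> M * theta ^+ n <= eps.
Proof.
move=> /andP[t0 t1] eps0; have M0 : 0 < `|M| + 1 by rewrite ltr_wpDl.
have tc : `|theta| < 1 by rewrite gtr0_norm.
have /cvgrPdist_lt h := cvg_expr tc.
have [n0 _ hn] := h _ (divr_gt0 eps0 M0).
exists n0 => n /hn; rewrite sub0r normrN gtr0_norm ?exprn_gt0// ltr_pdivlMr// => lt_eps.
apply: le_trans (ltW lt_eps); rewrite mulrC ler_wpM2l ?exprn_ge0 ?ltW//.
by rewrite ltr_pwDr// ler_norm.
Qed.

(** The diameters of the balls attached to certified words have summable powers of
    order [t], and the words of length at least [n] already provide a covering. *)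
Lemma dimH_le_certified (A : set 'rV[R]_d) t Q eta c k : A !=set0 ->
  0 < eta -> 0 < c -> 0 < k ->
  (forall x n, A x -> exists w, [/\ (n <= size w)%N, eucl_dist x (Tw w k0) <= k * rw w &
      rw w `^ t <= c * certificate r p beta Q eta w]) ->
  (dimH A <= t%:E)%E.
Proof.
move=> [x0 Ax0] eta0 c0 kpos hA.
have p0 := gi_p0 H.
have cert0 w : 0 <= certificate r p beta Q eta w by exact: certificate_ge0.
(* If [t <= 0], then [rw w ^ t >= 1], while the certificates of long words tend
   to [0]. *)
have t0 : 0 < t.
  rewrite ltNge; apply/negP => t0.
  pose M := c * (size Q)%:R + 1.
  have M0 : 0 < M by rewrite ltr_wpDl// mulr_ge0// ltW.
  have [n hn] := ratio_word_small H (expR_gt0 (- (ln M / eta))).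
  have [w [/hn wn _ hw]] := hA x0 n Ax0.
  have lw : ln (rw w) <= - (ln M / eta) by rewrite -(expRK (- _)) ler_ln ?posrE ?expR_gt0.
  have lw0 : ln (rw w) <= 0 by rewrite ln_le0// (ratio_word_le1 H).
  have h1 : 1 <= rw w `^ t.
    by rewrite powR_expR// -[leLHS]expR0 ler_expR mulr_le0.
  have h2 : certificate r p beta Q eta w <= (size Q)%:R * rw w `^ eta.
    rewrite /certificate -sum1_size natr_sum mulr_suml; apply: ler_sum => q _.
    by rewrite ler_wpM2r ?powR_ge0// (weight_tilt_le1 r0 p0 hbeta).
  have h3 : rw w `^ eta <= M^-1.
    rewrite powR_expR// -[leRHS]lnK ?posrE ?invr_gt0// ler_expR lnV ?posrE//.
    by move: lw; rewrite -mulNr ler_pdivlMr// mulrC.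
  have : 1 <= c * (size Q)%:R * M^-1.
    apply: le_trans h1 _; apply: le_trans hw _; rewrite -mulrA ler_wpM2l ?(ltW c0)//.
    by apply: le_trans h2 _; rewrite ler_wpM2l.
  by rewrite ler_pdivlMr// mul1r /M gerDl leNgt ltr01.
apply: dimH_le; first exact: ltW.
apply/eqP; rewrite eq_le hausdorff_measure_ge0 andbT.
apply: ge_ereal_sup => _ [delta /= delta0 <-].
apply/lee_addgt0Pr => eps eps0; rewrite add0e.
have [theta t01 htheta] := certificate_level_sum r0 p0 hbeta eta0.
have /andP[th0 th1] := t01.
pose c1 := (2 * k) `^ t * c.
have c10 : 0 <= c1 by rewrite mulr_ge0 ?powR_ge0// ltW.
have [n1 hn1] := exprn_small (c1 * (size Q)%:R / (1 - theta)) t01 eps0.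
have dk0 : 0 < delta / (2 * k) by rewrite divr_gt0// mulr_gt0.
have [n2 hn2] := ratio_word_small H dk0.
pose n := maxn n1 n2.
pose good w := (n <= size w)%N && (rw w `^ t <= c * certificate r p beta Q eta w).
pose U w := if good w then eucl_ball (Tw w k0) (k * rw w) else set0.
pose E j := if pickle_inv j is Some w then U w else set0.
apply: (@le_trans _ _ (\sum_(0 <= j <oo) diam_pow t (E j))%E).
  apply: ereal_inf_lbound; exists E => //; split.
    move=> x /(hA x n)[w [nw xw hw]]; exists (choice.pickle w) => //.
    rewrite /E pickleK_inv /U /good nw hw /= /eucl_ball /= eucl_distC; exact: xw.
  move=> j; rewrite /E; case: (pickle_inv j) => [w|]; last by rewrite diam_set0 leNye.
  rewrite /U; case: ifP => [/andP[nw _]|_]; last by rewrite diam_set0 leNye.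
  apply: le_trans (diam_eucl_ball _ _) _; rewrite lee_fin mulrA mulrC -ler_pdivlMr ?mulr_gt0//.
  by apply: hn2; apply: leq_trans nw; exact: leq_maxr.
pose g w := if (n <= size w)%N then c1 * certificate r p beta Q eta w else 0.
have g0 w : 0 <= g w by rewrite /g; case: ifP => // _; rewrite mulr_ge0.
have Ug w : (diam_pow t (U w) <= (g w)%:E)%E.
  rewrite /U /good /g; case: ifP => [/andP[-> hw]|_]; last first.
    by rewrite /diam_pow eqxx lee_fin g0.
  apply: le_trans (diam_pow_eucl_ball _ (ltW t0) _) _; first by rewrite mulr_ge0// ltW.
  rewrite lee_fin mulrA powRM ?(ltW (rw0 _)) ?mulr_ge0 ?(ltW kpos)// /c1 -mulrA.
  by rewrite ler_wpM2l ?powR_ge0.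
apply: lime_le; first by apply: is_cvg_nneseries => j _ _; exact: diam_pow_ge0.
near=> m0; pose ws := pmap (@pickle_inv (seq 'I_N)) (index_iota 0 m0).
have h1 : (\sum_(0 <= j < m0) diam_pow t (E j) <= \sum_(w <- ws) (g w)%:E)%E.
  rewrite /ws; elim: (index_iota 0 m0) => [|j s IH]; first by rewrite !big_nil.
  rewrite big_cons /= {1}/E; case: (pickle_inv j) => [w|] /=.
    by rewrite big_cons leeD.
  by rewrite /diam_pow eqxx add0e.
apply: le_trans h1 _; rewrite sumEFin lee_fin.
have uws : uniq ws.
  by apply: (@pmap_uniq _ _ _ choice.pickle); [exact: pickle_invK|exact: iota_uniq].
have [m hm] := sum_words_level uws g0.
apply: le_trans hm _.
apply: le_trans (_ : \sum_(i < m) c1 * (size Q)%:R * (if (n <= i)%N then theta ^+ i else 0) <= _).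
  apply: ler_sum => i _; rewrite big_seq; case: ifP => ni.
    rewrite -mulrA; apply: le_trans (ler_wpM2l c10 (htheta Q i)).
    rewrite mulr_sumr [leRHS]big_seq; apply: ler_sum => w; rewrite mem_words => /eqP wi.
    by rewrite /g wi ni.
  by rewrite mulr0 big1// => w; rewrite mem_words /g => /eqP ->; rewrite ni.
rewrite -mulr_sumr; apply: le_trans (hn1 n (leq_maxl _ _)).
rewrite [leRHS]mulrAC -[leRHS]mulrA ler_wpM2l ?(mulr_ge0 c10)//.
exact: geometric_tail.
Unshelve. all: by end_near. Qed.

Lemma dimH_acc_set_le (C : set R) : closed C ->
  (dimH (acc_set mu K C) <= ereal_sup [set legendre beta alpha | alpha in C])%E.
Proof.
move=> cC; have [->|/set0P A0] := eqVneq (acc_set mu K C) set0.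
  by rewrite /dimH eqxx leNye.
rewrite leNgt; apply/negP => /ereal_between[t [ht1 ht2]].
have [|Q [eta [c [k [eta0 c0 kpos h]]]]] := @acc_set_certified C t cC.
  by move=> alpha Ca; apply: le_lt_trans ht1; apply: ereal_sup_ubound; exists alpha.
have := dimH_le_certified A0 eta0 c0 kpos h.
by rewrite leNgt ht2.
Qed.

End UpperBound.

(** * Avoiding cylinders of small total mass *)

Section Avoidance.
Context {R : realType} {W : eqType}.
Variables (G : nat -> seq W) (m : nat -> W -> R).
Hypotheses (Guniq : forall j, uniq (G j)) (m0 : forall j w, 0 <= m j w)
  (m1 : forall j, \sum_(w <- G j) m j w = 1).

(** The mass that the product of the weights [m j], [m j.+1], ... gives to the
    cylinder of a finite sequence. *)
Fixpoint cylinder_mass j (z : seq W) : R :=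
  if z is w :: z' then m j w * cylinder_mass j.+1 z' else 1.

Let omass j (o : option (seq W)) : R := oapp (cylinder_mass j) 0 o.

(** What is left of a cylinder after the choice of [b]; [None] once it is avoided. *)
Let tail b (o : option (seq W)) : option (seq W) :=
  if o is Some (w :: z) then (if w == b then Some z else None) else None.

Lemma cylinder_mass_ge0 j z : 0 <= cylinder_mass j z.
Proof. by elim: z j => //= w z IH j; rewrite mulr_ge0. Qed.

Let omass_ge0 j o : 0 <= omass j o.
Proof. by case: o => //= z; exact: cylinder_mass_ge0. Qed.

Let omass_tail j o : \sum_(b <- G j) m j b * omass j.+1 (tail b o) <= omass j o.
Proof.
case: o => [[|w z]|] /=.
- by rewrite big1// => b _; rewrite mulr0.
- rewrite (eq_bigr (fun b => if b == w then m j w * cylinder_mass j.+1 z else 0)); last first.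
    by move=> b _; rewrite eq_sym; case: eqP => [->//|_] /=; rewrite mulr0.
  rewrite -big_mkcond /=.
  have [wG|wG] := boolP (w \in G j).
    by rewrite -big_filter filter_pred1_uniq// big_seq1.
  rewrite big_seq_cond big1 ?mulr_ge0 ?cylinder_mass_ge0// => b /andP[bG /eqP bw].
  by rewrite bw (negbTE wG) in bG.
- by rewrite big1// => b _; rewrite mulr0.
Qed.

Let step j (Z : nat -> option (seq W)) :
  (\sum_(0 <= n <oo) (omass j (Z n))%:E < 1)%E ->
  exists2 b, b \in G j & (\sum_(0 <= n <oo) (omass j.+1 (tail b (Z n)))%:E < 1)%E.
Proof.
move=> hZ; apply: contrapT => hn.
have {}hn b : b \in G j -> (1 <= \sum_(0 <= n <oo) (omass j.+1 (tail b (Z n)))%:E)%E.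
  by move=> bG; rewrite leNgt; apply/negP => h; apply: hn; exists b.
move: hZ; rewrite ltNge => /negP; apply.
apply: (@le_trans _ _ (\sum_(b <- G j) (m j b)%:E * \sum_(0 <= n <oo) (omass j.+1 (tail b (Z n)))%:E)%E).
  rewrite -[X in (X%:E <= _)%E](m1 j) -sumEFin big_seq [leRHS]big_seq.
  apply: lee_sum => b bG; rewrite -[leLHS]mule1; apply: lee_wpmul2l; first by rewrite lee_fin.
  exact: hn.
rewrite (eq_bigr (fun b => \sum_(0 <= n <oo) (m j b * omass j.+1 (tail b (Z n)))%:E)%E); last first.
  move=> b _; rewrite -nneseriesZl => [|n _]; last by rewrite lee_fin.
  by apply: eq_eseriesr => n _; rewrite EFinM.
rewrite -nneseries_sum; last by move=> b n _; rewrite lee_fin mulr_ge0.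
apply: lee_nneseries => [n _ _|n _]; rewrite sumEFin lee_fin; last exact: omass_tail.
by apply: sumr_ge0 => b _; rewrite mulr_ge0.
Qed.

(** A greedy choice keeps the conditional mass of the cylinders below [1], so the
    resulting path enters none of them. *)
Lemma avoid_cylinders (Z : nat -> option (seq W)) :
  (\sum_(0 <= n <oo) (oapp (cylinder_mass 0) 0 (Z n))%:E < 1)%E ->
  exists om : nat -> W, (forall j, om j \in G j) /\
    forall n z, Z n = Some z -> z <> mkseq om (size z).
Proof.
move=> hZ.
have /choice[f hf] : forall jZ : nat * (nat -> option (seq W)), exists b,
    (\sum_(0 <= n <oo) (omass jZ.1 (jZ.2 n))%:E < 1)%E ->
    b \in G jZ.1 /\ (\sum_(0 <= n <oo) (omass jZ.1.+1 (tail b (jZ.2 n)))%:E < 1)%E.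
  move=> [j Y] /=; have [h|h] := pselect ((\sum_(0 <= n <oo) (omass j (Y n))%:E < 1)%E).
    by have [b bG hb] := step h; exists b.
  have : G j <> [::] by move=> Gj; have := m1 j; rewrite Gj big_nil => /esym/eqP; rewrite oner_eq0.
  by case: (G j) => // b s _; exists b.
pose st := fix st j := if j is i.+1 then (fun n => tail (f (i, st i)) (st i n)) else Z.
have hst j : (\sum_(0 <= n <oo) (omass j (st j n))%:E < 1)%E.
  by elim: j => [|j IH]; [exact: hZ|have [] := hf (j, st j) IH].
exists (fun j => f (j, st j)); split=> [j|n z Zn zE]; first by have [] := hf (j, st j) (hst j).
have h j : (j <= size z)%N -> st j n = Some (drop j z).
  elim: j => [|j IH] jz; first by rewrite drop0.
  rewrite /= IH ?(ltnW jz)//.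
  have w0 : W by case: (z) jz.
  rewrite (drop_nth w0 jz) /= {1}zE nth_mkseq// eqxx.
  by [].
have := hst (size z); rewrite ltNge => /negP; apply.
rewrite (@nneseriesD1 R _ n)//=; last by move=> k _; rewrite lee_fin.
rewrite h// drop_size /= leeDl//; apply: nneseries_ge0 => k _ _; rewrite lee_fin; exact: omass_ge0.
Qed.

End Avoidance.

(** * Concatenations of blocks *)

(** Words [w ++ v], with [w] in the [j]-th list, are the possible [j]-th blocks of
    a path. Their lengths grow so slowly with [j] that a single block is
    negligible against the preceding ones, while their exponents tend to [alpha]. *)
Record block_scheme {R : realType} {N : nat} (r p : 'I_N -> R) (alpha t : R)
    (v : seq 'I_N) (G : nat -> seq (seq 'I_N)) (len : nat -> nat) : Prop := BlockScheme {
  bs_uniq : forall j, uniq (G j) ;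
  bs_size : forall j w, w \in G j -> size w = len j ;
  bs_pos : forall j, (0 < len j)%N ;
  bs_sum : forall j, 1 <= \sum_(w <- G j) weight_string r (w ++ v) `^ t ;
  bs_len : forall eps : R, 0 < eps -> exists2 C : R, 0 <= C &
    forall j, (len j + size v)%:R <= eps * j%:R + C ;
  bs_exp1 : forall j w, w \in G j ->
    `|ln (weight_string p (w ++ v)) - alpha * ln (weight_string r (w ++ v))|
      <= - ln (weight_string r (w ++ v)) ;
  bs_exp : forall eps : R, 0 < eps -> exists J, forall j w, (J <= j)%N -> w \in G j ->
    `|ln (weight_string p (w ++ v)) - alpha * ln (weight_string r (w ++ v))|
      <= eps * - ln (weight_string r (w ++ v)) }.

Lemma slow_index (ell : nat -> nat) : exists kap : nat -> nat,
  (forall j, kap j * ell (kap j) <= j)%N /\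
  forall k, exists J, forall j, (J <= j)%N -> (k <= kap j)%N.
Proof.
have /choice[kap hk] : forall j, exists k, (k * ell k <= j)%N /\
    forall i, (i <= j)%N -> (i * ell i <= j)%N -> (i <= k)%N.
  move=> j; pose P k := (k <= j)%N && (k * ell k <= j)%N.
  have P0 : exists k, P k by exists 0%N; rewrite /P mul0n.
  have Pj k : P k -> (k <= j)%N by case/andP.
  case: (ex_maxnP P0 Pj) => k /andP[_ hk] maxk; exists k; split=> // i ij hi.
  by apply: maxk; rewrite /P ij.
exists kap; split=> [j|k]; first by have [] := hk j.
exists (maxn k (k * ell k)) => j; rewrite geq_max => /andP[h1 h2].
by have [_] := hk j; apply.
Qed.

Section BlockExistence.
Context {R : realType} {N : nat}.
Variables (r p : 'I_N -> R) (beta : R -> R).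
Hypotheses (r01 : forall i, 0 < r i < 1) (p0 : forall i, 0 < p i).
Hypothesis (hbeta : forall q, \sum_(i < N) p i `^ q * r i `^ beta q = 1).
Local Notation rw := (weight_string r).
Local Notation pw := (weight_string p).

Let r0 i : 0 < r i. Proof. by case/andP: (r01 i). Qed.
Let rw0 w : 0 < rw w. Proof. exact: weight_gt0. Qed.
Let pw0 w : 0 < pw w. Proof. exact: weight_gt0. Qed.

Let block_list alpha t v eps : (t%:E < legendre beta alpha)%E -> 0 < eps ->
  exists (G : seq (seq 'I_N)) len, [/\ uniq G, (0 < len)%N,
    1 <= \sum_(w <- G) rw (w ++ v) `^ t &
    forall w, w \in G -> size w = len /\
     `|ln (pw (w ++ v)) - alpha * ln (rw (w ++ v))| <= eps * - ln (rw (w ++ v))].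
Proof.
move=> ht eps0; have [lam [Lam [lam0 Lam0 hlam]]] := ln_weight_bounds r01.
pose cv := `|ln (pw v) - alpha * ln (rw v)|.
have eps2 : 0 < eps / 2 by rewrite divr_gt0.
have el0 : 0 < eps / 2 * lam by rewrite mulr_gt0.
have [n hn hA] := large_level_sum r01 p0 hbeta ((rw v `^ t)^-1)
  (Num.trunc (cv / (eps / 2 * lam))).+1 ht eps2.
exists [seq w <- words n | `|ln (pw w) - alpha * ln (rw w)| <= eps / 2 * - ln (rw w)], n.
split.
- by rewrite filter_uniq// words_uniq.
- exact: leq_ltn_trans hn.
- rewrite big_filter; under eq_bigr do rewrite weight_cat powRM ?(ltW (rw0 _))//.
  by rewrite -mulr_suml -ler_pdivrMr ?powR_gt0// mul1r.
move=> w; rewrite mem_filter mem_words => /andP[hw /eqP wn]; split=> //.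
rewrite !ln_weight_cat//.
have -> : ln (pw w) + ln (pw v) - alpha * (ln (rw w) + ln (rw v)) =
  (ln (pw w) - alpha * ln (rw w)) + (ln (pw v) - alpha * ln (rw v)) by ring.
apply: le_trans (ler_normD _ _) _; rewrite -/cv.
have h1 : cv <= eps / 2 * - ln (rw w).
  have /andP[+ _] := hlam w; rewrite wn -(ler_pM2l eps2) => h; apply: le_trans h.
  rewrite mulrCA -ler_pdivrMr//; apply: ltW; apply: lt_le_trans (truncnS_gt _) _.
  by rewrite ler_nat.
have h2 : 0 <= eps * - ln (rw v).
  by rewrite mulr_ge0 ?(ltW eps0)// oppr_ge0 ln_le0// weight_le1// => i; rewrite !ltW//; case/andP: (r01 i).
lra.
Qed.

(** The list of blocks with tolerance [k.+1%:R^-1] is used at step [j] only once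
    [j] is at least [k] times the length of its blocks. *)
Lemma exists_block_scheme alpha t v : (t%:E < legendre beta alpha)%E ->
  exists G len, block_scheme r p alpha t v G len.
Proof.
move=> ht.
have /choice[Gl hGl] : forall k : nat, exists Gl : seq (seq 'I_N) * nat,
    [/\ uniq Gl.1, (0 < Gl.2)%N, 1 <= \sum_(w <- Gl.1) rw (w ++ v) `^ t &
    forall w, w \in Gl.1 -> size w = Gl.2 /\
     `|ln (pw (w ++ v)) - alpha * ln (rw (w ++ v))| <= k.+1%:R^-1 * - ln (rw (w ++ v))].
  move=> k; have k0 : 0 < k.+1%:R^-1 :> R by rewrite invr_gt0.
  by have [G [len h]] := block_list v ht k0; exists (G, len).
have [kap [hk1 hk2]] := slow_index (fun k => (Gl k).2 + size v)%N.
have lw0 w : 0 <= - ln (rw w).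
  by rewrite oppr_ge0 ln_le0// weight_le1// => i; rewrite !ltW//; case/andP: (r01 i).
exists (fun j => (Gl (kap j)).1), (fun j => (Gl (kap j)).2); split.
- by move=> j; have [] := hGl (kap j).
- by move=> j w wG; have [_ _ _ /(_ w wG)[]] := hGl (kap j).
- by move=> j; have [] := hGl (kap j).
- by move=> j; have [] := hGl (kap j).
- move=> eps eps0; pose ell j : R := ((Gl (kap j)).2 + size v)%:R.
  have [J hJ] := hk2 (Num.trunc eps^-1).+1.
  have ell0 j : 0 <= ell j by [].
  exists (\sum_(i < J) ell i); first by rewrite sumr_ge0.
  move=> j; rewrite -/(ell j); have [Jj|jJ] := leqP J j.
    rewrite ler_wpDr ?sumr_ge0//.
    have k1 : eps^-1 <= (kap j)%:R.
      by apply: ltW; apply: lt_le_trans (truncnS_gt _) _; rewrite ler_nat hJ.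
    have : (kap j)%:R * ell j <= j%:R by rewrite -natrM ler_nat hk1.
    move=> h; rewrite -ler_pdivrMl//; apply: le_trans h; exact: ler_wpM2r.
  rewrite (bigD1 (Ordinal jJ))//= addrCA lerDl addr_ge0 ?mulr_ge0 ?(ltW eps0)// sumr_ge0//.
- move=> j w wG; have [_ _ _ /(_ w wG)[_ h]] := hGl (kap j).
  by apply: le_trans h _; rewrite ler_piMl// invf_le1// ler1n.
- move=> eps eps0; have [J hJ] := hk2 (Num.trunc eps^-1).
  exists J => j w Jj wG; have [_ _ _ /(_ w wG)[_ h]] := hGl (kap j).
  apply: le_trans h _; rewrite ler_wpM2r// -[leRHS]invrK lef_pV2 ?posrE ?invr_gt0//.
  by apply: ltW; apply: lt_le_trans (truncnS_gt _) _; rewrite ler_nat ltnS hJ.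
Qed.

End BlockExistence.

(** The concatenation of the first [j] blocks of the path [om]; the paths list the
    words [om i] without their common suffix [v]. *)
Fixpoint code_word {N : nat} (v : seq 'I_N) (om : nat -> seq 'I_N) j : seq 'I_N :=
  if j is i.+1 then code_word v om i ++ (om i ++ v) else [::].

Section CodeEstimates.
Context {R : realType} {N : nat}.
Variables (r p : 'I_N -> R) (alpha t : R) (v : seq 'I_N).
Variables (G : nat -> seq (seq 'I_N)) (len : nat -> nat).
Hypotheses (r01 : forall i, 0 < r i < 1) (p0 : forall i, 0 < p i).
Hypothesis (p1 : \sum_i p i = 1).
Hypothesis hG : block_scheme r p alpha t v G len.
Local Notation rw := (weight_string r).
Local Notation pw := (weight_string p).
Local Notation cw := (code_word v).
Local Notation code om := (forall j, om j \in G j).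

Let r0 i : 0 < r i. Proof. by case/andP: (r01 i). Qed.
Let rw0 w : 0 < rw w. Proof. exact: weight_gt0. Qed.
Let pw0 w : 0 < pw w. Proof. exact: weight_gt0. Qed.
Let lw0 w : 0 <= - ln (rw w).
Proof. by rewrite oppr_ge0 ln_le0// weight_le1// => i; rewrite !ltW//; case/andP: (r01 i). Qed.

Lemma size_code_word om j : code om -> (j <= size (cw om j))%N.
Proof.
move=> com; elim: j => //= j IH; rewrite !size_cat (bs_size hG (com j)).
by rewrite -addn1 leq_add// addn_gt0 (bs_pos hG).
Qed.

(** The length of the [j]-th block is negligible against [j], while each of the
    preceding blocks contributes at least a constant to the logarithm. *)
Lemma ln_code_word_step eps : 0 < eps -> exists2 C, 0 <= C & forall om j, code om ->
  - ln (rw (cw om j.+1)) <= (1 + eps) * - ln (rw (cw om j)) + C.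
Proof.
move=> eps0; have [lam [Lam [lam0 Lam0 hlam]]] := ln_weight_bounds r01.
have [|C C0 hC] := bs_len hG (_ : 0 < eps * lam / Lam); first by rewrite divr_gt0// mulr_gt0.
exists (C * Lam); first by rewrite mulr_ge0// ltW.
move=> om j com; rewrite /= ln_weight_cat// opprD mulrDl mul1r -addrA lerD2l.
have /andP[_ h1] := hlam (om j ++ v); rewrite size_cat (bs_size hG (com j)) in h1.
apply: le_trans h1 _.
apply: le_trans (ler_wpM2r (ltW Lam0) (hC j)) _; rewrite mulrDl lerD2r.
rewrite (_ : eps * lam / Lam * j%:R * Lam = eps * (j%:R * lam)); last by field; rewrite gt_eqF.
rewrite ler_pM2l//; have /andP[+ _] := hlam (cw om j); apply: le_trans.
by rewrite ler_pM2r// ler_nat size_code_word.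
Qed.

(** A weighted average of the exponents of the blocks; the finitely many blocks
    with a poor exponent only contribute a constant. *)
Lemma ln_code_word_exponent eps : 0 < eps -> exists2 C, 0 <= C & forall om j, code om ->
  `|ln (pw (cw om j)) - alpha * ln (rw (cw om j))| <= eps * - ln (rw (cw om j)) + C.
Proof.
move=> eps0; have [lam [Lam [lam0 Lam0 hlam]]] := ln_weight_bounds r01.
have [J hJ] := bs_exp hG eps0.
pose b i : R := (len i + size v)%:R * Lam.
have b0 i : 0 <= b i by rewrite mulr_ge0// ltW.
exists (\sum_(i < J) b i); first by rewrite sumr_ge0.
move=> om j com.
apply: (@le_trans _ _ (eps * - ln (rw (cw om j)) + \sum_(i < minn j J) b i)); last first.
  rewrite lerD2l -!(big_mkord xpredT b) (@big_cat_nat _ _ _ (minn j J) 0 J)//= ?geq_minr//.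
  by rewrite lerDl sumr_ge0.
elim: j => [|j IH]; first by rewrite /= !weight_nil ln1 mulr0 subrr normr0 oppr0 mulr0 min0n big_ord0 addr0.
rewrite /= (ln_weight_cat (cw om j) (om j ++ v) p0) (ln_weight_cat (cw om j) (om j ++ v) r0).
set l := ln (rw (om j ++ v)); set l' := ln (rw (cw om j)) in IH *.
have -> : forall a b : R, a + b - alpha * (l' + l) = (a - alpha * l') + (b - alpha * l).
  by move=> *; ring.
apply: le_trans (ler_normD _ _) _.
have hl : 0 <= - l by exact: lw0.
have [Jj|jJ] := leqP J j.
  have h := hJ j (om j) Jj (com j); rewrite -/l in h.
  have -> : minn j.+1 J = minn j J by rewrite !(minn_idPr _)// leqW.
  lra.
have h := bs_exp1 hG (com j); rewrite -/l in h.
rewrite (minn_idPl jJ) big_ord_recr /=; rewrite (minn_idPl (ltnW jJ)) in IH.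
have /andP[_ h1] := hlam (om j ++ v); rewrite size_cat (bs_size hG (com j)) -/(b j) -/l in h1.
have h2 : 0 <= eps * - l by rewrite mulr_ge0// ltW.
lra.
Qed.

Lemma code_word_scale_index c om rho : code om -> 0 < rho <= c -> exists i,
  c * rw (cw om i.+1) < rho <= c * rw (cw om i).
Proof.
move=> com /andP[rho0 rhoc]; have c0 : 0 < c by exact: lt_le_trans rhoc.
have ex : exists i, c * rw (cw om i) < rho.
  have rc0 : 0 < rho / c / 2 by rewrite !divr_gt0.
  have [n hn] := weight_tail r01 rc0.
  exists n; rewrite -ltr_pdivlMl//.
  apply: le_lt_trans (hn _ (size_code_word n com)) _.
  by rewrite [ltRHS]mulrC ltr_pdivrMr// ltr_pMr ?ltr1n// mulr_gt0// invr_gt0.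
case: (ex_minnP ex) => -[|i] hi mini.
  by move: hi; rewrite /= weight_nil mulr1 ltNge rhoc.
exists i; rewrite hi leNgt; apply/negP => /mini; by rewrite ltnn.
Qed.

(** Every scale [rho] lies between the sizes of two consecutive cylinders of a
    path. As one block is negligible, both sizes are [rho] up to a small power,
    and both weights are about [rho ^ alpha]. *)
Lemma code_word_scale c eps : 0 < c -> 0 < eps -> exists2 C, 0 <= C &
  forall om rho, code om -> 0 < rho <= c -> rho < 1 -> exists i,
    [/\ c * rw (cw om i.+1) < rho <= c * rw (cw om i),
     `|ln (pw (cw om i)) - alpha * ln rho| <= eps * - ln rho + C &
     `|ln (pw (cw om i.+1)) - alpha * ln rho| <= eps * - ln rho + C].
Proof.
(* The error [e] enters at most twice through the exponent and [alpha] times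
   through the size, whence the factor [`|alpha| + 2]. *)
move=> c0 eps0; pose e := Num.min 1 (eps / (`|alpha| + 2)).
have a2 : 0 < `|alpha| + 2 by rewrite ltr_wpDl.
have e0 : 0 < e by rewrite lt_min ltr01 divr_gt0.
have e1 : e <= 1 by rewrite /e ge_min lexx.
have e2 : e * (`|alpha| + 2) <= eps.
  by rewrite -ler_pdivlMr// /e ge_min lexx orbT.
have [C1 C10 h1] := ln_code_word_step e0.
have [C2 C20 h2] := ln_code_word_exponent e0.
pose c1 := `|ln c|; have c10 : 0 <= c1 := normr_ge0 _.
pose C3 := 2 * c1 + C1; have C30 : 0 <= C3 by rewrite addr_ge0// mulr_ge0.
exists (`|alpha| * C3 + e * (C3 + c1) + C2).
  by rewrite !addr_ge0// mulr_ge0// ?(ltW e0)// addr_ge0.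
move=> om rho com rhoc rho1; have /andP[rho0 _] := rhoc.
have [i /andP[hi hi']] := code_word_scale_index com rhoc.
exists i; rewrite hi hi'.
have k1 : ln c + ln (rw (cw om i.+1)) <= ln rho.
  by rewrite -lnM ?posrE// ler_ln ?posrE ?mulr_gt0// ltW.
have k2 : ln rho <= ln c + ln (rw (cw om i)).
  by rewrite -lnM ?posrE// ler_ln ?posrE ?mulr_gt0.
have k3 := h1 om i com; have k4 := h2 om i com; have k5 := h2 om i.+1 com.
set L := - ln (rw (cw om i)) in k3 k4; set L' := - ln (rw (cw om i.+1)) in k3 k5.
have EL : ln (rw (cw om i)) = - L by rewrite opprK.
have EL' : ln (rw (cw om i.+1)) = - L' by rewrite opprK.
rewrite EL in k2 k4; rewrite EL' in k1 k5.
have kc := ler_norm (ln c); have kc' := ler_norm (- ln c); rewrite normrN -/c1 in kc kc'.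
have lrho : ln rho < 0 by rewrite ln_lt0// rho0.
set l := ln rho in k1 k2 lrho *.
have L1 : L <= - l + c1 by lra.
have L1' : - l - c1 <= L' by lra.
have eL : e * L <= e * (- l + c1) by rewrite ler_pM2l.
have ec1 : e * c1 <= c1 by rewrite ler_piMl.
have d1 : `|- L - l| <= e * - l + C3.
  by rewrite ler_norml /C3; apply/andP; split; lra.
have d2 : `|- L' - l| <= e * - l + C3.
  by rewrite ler_norml /C3; apply/andP; split; lra.
have el1 : e * - l <= - l by rewrite ler_piMl// oppr_ge0 ltW.
have fin (X : R) (P : R) : X <= 2 * - l + C3 + c1 -> `|- X - l| <= e * - l + C3 ->
    `|P - alpha * - X| <= e * X + C2 ->
    `|P - alpha * l| <= eps * - l + (`|alpha| * C3 + e * (C3 + c1) + C2).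
  move=> x1 x2 x3; have -> : P - alpha * l = (P - alpha * - X) + alpha * (- X - l) by ring.
  apply: le_trans (ler_normD _ _) _; rewrite normrM.
  have x4 := ler_wpM2l (normr_ge0 alpha) x2.
  have x5 : e * X <= e * (2 * - l + C3 + c1) by rewrite ler_pM2l.
  have x6 : e * (`|alpha| + 2) * - l <= eps * - l by rewrite ler_wpM2r// oppr_ge0 ltW.
  lra.
split=> //; [apply: (fin L)|apply: (fin L')] => //; rewrite /C3; lra.
Qed.

End CodeEstimates.

(** * The lower bound for Hausdorff dimensions *)

Section MoranSet.
Context {R : realType} {d N : nat} {T : 'I_N -> 'rV[R]_d -> 'rV[R]_d}.
Context {r p : 'I_N -> R} {K : set 'rV[R]_d} {mu : probability (borel_rV R d) R}.
Hypothesis H : global_ifs T r p K mu.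
Hypothesis diam0 : (0 < diam K)%E.

Local Notation rw := (weight_string r).
Local Notation pw := (weight_string p).
Local Notation Tw := (map_string T).
Local Notation Kw := (set_string T K).
Local Notation mass A := (fine (mu (A : set (borel_rV R d)))).
Local Notation D := (fine (diam K)).

Variables (v : seq 'I_N) (c : R).
Hypotheses (c0 : 0 < c) (isolating : forall u w x y,
  Kw (u ++ v) x -> Kw w y -> rw w <= rw (u ++ v) -> eucl_dist x y <= c * rw u -> prefix u w).
Variables (alpha t : R) (G : nat -> seq (seq 'I_N)) (len : nat -> nat).
Hypothesis hG : block_scheme r p alpha t v G len.
Local Notation cw := (code_word v).
Local Notation code om := (forall j, om j \in G j).

Let r01 := gi_ratio H.
Let rw0 := ratio_word_gt0 H.
Let pw0 := prob_word_gt0 H.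
Let D0 : 0 < D. Proof. exact: fine_diam_gt0 H diam0. Qed.
Let c' := c / rw v.
Let c'0 : 0 < c'. Proof. by rewrite divr_gt0. Qed.

Definition moran_set : set 'rV[R]_d :=
  [set x | exists om, code om /\ forall j, Kw (cw om j) x].

Lemma code_point om : exists x, forall j, Kw (cw om j) x.
Proof.
have [k0 Kk0] := gi_nonempty H.
have nested i j : (i <= j)%N -> Kw (cw om j) `<=` Kw (cw om i).
  elim: j => [|j IH]; first by rewrite leqn0 => /eqP ->.
  rewrite leq_eqVlt => /orP[/eqP ->//|]; rewrite ltnS => /IH; apply: subset_trans.
  exact: set_string_sub H _ _.
pose u j := Tw (cw om j) k0.
have [x [Kx clx]] : K `&` cluster (u j @[j --> \oo]) !=set0.
  apply: (gi_compact H); exists 0%N => // j _; exact: map_string_stable H _ _ Kk0.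
exists x => j; apply: (closed_set_string H) => B Bx.
have [y [Ay By]] : (Kw (cw om j) `&` B) !=set0; last by exists y.
apply: clx => //; exists j => // i /= ji; apply: (nested _ _ ji).
by exists k0.
Qed.

Lemma moran_set_neq0 : moran_set !=set0.
Proof.
have /choice[om com] : forall j, exists w, w \in G j.
  move=> j; have := bs_sum hG j; case: (G j) => [|w s _]; first by rewrite big_nil ler10.
  by exists w; rewrite mem_head.
by have [x hx] := code_point om; exists x, om.
Qed.

(** Between two consecutive cylinders of its path, the mass of a ball around a
    point of the Moran set is squeezed: it contains the smaller cylinder, and the
    block suffix [v] isolates it from everything outside the larger one. *)
Lemma moran_subset_level_set : moran_set `<=` level_set mu K alpha.
Proof.
move=> x [om [com hx]]; have Kx : K x by have [y Ky <-] := hx 0%N.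
split=> //.
apply/cvgrPdist_le => eps eps0.
have eps3 : 0 < eps / 3 by rewrite divr_gt0.
have [C1 C10 h1] := code_word_scale r01 (gi_p0 H) hG D0 eps3.
have [C2 C20 h2] := code_word_scale r01 (gi_p0 H) hG c'0 eps3.
pose C3 := C1 + C2 + `|ln (pw v)|.
have C30 : 0 <= C3 by rewrite !addr_ge0.
near=> rho.
have rho0 : 0 < rho by near: rho; exact: nbhs_right_gt.
have rho1 : rho < 1 by near: rho; exact: nbhs_right_lt.
have rhoD : rho <= D by near: rho; exact: nbhs_right_le.
have rhoc : rho <= c' * rw (cw om 1) by near: rho; apply: nbhs_right_le; rewrite mulr_gt0.
have rhoe : rho <= expR (- (C3 * 3 / eps)) by near: rho; apply: nbhs_right_le; exact: expR_gt0.
have rhoc' : rho <= c'.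
  by apply: le_trans rhoc _; rewrite ler_piMr ?(ltW c'0)// (ratio_word_le1 H).
have lrho : ln rho < 0 by rewrite ln_lt0// rho0.
have mass0 := mass_ball_gt0 H Kx rho0.
have lo : alpha * ln rho - eps / 3 * - ln rho - C1 <= ln (mass (eucl_ball x rho)).
  have [|i [/andP[hi _] _]] := h1 om rho com _ rho1; first by rewrite rho0.
  rewrite ler_distl => /andP[h _].
  apply: (@le_trans _ _ (ln (pw (cw om i.+1)))); first lra.
  rewrite ler_ln ?posrE//; apply: (mass_ge_word H); first exact: measurable_eucl_ball.
  move=> y Ky; rewrite /eucl_ball /=; apply: le_trans (set_string_dist H diam0 (hx _) Ky) _.
  by rewrite mulrC ltW.
have hi : ln (mass (eucl_ball x rho)) <= alpha * ln rho + eps / 3 * - ln rho + C2 - ln (pw v).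
  have [|i [/andP[hi hi'] h _]] := h2 om rho com _ rho1; first by rewrite rho0.
  move: h; rewrite ler_distl => /andP[_ h].
  apply: (@le_trans _ _ (ln (pw (cw om i)) - ln (pw v))); last by lra.
  case: i hi hi' h => [|i] hi hi' h; first by rewrite ltNge rhoc in hi.
  have hx' : Kw ((cw om i ++ om i) ++ v) x by rewrite -catA; exact: (hx i.+1).
  have pE : pw (cw om i.+1) = pw (cw om i ++ om i) * pw v by rewrite /= catA weight_cat.
  have rE : c' * rw (cw om i.+1) = c * rw (cw om i ++ om i).
    by rewrite /= catA weight_cat /c'; field; rewrite gt_eqF.
  rewrite pE lnM ?posrE// addrK ler_ln ?posrE//.
  apply: le_trans (isolating_word_mass H c0 isolating hx').
  apply: mass_le => [||y /=]; [exact: measurable_eucl_ball|exact: measurable_eucl_ball|].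
  by move=> xy; apply: le_trans xy _; rewrite -rE.
have lrhoe : C3 <= eps / 3 * - ln rho.
  have : C3 * 3 / eps <= - ln rho.
    by rewrite lerNr -(expRK (- _)) ler_ln ?posrE ?expR_gt0.
  rewrite ler_pdivrMr// => h; lra.
have nv := ler_norm (- ln (pw v)); rewrite normrN in nv.
have nv0 : 0 <= `|ln (pw v)| by [].
rewrite distrC /log_ratio.
rewrite (_ : _ - alpha = (ln (mass (eucl_ball x rho)) - alpha * ln rho) / ln rho); last first.
  by rewrite mulrBl mulfK// lt_eqF.
rewrite normrM normfV (ltr0_norm lrho) ler_pdivrMr ?oppr_gt0//.
rewrite ler_norml; apply/andP; split; rewrite /C3 in lrhoe; lra.
Unshelve. all: by end_near. Qed.

Lemma size_code_word_eq om om' j : code om -> code om' -> size (cw om j) = size (cw om' j).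
Proof.
move=> com com'; elim: j => //= j IH.
by rewrite !size_cat IH (bs_size hG (com j)) (bs_size hG (com' j)).
Qed.

Lemma code_word_inj om om' j : code om -> code om' -> cw om j = cw om' j ->
  mkseq om j = mkseq om' j.
Proof.
move=> com com'; elim: j => //= j IH /eqP.
rewrite eqseq_cat ?(size_code_word_eq j com com')// => /andP[/eqP/IH h].
rewrite eqseq_cat ?(bs_size hG (com j)) ?(bs_size hG (com' j))// => /andP[/eqP e _].
by rewrite !mkseqS h e.
Qed.

Lemma code_word_prefix om om' i J : code om -> code om' -> (i < J)%N ->
  prefix (cw om i ++ om i) (cw om' J) -> mkseq om i.+1 = mkseq om' i.+1.
Proof.
move=> com com' iJ; have [s ->] : exists s, cw om' J = (cw om' i ++ om' i) ++ s.
  elim: J iJ => // J IH; rewrite ltnS leq_eqVlt => /orP[/eqP <-|/IH[s e]].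
    by exists v; rewrite /= catA.
  by exists (s ++ (om' J ++ v)); rewrite /= e !catA.
rewrite prefixE => /eqP; rewrite take_size_cat; last first.
  by rewrite !size_cat (size_code_word_eq i com com') (bs_size hG (com i)) (bs_size hG (com' i)).
move=> /eqP; rewrite eqseq_cat ?(size_code_word_eq i com' com)// => /andP[/eqP e1 /eqP e2].
by rewrite !mkseqS (code_word_inj com com' (esym e1)) e2.
Qed.

(** As the normalising sum is at least [1], the product weight of a cylinder is at
    most the power [t] of its contraction ratio. *)
Definition block_mass j w := rw (w ++ v) `^ t / \sum_(u <- G j) rw (u ++ v) `^ t.

Let Z0 j : 0 < \sum_(u <- G j) rw (u ++ v) `^ t.
Proof. exact: lt_le_trans (bs_sum hG j). Qed.

Lemma block_mass_ge0 j w : 0 <= block_mass j w.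
Proof. by rewrite divr_ge0 ?powR_ge0// ltW. Qed.

Lemma block_mass_sum j : \sum_(w <- G j) block_mass j w = 1.
Proof. by rewrite -mulr_suml divff// gt_eqF. Qed.

Lemma cylinder_mass_le om j :
  cylinder_mass block_mass 0 (mkseq om j) <= rw (cw om j) `^ t.
Proof.
have cyl_rcons z w i : cylinder_mass block_mass i (rcons z w) =
    cylinder_mass block_mass i z * block_mass (i + size z) w.
  elim: z i => [|a z IH] i /=; first by rewrite mulr1 mul1r addn0.
  by rewrite IH mulrA addSnnS.
elim: j => [|j IH]; first by rewrite /= weight_nil powR1.
rewrite mkseqS cyl_rcons /= weight_cat powRM ?(ltW (rw0 _))//.
rewrite ler_pM ?block_mass_ge0 ?cylinder_mass_ge0//; first by move=> *; exact: block_mass_ge0.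
by rewrite /block_mass ler_pdivrMr// ler_peMr ?powR_ge0// size_mkseq add0n (bs_sum hG).
Qed.

(** By isolation, points of the Moran set at distance [delta] share their blocks
    down to scale [delta]; the last common cylinder is larger than [delta] by a
    negligible power only, which is absorbed in the loss from [t] to [s]. *)
Lemma moran_cylinder s : 0 < s < t -> exists2 C, 0 < C & forall om x delta,
  code om -> (forall j, Kw (cw om j) x) -> 0 < delta -> exists J,
    cylinder_mass block_mass 0 (mkseq om J) <= C * delta `^ s /\
    forall om' y, code om' -> (forall j, Kw (cw om' j) y) -> eucl_dist x y <= delta ->
      mkseq om' J = mkseq om J.
Proof.
move=> /andP[s0 st]; pose eps := t / s - 1.
have eps0 : 0 < eps by rewrite subr_gt0 ltr_pdivlMr// mul1r.
have [C C0 hC] := ln_code_word_step r01 hG eps0.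
have b0 : 0 < expR C / c' by rewrite divr_gt0 ?expR_gt0.
exists ((expR C / c') `^ s); first exact: powR_gt0.
move=> om x delta com hx delta0.
rewrite -powRM ?(ltW b0) ?(ltW delta0)//.
have b1 : 0 <= expR C / c' * delta := ltW (mulr_gt0 b0 delta0).
have [hd|hd] := ltP c' delta.
  exists 0%N; split=> //=; have -> : 1 = 1 `^ s by rewrite powR1.
  rewrite ge0_ler_powR ?(ltW s0) ?nnegrE ?b1//.
  rewrite mulrAC ler_pdivlMr// mul1r; apply: le_trans (ltW hd) _.
  by rewrite ler_peMl ?(ltW delta0)// -expR0 ler_expR.
have [|i /andP[hi1 hi2]] := code_word_scale_index r01 hG (c := c') (rho := delta) com.
  by rewrite delta0.
exists i; split.
  apply: le_trans (cylinder_mass_le om i) _.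
  rewrite (_ : t = t / s * s); last by rewrite divfK// gt_eqF.
  rewrite powRrM ge0_ler_powR ?(ltW s0) ?nnegrE ?powR_ge0 ?b1//.
  have e1 : 1 + eps = t / s by rewrite /eps addrC subrK.
  have := hC om i com; rewrite e1 => h.
  rewrite mulrAC ler_pdivlMr// mulrC -ler_pdivrMl ?expR_gt0// mulrCA.
  apply: le_trans (ltW hi1); rewrite ler_pM2l//.
  rewrite powR_expR// -expRN -expRD -[leRHS]lnK ?posrE// ler_expR; lra.
move=> om' y com' hy xy; case: i hi1 hi2 => [//|i] _ hi2.
have hx' : Kw ((cw om i ++ om i) ++ v) x by rewrite -catA; exact: (hx i.+1).
have rE : c' * rw (cw om i.+1) = c * rw (cw om i ++ om i).
  by rewrite /= catA weight_cat /c'; field; rewrite gt_eqF.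
(* A long prefix of the path of [y] is small enough for isolation to apply. *)
have [n hn] := ratio_word_small H (rw0 ((cw om i ++ om i) ++ v)).
pose J := maxn n i.+1.
apply/esym; apply: (code_word_prefix (J := J) com com'); first exact: leq_maxr.
apply: (isolating hx' (hy J)); last by rewrite -rE; exact: le_trans hi2.
apply: hn; apply: leq_trans (size_code_word hG J com'); exact: leq_maxl.
Qed.

(** Mass distribution: a covering of small [s]-dimensional sum would give cylinders
    of total mass less than [1] containing the whole Moran set. *)
Lemma le_dimH_moran_set : 0 < t -> (t%:E <= dimH moran_set)%E.
Proof.
move=> t0; rewrite /dimH ifF; last first.
  by apply/negbTE/set0P; exact: moran_set_neq0.
apply: le_ereal_inf_tmp => _ [s0 /= [s00 hs0] <-]; rewrite lee_fin leNgt; apply/negP => s0t.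
pose s := (s0 + t) / 2.
have s0s : s0 < s by rewrite /s; lra.
have st : 0 < s < t by rewrite /s; apply/andP; split; lra.
have /andP[spos _] := st.
have [C C0 hC] := moran_cylinder st.
pose e := (4 * C)^-1; have e0 : 0 < e by rewrite invr_gt0 mulr_gt0.
have : (hausdorff_premeasure s0 1 moran_set < e%:E)%E.
  apply: (@le_lt_trans _ _ 0%E); last by rewrite lte_fin.
  by rewrite -hs0; apply: ereal_sup_ubound; exists 1 => //=.
move=> /ereal_inf_lt[_ [E [covE diamE] <-] sumE].
pose e_ n := e / (2 ^ n.+1)%:R.
have en0 n : 0 < e_ n by rewrite divr_gt0// ltr0n expn_gt0.
have /choice[Z hZ] : forall n, exists z : option (seq (seq 'I_N)),
  ((oapp (cylinder_mass block_mass 0) 0 z)%:E <= C%:E * (diam_pow s0 (E n) + (e_ n)%:E))%E /\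
  forall om y, code om -> (forall j, Kw (cw om j) y) -> E n y ->
    exists z', z = Some z' /\ z' = mkseq om (size z').
  move=> n; have [[x [Ex [om [com hx]]]]|none] := pselect (E n `&` moran_set !=set0); last first.
    exists None; split=> [|om y com hy Ey]; last by case: none; exists y; split=> //; exists om.
    by rewrite /= mule_ge0 ?lee_fin ?(ltW C0)// adde_ge0 ?diam_pow_ge0// lee_fin ltW.
  have d0 : (0 <= diam (E n))%E by apply: diam_ge0; exists x.
  have dE : diam (E n) = (fine (diam (E n)))%:E.
    by rewrite fineK// ge0_fin_numE//; exact: le_lt_trans (diamE n) (ltry _).
  set dn := fine (diam (E n)) in dE.
  have dn0 : 0 <= dn by rewrite -lee_fin -dE.
  have dn1 : dn <= 1 by rewrite -lee_fin -dE diamE.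
  (* A covering set may be a single point; [tau] replaces its diameter at the cost
     of the summable error [e_ n]. *)
  pose tau := e_ n `^ s^-1.
  have tau0 : 0 < tau by exact: powR_gt0.
  have del0 : 0 < Num.max dn tau by rewrite lt_max tau0 orbT.
  have [J [hJ1 hJ2]] := hC om x _ com hx del0.
  exists (Some (mkseq om J)); split=> /= [|om' y com' hy Ey]; last first.
    exists (mkseq om J); split=> //; rewrite size_mkseq; apply/esym.
    apply: hJ2 com' hy _; rewrite le_max; apply/orP; left.
    by rewrite -lee_fin -dE; apply: ereal_sup_ubound; exists (x, y).
  have powE : diam_pow s0 (E n) = (dn `^ s0)%:E.
    by rewrite /diam_pow ifF//; apply/negbTE/set0P; exists x.
  rewrite powE -EFinD -EFinM lee_fin; apply: le_trans hJ1 _; rewrite ler_pM2l//.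
  have hdn : dn `^ s <= dn `^ s0.
    have [dn00|dnn] := eqVneq dn 0; first by rewrite dn00 powR0 ?gt_eqF// powR_ge0.
    by apply: ger_powR; [rewrite lt0r dnn dn0|exact: ltW].
  have htau : tau `^ s = e_ n by rewrite /tau -powRrM mulVf ?gt_eqF// powRr1// ltW.
  rewrite -htau; have [_|_] := leP dn tau.
    by rewrite lerDr powR_ge0.
  by rewrite (le_trans hdn)// lerDl powR_ge0.
have [|om [com hom]] := avoid_cylinders (bs_uniq hG) block_mass_ge0 block_mass_sum (Z := Z).
  apply: (@le_lt_trans _ _ (\sum_(0 <= n <oo) C%:E * (diam_pow s0 (E n) + (e_ n)%:E))%E).
    apply: lee_nneseries => [n _ _|n _]; last by have [] := hZ n.
    by rewrite lee_fin; case: (Z n) => //= z; apply: cylinder_mass_ge0; exact: block_mass_ge0.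
  rewrite nneseriesZl; last by move=> n _; rewrite adde_ge0 ?diam_pow_ge0// lee_fin ltW.
  apply: (@le_lt_trans _ _ (C%:E * (\sum_(0 <= n <oo) diam_pow s0 (E n) + e%:E))%E).
    rewrite lee_wpmul2l ?lee_fin ?(ltW C0)//.
    by apply: epsilon_trick; [move=> n; exact: diam_pow_ge0|exact: ltW].
  apply: (@lt_le_trans _ _ (C%:E * (e%:E + e%:E))%E).
    by rewrite lte_pmul2l ?lte_fin//; apply: lte_leD.
  by rewrite -EFinD -EFinM lee_fin /e (_ : C * _ = 2^-1) ?invf_le1 ?ler1n//; field; rewrite gt_eqF.
have [x hx] := code_point om.
have [n _ Ex] : (\bigcup_n E n) x by apply: covE; exists om.
have [_ /(_ om x com hx Ex)[z [Zn zE]]] := hZ n.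
exact: hom n z Zn zE.
Qed.

Lemma le_dimH_level_set : (t%:E <= dimH (level_set mu K alpha))%E.
Proof.
apply: le_trans (dimH_mono moran_subset_level_set).
have [t0|t0] := leP t 0; last exact: le_dimH_moran_set.
rewrite /dimH ifF; last by apply/negbTE/set0P; exact: moran_set_neq0.
apply: le_ereal_inf_tmp => _ [s /= [s0 _] <-]; rewrite lee_fin; exact: le_trans s0.
Qed.

End MoranSet.

(** * The theorem *)

Section Extension.
Context {R : realType} {d N : nat}.
Variables (V X K : set 'rV[R]_d) (S : 'I_N -> 'rV[R]_d -> 'rV[R]_d).
Variables (r p : 'I_N -> R) (mu : probability (borel_rV R d) R).
Hypotheses (hS : similarity_cifs V X S r) (hK : self_similar_set X S K).
Hypotheses (hp : probability_vector p) (hp0 : forall i, 0 < p i).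
Hypothesis hmu : self_similar_measure V S p mu.

Let KV x : K x -> V x. Proof. by move=> /(sss_subset hK); exact: cifs_subset hS _. Qed.

Let SV i x : V x -> V (S i x).
Proof. by move=> Vx; apply: (cifs_stableV hS); exists x. Qed.

Lemma mass_ambient (A : set (borel_rV R d)) : measurable A -> mu (V `&` A) = mu A.
Proof.
have mV : measurable (V : set (borel_rV R d)) by apply: measurable_open; exact: cifs_open hS.
have muV : mu V = 1%E.
  have := hmu (@measurableT _ (borel_rV R d)); rewrite probability_setT => ->.
  under eq_bigr do rewrite preimage_setT setIT.
  by rewrite -ge0_sume_distrl ?sumEFin ?(proj2 hp) ?mul1e// => i _; rewrite lee_fin ltW.
have muVC : mu (~` V) = 0%E by rewrite probability_setC// muV subee.
move=> mA; have AV0 : mu (A `\` V) = 0%E.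
  apply: (@subset_measure0 _ _ _ mu _ (~` V)) => //.
  - exact: measurableD.
  - exact: measurableC.
rewrite setIC; apply/esym; apply: etrans (measureDI mu mA mV) _.
by rewrite -[X in (X + _)%E]/(mu (A `\` V)) AV0 add0e.
Qed.

Lemma global_extension : exists T : 'I_N -> 'rV[R]_d -> 'rV[R]_d,
  (forall i x, V x -> T i x = S i x) /\ global_ifs T r p K mu.
Proof.
have [k0 Kk0] := sss_nonempty hK.
have r0 i : 0 < r i by case/andP: (cifs_ratio hS i).
have /choice[T hT] : forall i, exists f : 'rV[R]_d -> 'rV[R]_d,
    [/\ forall x, V x -> f x = S i x,
        forall x y, eucl_dist (f x) (f y) = r i * eucl_dist x y
      & forall y, exists x, f x = y].
  move=> i; apply: (similarity_extension (cifs_open hS) _ (r0 i) (cifs_similarity hS i)).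
  by exists k0; exact: KV.
have TS i x : V x -> T i x = S i x by have [h _ _] := hT i; exact: h.
have simT i x y : eucl_dist (T i x) (T i y) = r i * eucl_dist x y by have [_ h _] := hT i.
exists T; split=> //; split=> //.
- exact: cifs_ratio hS.
- by move=> i y; have [_ _ h] := hT i; exact: h.
- by exists k0.
- exact: sss_compact hK.
- rewrite {1}(sss_fixed hK); apply: eq_bigcupr => i _.
  by apply/seteqP; split=> _ [x Kx <-]; exists x => //; rewrite TS//; exact: KV.
- exact: (proj2 hp).
- move=> A mA; rewrite hmu//; apply: eq_bigr => i _; congr (_ * _)%E.
  have mTA : measurable (T i @^-1` A : set (borel_rV R d)).
    by apply: measurable_preimage_continuous => //; exact: continuous_similarity (r0 i) (simT i).
  rewrite -(mass_ambient mTA); congr (mu _).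
  by apply/seteqP; split=> x [Vx /=]; rewrite ?TS// => h; split=> //=; rewrite TS.
Qed.

Variable T : 'I_N -> 'rV[R]_d -> 'rV[R]_d.
Hypothesis TS : forall i x, V x -> T i x = S i x.

Lemma set_string_extension w : set_string S K w = set_string T K w.
Proof.
have h x : V x -> map_string T w x = map_string S w x /\ V (map_string S w x).
  elim: w => [//|i w IH] Vx /=; have [-> Vw] := IH Vx.
  by rewrite TS//; split=> //; exact: SV.
by apply/seteqP; split=> _ [x Kx <-]; exists x => //; have [] := h x (KV Kx).
Qed.

Lemma open_set_condition_separated :
  global_ifs T r p K mu -> open_set_condition X S -> separated_orbits T r.
Proof.
move=> H [U [openU U0 _ UX [stU disjU]]].
have TSU i : T i @` U = S i @` U.
  by apply/seteqP; split=> _ [x Ux <-]; exists x => //; rewrite TS//; exact/(cifs_subset hS)/UX.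
apply: (open_set_separated H openU U0) => [i|i j ij]; first by rewrite TSU.
by rewrite !TSU disjU.
Qed.

End Extension.

Section Spectrum.
Context {R : realType} {d N : nat} {T : 'I_N -> 'rV[R]_d -> 'rV[R]_d}.
Context {r p : 'I_N -> R} {K : set 'rV[R]_d} {mu : probability (borel_rV R d) R}.
Hypothesis H : global_ifs T r p K mu.
Hypothesis diam0 : (0 < diam K)%E.
Hypothesis sepT : separated_orbits T r.
Variable beta : R -> R.
Hypothesis hbeta : forall q, \sum_(i < N) p i `^ q * r i `^ beta q = 1.

Lemma level_set_sub_acc_set (C : set R) alpha : C alpha ->
  level_set mu K alpha `<=` acc_set mu K C.
Proof.
move=> Ca x [Kx cvx]; split=> // y cly.
suff -> : y = alpha by [].
by apply/esym/(@norm_hausdorff _ R^o); exact: cvg_cluster cvx _ cly.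
Qed.

(** Moran sets exist for every [t] below the Legendre transform. *)
Lemma legendre_le_dimH alpha :
  (legendre beta alpha <= dimH (level_set mu K alpha))%E.
Proof.
rewrite leNgt; apply/negP => /ereal_between[t [ht1 ht2]].
have [v [c [c0 isolating]]] := isolating_word H sepT diam0.
have [G [len hG]] := exists_block_scheme (gi_ratio H) (gi_p0 H) hbeta v ht2.
have := le_dimH_level_set H diam0 c0 isolating hG.
by rewrite leNgt ht1.
Qed.

(** The level sets lie in the accumulation set, whose dimension is at most the
    supremum of the Legendre transform, while each level set has at least the
    dimension predicted by it. *)
Lemma multifractal_formalism (C : set R) : closed C ->
  let sup_dimH := ereal_sup [set dimH (level_set mu K alpha) | alpha in C] in
  sup_dimH = ereal_sup [set legendre beta alpha | alpha in C] /\
  dimH (acc_set mu K C) = ereal_sup [set legendre beta alpha | alpha in C].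
Proof.
move=> cC sup_dimH; have [k0 Kk0] := gi_nonempty H.
have h1 : (ereal_sup [set legendre beta alpha | alpha in C] <= sup_dimH)%E.
  apply: ge_ereal_sup => _ [alpha Ca <-]; apply: le_trans (legendre_le_dimH alpha) _.
  by apply: ereal_sup_ubound; exists alpha.
have h2 : (sup_dimH <= dimH (acc_set mu K C))%E.
  apply: ge_ereal_sup => _ [alpha Ca <-]; apply: dimH_mono.
  exact: level_set_sub_acc_set.
have h3 := dimH_acc_set_le H diam0 hbeta sepT Kk0 cC.
split; apply/eqP; rewrite eq_le.
  by rewrite (le_trans h2 h3).
by rewrite h3 (le_trans h1 h2).
Qed.

Lemma dimH_level_set alpha : dimH (level_set mu K alpha) = legendre beta alpha.
Proof.
have [+ _] := multifractal_formalism (@closed_eq _ alpha).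
by rewrite !image_set1 !ereal_sup1.
Qed.

End Spectrum.

Theorem theorem3p6 (R : realType) (d N : nat)
    (V X : set 'rV[R]_d) (S : 'I_N -> 'rV[R]_d -> 'rV[R]_d) (r : 'I_N -> R)
    (K : set 'rV[R]_d) (p : 'I_N -> R) (mu : probability (borel_rV R d) R)
    (beta : R -> R) (C : set R)
    (hS : similarity_cifs V X S r)
    (hK : self_similar_set X S K)
    (* K is not a singleton, i.e. every [log diam K_w] is defined *)
    (hdiam : (0 < diam K)%E)
    (hp : probability_vector p) (hp0 : forall i, 0 < p i)
    (hmu : self_similar_measure V S p mu)
    (hbeta : forall q, \sum_(i < N) p i `^ q * r i `^ beta q = 1)
    (hC : closed C) :
  let sup_legendre := ereal_sup [set legendre beta alpha | alpha in C] in
  let sup_dimH := ereal_sup [set dimH (level_set mu K alpha) | alpha in C] in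
  let meets := interior C `&`
    [set t | (min_exponent p r < t%:E)%E /\ (t%:E < max_exponent p r)%E] !=set0 in
  (* (1.1) *)
  [/\ (sigma_ab (zeta_sim_nbhd S r p K C rho) @[rho --> 0^'+] --> sup_legendre)
      /\ (forall alpha : R,
          sigma_ab (zeta_sim_nbhd S r p K [set alpha] rho) @[rho --> 0^'+] -->
          legendre beta alpha),
  (* (1.2) *)
      open_set_condition X S ->
      [/\ sigma_ab (zeta_sim_nbhd S r p K C rho) @[rho --> 0^'+] --> sup_dimH,
          sup_dimH = dimH (acc_set mu K C)
        & forall alpha : R,
          sigma_ab (zeta_sim_nbhd S r p K [set alpha] rho) @[rho --> 0^'+] -->
          dimH (level_set mu K alpha)],
  (* (2.1) *)
      is_interval C -> meets -> sigma_ab (zeta_sim S r p K C) = sup_legendre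
  (* (2.2) *)
    & is_interval C -> meets -> open_set_condition X S ->
      sigma_ab (zeta_sim S r p K C) = sup_dimH /\
      sup_dimH = dimH (acc_set mu K C)].
Proof.
move=> sup_legendre sup_dimH meets.
have [T [TS H]] := global_extension hS hK hp hp0 hmu.
have D0 := fine_diam_gt0 H hdiam.
have diamE w : fine (diam (set_string S K w)) = weight_string r w * fine (diam K).
  by rewrite (set_string_extension hS hK TS) (diam_set_string H hdiam).
have r01 := gi_ratio H; have p1 := gi_p1 H.
have cvgC := sigma_nbhd_cvg r01 hp0 p1 hbeta D0 diamE hC.
have cvg1 := sigma_nbhd_cvg1 r01 hp0 p1 hbeta D0 diamE.
have formalism osc := multifractal_formalism H hdiam
  (open_set_condition_separated hS TS H osc) hbeta hC.
split=> [//|osc|iC mC|iC mC osc].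
- have [eq_sup eq_acc] := formalism osc; rewrite /sup_dimH eq_sup; split=> // alpha.
  rewrite (dimH_level_set H hdiam (open_set_condition_separated hS TS H osc) hbeta).
  exact: cvg1.
- exact: sigma_zeta_interval r01 hp0 p1 hbeta D0 diamE _ hC iC mC.
- have [eq_sup eq_acc] := formalism osc; rewrite /sup_dimH eq_sup; split=> //.
  exact: sigma_zeta_interval r01 hp0 p1 hbeta D0 diamE _ hC iC mC.
Qed.
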